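(* Let $X,Y$ be real separable Hilbert spaces, $H\in(\tfrac12,1)$, $\tau>0$, $T>0$, and let $B^H$ be the $Y$-valued fractional Brownian motion with Hurst parameter $H$ and trace-class covariance operator $Q$ described in the context. Let $\{A(t)\}_{t\in[0,T]}$ be a family of closed densely defined linear operators on $X$, with domain independent of $t$, satisfying the Acquistapace–Terreni conditions stated in the context, and let $\{U(t,s):0\le s\le t\le T\}$ be the evolution family it generates. Let $f,g:[0,T]\times X\to X$, $\sigma:[0,T]\to\mathcal L_2^0(Y,X)$ (measurable), $r,\rho:[0,\infty)\to[0,\tau]$ and $\varphi:[-\tau,0]\to L^2(\Omega,X)$ be given. Assume: (1) There are constants $\beta>0$, $M\ge 1$ with $\|U(t,s)\|\le Me^{-\beta(t-s)}$ for all $0\le s\le t\le T$; and each $A(t)$ is invertible with bounded inverse, with a constant $M_*>0$ such that $\|A(t)^{-1}\|\le M_*$ for all $t\in[0,T]$. (2) $f$ and $g$ are continuous, $g(t,x)\in D(A(t))$ for all $(t,x)$, and there are constants $C_1,C_2>0$ such that for all $t\in[0,T]$, $x,y\in X$: $$\|f(t,x)-f(t,y)\|\le C_1\|x-y\|,\qquad \|g(t,x)-g(t,y)\|\le C_1\|x-y\|,$$ $$\|f(t,x)\|^2\le C_2(1+\|x\|^2),\qquad \|A(t)^kg(t,x)\|^2\le C_2(1+\|x\|^2)\ \ (k=0,1).$$ (3) There is a constant $0<L_*<1/M_*$ such that $\|A(t)g(t,x)-A(t)g(t,y)\|\le L_*\|x-y\|$ for all $t\in[0,T]$, $x,y\in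 X$; and for every $x(\cdot)\in C([0,T],L^2(\Omega,X))$ and every $s\in[0,T]$, $\lim_{t\to s}\mathbb E\|g(t,x(t))-g(s,x(s))\|^2=0$. (4) There is a constant $L>0$ with $\|\sigma(t)\|_{\mathcal L_2^0}\le L$ for all $t\in[0,T]$; the functions $r,\rho$ are continuous (so that $-\tau\le t-r(t)\le t$ and $-\tau\le t-\rho(t)\le t$ for all $t\ge 0$); and $\varphi\in C([-\tau,0],L^2(\Omega,X))$. Then the equation $$\begin{cases} d[x(t)+g(t,x(t-r(t)))]=[A(t)x(t)+f(t,x(t-\rho(t)))]\,dt+\sigma(t)\,dB^H(t), & 0\le t\le T,\\ x(t)=\varphi(t), & -\tau\le t\le 0,\end{cases}$$ has a unique mild solution on $[-\tau,T]$. That is, there is exactly one $x\in C([-\tau,T],L^2(\Omega,X))$ with $x(t)=\varphi(t)$ for $t\in[-\tau,0]$ such that for every $t\in[0,T]$, $\mathbb P$-a.s., $$x(t)=U(t,0)\big(\varphi(0)+g(0,\varphi(-r(0)))\big)-g(t,x(t-r(t)))-\int_0^tU(t,s)A(s)g(s,x(s-r(s)))\,ds+\int_0^tU(t,s)f(s,x(s-\rho(s)))\,ds+\int_0^tU(t,s)\sigma(s)\,dB^H(s).$$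
   Context: **Evolution families.** An evolution family on $X$ is a set $\{U(t,s):0\le s\le t\le T\}$ of bounded linear operators with $U(t,s)U(s,r)=U(t,r)$ for $r\le s\le t$, $U(s,s)=I$, and $(t,s)\mapsto U(t,s)x$ continuous for $t>s$ for each $x\in X$. **Acquistapace–Terreni conditions** (resolvents and spectra understood in the complexification of $X$). There are constants $\lambda_0\ge0$, $\theta\in(\frac\pi2,\pi)$, $L_0,K\ge 0$, $\mu,\nu\in(0,1]$ with $\mu+\nu>1$ such that, with $\Sigma_\theta=\{\lambda\in\mathbb C\setminus\{0\}:|\arg\lambda|\le\theta\}$, for all $t,s\in[0,T]$ and $\lambda\in\Sigma_\theta$: $\Sigma_\theta\cup\{0\}$ is contained in the resolvent set of $A(t)-\lambda_0$, $$\|R(\lambda,A(t)-\lambda_0)\|\le\frac{K}{1+|\lambda|},\qquad \|(A(t)-\lambda_0)R(\lambda,A(t)-\lambda_0)[R(\lambda_0,A(t))-R(\lambda_0,A(s))]\|\le L_0|t-s|^\mu|\lambda|^{-\nu}.$$ It is well known that these imply that there is a unique evolution family $\{U(t,s)\}$ on $X$ such that $(t,s)\mapsto U(t,s)\in\mathcal L(X)$ is continuous for $t>s$, $U(\cdot,s)$ is $C^1$ on $t>s$ with values in $\mathcal L(X)$, $\partial_tU(t,s)=A(t)U(t,s)$, $\|A(t)^kU(t,s)\|\le C(t-s)^{-k}$ for $0<t-s\le1$, $k=0,1$, and $\partial_s^+U(t,s)x=-U(t,s)A(s)x$ for $t>s$ and $x\in D(A(s))$ with $A(s)x\in\overline{D(A(s))}$.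 One says that $A(\cdot)$ generates $\{U(t,s)\}$. **Noise.** $(\Omega,\mathcal F,\mathbb P)$ is a complete probability space. A standard real fractional Brownian motion (fBm) $\beta^H$ is a centered continuous Gaussian process with $\mathbb E[\beta^H(t)\beta^H(s)]=\frac12(t^{2H}+s^{2H}-|t-s|^{2H})$. Let $\{e_n\}_{n\ge1}$ be a complete orthonormal basis of $Y$, $\lambda_n\ge0$ with $\sum_n\lambda_n<\infty$, and $Qe_n=\lambda_ne_n$. Then $B^H(t)=\sum_{n\ge1}\sqrt{\lambda_n}\,e_n\beta_n^H(t)$, with $\beta^H_n$ independent standard real fBm's of Hurst parameter $H$. $\mathcal L_2^0=\mathcal L_2^0(Y,X)$ is the space of $Q$-Hilbert–Schmidt operators: $\psi\in\mathcal L(Y,X)$ with $\|\psi\|_{\mathcal L_2^0}^2:=\sum_n\lambda_n\|\psi e_n\|^2<\infty$. Measurability of an $\mathcal L_2^0$-valued function $\phi$ means that $s\mapsto\phi(s)e_n$ is measurable for every $n$. **Wiener integral.** For deterministic measurable $\phi:[0,t]\to\mathcal L_2^0$ with $\int_0^t\|\phi(s)\|^2_{\mathcal L_2^0}ds<\infty$, $$\int_0^t\phi(s)\,dB^H(s)=\sum_{n\ge1}\int_0^t\sqrt{\lambda_n}\,\phi(s)e_n\,d\beta_n^H(s)=\sum_{n\ge1}\int_0^t\sqrt{\lambda_n}\,\big(K_H^*(\phi e_n)\big)(s)\,d\beta_n(s),$$ where $\beta_n$ is the Wiener process with $\beta_n^H(t)=\int_0^tK_H(t,s)\,d\beta_n(s)$,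 $K_H(t,s)=c_Hs^{\frac12-H}\int_s^t(u-s)^{H-\frac32}u^{H-\frac12}du$ for $t>s$, $c_H=\sqrt{H(2H-1)/\mathrm{B}(2-2H,H-\frac12)}$ with $\mathrm B$ the Beta function, and $(K_H^*h)(s)=\int_s^th(u)\frac{\partial K_H}{\partial u}(u,s)\,du$. Equivalently, each $\int_0^th\,d\beta_n^H$ is the continuous linear extension of $1_{[0,a]}v\mapsto\beta_n^H(a)v$ ($v\in X$) to $h\in L^2([0,t],X)$.
   Formalization: The generated evolution family is additionally required to satisfy U(t,s)x → x as t → s+ for every x; without this, U(t,s)=0 for t>s meets all the listed properties and the claim fails. *)

(* Defs.v *)
From HB Require Import structures.
From mathcomp Require Import all_boot all_order all_algebra.
From mathcomp Require Import complex.
From mathcomp Require Import all_classical all_reals all_analysis.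

Set Implicit Arguments.
Unset Strict Implicit.
Unset Printing Implicit Defensive.

Import Order.TTheory GRing.Theory Num.Theory.
Import numFieldNormedType.Exports.

Local Open Scope classical_set_scope.
Local Open Scope ring_scope.
Local Open Scope complex_scope.

HB.mixin Record NormedModule_isInnerProduct (R : realType) V
    & NormedModule R V := {
  dot : V -> V -> R ;
  dotC : forall x y, dot x y = dot y x ;
  dotPl : forall (a : R) x y z, dot (a *: x + y) z = a * dot x z + dot y z ;
  dotxx : forall x, dot x x = `|x| ^+ 2
}.

#[short(type="hilbertType")]
HB.structure Definition Hilbert (R : realType) :=
  {V of CompleteNormedModule R V & NormedModule_isInnerProduct R V}.

Definition separable (X : topologicalType) : Prop :=
  exists2 D : set X, countable D & dense D.

(* A basis (e_n)_(n >= 1) corresponds to [J = setT]; a finite [J] covers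
   finite-dimensional [Y]. *)
Definition orthonormal_basis (R : realType) (Y : hilbertType R)
    (J : set nat) (e : nat -> Y) : Prop :=
  (forall i j, J i -> J j -> dot (e i) (e j) = (i == j)%:R) /\
  (forall y : Y,
    \sum_(0 <= i < n | i \in J) dot y (e i) *: e i @[n --> \oo] --> y).

Section Operators.
Context (R : realType).

(* Operator norm with respect to explicitly given norms on source and target
   (the Hilbert norm of the complexification, see [cnorm], is not the product
   norm of [X * X]). *)
Definition opnorm (V W : Type) (NV : V -> R) (NW : W -> R) (F : V -> W)
    : \bar R :=
  ereal_sup [set (NW (F v))%:E | v in [set v | NV v <= 1]].

Definition normL (V W : normedModType R) (F : V -> W) : \bar R :=
  opnorm Num.norm Num.norm F.

Definition bounded_linear (V W : normedModType R) (F : V -> W) : Prop :=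
  linear F /\ (normL F < +oo)%E.

(* Values outside the domain are irrelevant. *)
Record operator (X : Type) := Operator {
  dom : set X ;
  opval :> X -> X
}.

Definition op_linear (X : lmodType R) (B : operator X) : Prop :=
  dom B 0 /\
  forall (a : R) (x y : X), dom B x -> dom B y ->
    dom B (a *: x + y) /\ B (a *: x + y) = a *: B x + B y.

Definition op_closed (X : normedModType R) (B : operator X) : Prop :=
  closed [set z : X * X | dom B z.1 /\ z.2 = B z.1].

Definition closed_densely_defined (X : normedModType R) (B : operator X)
    : Prop :=
  [/\ op_linear B, op_closed B & closure (dom B) = setT].

Definition op_inv (X : normedModType R) (B : operator X) : X -> X :=
  pinv (dom B) B.

Definition boundedly_invertible (X : normedModType R) (B : operator X) : Prop :=
  set_bij (dom B) setT B /\ (normL (op_inv B) < +oo)%E.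

Definition op_shift (X : lmodType R) (B : operator X) (c : R) : operator X :=
  Operator (dom B) (fun x => B x - c *: x).

(* The complexification of [X] is [X * X], with (x, y) standing for x + iy. *)
Definition cnorm (X : normedModType R) (z : X * X) : R :=
  Num.sqrt (`|z.1| ^+ 2 + `|z.2| ^+ 2).

Definition normC (X : normedModType R) (F : X * X -> X * X) : \bar R :=
  opnorm (@cnorm X) (@cnorm X) F.

Definition complex_scale (X : lmodType R) (l : R[i]) (z : X * X) : X * X :=
  (complex.Re l *: z.1 - complex.Im l *: z.2,
   complex.Re l *: z.2 + complex.Im l *: z.1).

Definition op_complex (X : Type) (B : operator X) : operator (X * X) :=
  Operator [set z | dom B z.1 /\ dom B z.2] (fun z => (B z.1, B z.2)).

Definition resolvent (X : normedModType R) (B : operator X) (l : R[i])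
    : X * X -> X * X :=
  pinv (dom (op_complex B)) (fun z => complex_scale l z - op_complex B z).

Definition resolvent_set (X : normedModType R) (B : operator X)
    : set R[i] :=
  [set l | set_bij (dom (op_complex B)) setT
             (fun z => complex_scale l z - op_complex B z) /\
           (normC (resolvent B l) < +oo)%E].

(* The nonzero complex numbers with principal argument in [-theta, theta]
   (for theta < pi), in polar form. *)
Definition sector (theta : R) : set R[i] :=
  [set l | exists2 r : R, 0 < r &
           exists2 a : R, `|a| <= theta & l = (r * cos a) +i* (r * sin a)].

Definition acquistapace_terreni (X : normedModType R) (T : R)
    (A : R -> operator X) : Prop :=
  exists (lambda0 theta L0 K mu nu : R),
  [/\ 0 <= lambda0,
      pi / 2 < theta < pi,
      0 <= L0 /\ 0 <= K,
      [/\ 0 < mu <= 1, 0 < nu <= 1 & 1 < mu + nu] &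
      forall t s : R, 0 <= t <= T -> 0 <= s <= T ->
        let At := op_shift (A t) lambda0 in
        sector theta `|` [set 0] `<=` resolvent_set At /\
        forall l, sector theta l ->
          let G z := op_complex At (resolvent At l
            (resolvent (A t) lambda0%:C z - resolvent (A s) lambda0%:C z)) in
          let absl := ComplexField.Normc.normc l in
          (normC (resolvent At l) <= (K / (1 + absl))%:E)%E /\
          (normC G <= (L0 * `|t - s| `^ mu * absl `^ (- nu))%:E)%E].

Definition evolution_family (X : normedModType R) (T : R)
    (U : R -> R -> X -> X) : Prop :=
  [/\ forall t s : R, 0 <= s -> s <= t -> t <= T -> bounded_linear (U t s),
      forall t s r : R, 0 <= r -> r <= s -> s <= t -> t <= T ->
        forall x, U t s (U s r x) = U t r x,
      forall s : R, 0 <= s <= T -> forall x, U s s x = x &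
      forall x, {within [set p : R * R | 0 <= p.2 < p.1 /\ p.1 <= T],
        continuous (fun p => U p.1 p.2 x)}].

(* The penultimate clause is strong continuity at the diagonal.  It is what
   ties U(t, s), t > s, to the initial value U(s, s) = I: without it the family
   with U(t, s) = 0 for t > s would satisfy all the other clauses, whatever A,
   and the generated family would not be unique. *)
Definition generates (X : normedModType R) (T : R) (A : R -> operator X)
    (U : R -> R -> X -> X) : Prop :=
  let Delta := [set p : R * R | 0 <= p.2 < p.1 /\ p.1 <= T] in
  evolution_family T U /\
  [/\ forall q, Delta q ->
        normL (fun x => U p.1 p.2 x - U q.1 q.2 x)
          @[p --> within Delta (nbhs q)] --> 0%E,
      (* U(., s) is C^1 on ]s, T], with derivative A(t)U(t, s) *)
      forall t s : R, 0 <= s < t -> t <= T ->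
        [/\ forall x, dom (A t) (U t s x),
            bounded_linear (fun x => A t (U t s x)),
            normL (fun x => (t' - t)^-1 *: (U t' s x - U t s x)
                              - A t (U t s x))
              @[t' --> within `]s, T] t^'] --> 0%E &
            normL (fun x => A t' (U t' s x) - A t (U t s x))
              @[t' --> within `]s, T] (nbhs t)] --> 0%E],
      exists C : R, forall t s : R, 0 <= s < t -> t <= T -> t - s <= 1 ->
        (normL (U t s) <= C%:E)%E /\
        (normL (fun x => A t (U t s x)) <= (C / (t - s))%:E)%E,
      forall (s : R) (x : X), 0 <= s < T -> U t s x @[t --> s^'+] --> x &
      forall (t s : R) (x : X), 0 <= s < t -> t <= T ->
        dom (A s) x -> closure (dom (A s)) (A s x) ->
        h^-1 *: (U t (s + h) x - U t s x) @[h --> (0 : R)^'+]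
          --> - U t s (A s x)].

End Operators.

Section SquareIntegrable.
Context (R : realType) (d : measure_display) (S : measurableType d).
Context (mu : {measure set S -> \bar R}) (X : normedModType R).

Definition borel_fun (D : set S) (h : S -> X) : Prop :=
  measurable_fun D (h : S -> g_sigma_algebraType (@open X)).

Definition L2norm (D : set S) (h : S -> X) : \bar R :=
  Lnorm mu 2%:E ((fun u => `|h u|%:E) \_ D).

Definition L2 (D : set S) (h : S -> X) : Prop :=
  borel_fun D h /\ (L2norm D h < +oo)%E.

End SquareIntegrable.

Section L2Processes.
Context (R : realType) (d : measure_display) (Omega : measurableType d).
Context (P : probability Omega R).

Definition continuous_L2 (X : normedModType R) (a b : R)
    (x : R -> Omega -> X) : Prop :=
  forall t : R, a <= t <= b ->
    L2 P setT (x t) /\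
    L2norm P setT (x s \- x t) @[s --> within `[a, b] (nbhs t)] --> 0%E.

(* [Z] is the Bochner integral over [0, t] of the L^2(Omega, X)-valued function
   [Phi]: simple functions [\sum_i \1_(E k i) *: V k i] tend to [Phi] almost
   everywhere and in L^1([0, t], L^2(Omega, X)), and their integrals tend to
   [Z]. *)
Definition is_bochner_integral (X : normedModType R) (t : R)
    (Phi : R -> Omega -> X) (Z : Omega -> X) : Prop :=
  let mu := @lebesgue_measure R in
  [/\ forall s : R, 0 <= s <= t -> L2 P setT (Phi s),
      L2 P setT Z &
      exists (m : nat -> nat) (E : nat -> nat -> set R)
             (V : nat -> nat -> Omega -> X),
      let simple k s w := \sum_(i < m k) \1_(E k i) s *: V k i w in
      let simple_int k w := \sum_(i < m k) fine (mu (E k i)) *: V k i w in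
      [/\ forall k i, [/\ measurable (E k i), E k i `<=` `[0, t] &
                          L2 P setT (V k i)],
          {ae mu, forall s, 0 <= s <= t ->
             L2norm P setT (simple k s \- Phi s) @[k --> \oo] --> 0%E},
          (\int[mu]_(s in `[0%R, t]) L2norm P setT (simple k s \- Phi s)%R
             @[k --> \oo] --> 0)%E &
          L2norm P setT (simple_int k \- Z) @[k --> \oo] --> 0%E]].

(* [normal_prob m 0] is not a Dirac measure in the library, hence the separate
   degenerate case. *)
Definition gaussian (Z : Omega -> R) : Prop :=
  measurable_fun setT Z /\
  exists m : R,
    (forall B : set R, measurable B -> P (Z @^-1` B) = \d_m B) \/
    (exists2 s : R, 0 < s &
      forall B : set R, measurable B -> P (Z @^-1` B) = normal_prob m s B).

(* A process is Gaussian when all linear combinations of its values are. *)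
Definition gaussian_process (T : R) (b : R -> Omega -> R) : Prop :=
  forall s : seq (R * R), (forall p, p \in s -> 0 <= p.2 <= T) ->
    gaussian (fun w => \sum_(p <- s) p.1 * b p.2 w).

Definition is_fBm (H T : R) (b : R -> Omega -> R) : Prop :=
  [/\ gaussian_process T b,
      forall t : R, 0 <= t <= T -> 'E_P[b t]%E = 0%E,
      {ae P, forall w, {within `[0, T], continuous (b ^~ w)}} &
      forall t s : R, 0 <= t <= T -> 0 <= s <= T ->
        'E_P[b t \* b s]%E =
        (2^-1 * (t `^ (2 * H) + s `^ (2 * H) - `|t - s| `^ (2 * H)))%:E].

Definition sigma_process (T : R) (b : R -> Omega -> R) : set (set Omega) :=
  <<s [set C | exists t : R, 0 <= t <= T /\
               exists2 B : set R, measurable B & C = b t @^-1` B] >>.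

Definition independent_processes (T : R) (J : set nat)
    (b : nat -> R -> Omega -> R) : Prop :=
  forall (F : seq nat) (C : nat -> set Omega), uniq F ->
    (forall n, n \in F -> J n /\ sigma_process T (b n) (C n)) ->
    P (\big[setI/setT]_(n <- F) C n) = (\prod_(n <- F) P (C n))%E.

(* B^H(t) = \sum_n sqrt(lambda_n) beta_n(t) e_n on [0, T], the series converging
   in L^2(Omega, Y); [bm_Q] is the trace-class covariance operator. *)
Record QfBm (Y : hilbertType R) (H T : R) := {
  bm_idx : set nat ;
  bm_e : nat -> Y ;
  bm_eP : orthonormal_basis bm_idx bm_e ;
  bm_lambda : nat -> R ;
  bm_lambda_ge0 : forall n, bm_idx n -> 0 <= bm_lambda n ;
  bm_lambda_summable :
    (\sum_(n <oo | n \in bm_idx) (bm_lambda n)%:E < +oo)%E ;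
  bm_Q : Y -> Y ;
  bm_Q_bounded : bounded_linear bm_Q ;
  bm_QE : forall n, bm_idx n -> bm_Q (bm_e n) = bm_lambda n *: bm_e n ;
  bm_beta : nat -> R -> Omega -> R ;
  bm_beta_fBm : forall n, bm_idx n -> is_fBm H T (bm_beta n) ;
  bm_beta_indep : independent_processes T bm_idx bm_beta ;
  bm_proc :> R -> Omega -> Y ;
  bm_proc_L2 : forall t : R, 0 <= t <= T -> L2 P setT (bm_proc t) ;
  bm_procE : forall t : R, 0 <= t <= T ->
    L2norm P setT (fun w =>
      \sum_(0 <= n < N | n \in bm_idx)
        (Num.sqrt (bm_lambda n) * bm_beta n t w) *: bm_e n - bm_proc t w)
      @[N --> \oo] --> 0%E
}.

Section Integral.
Context (Y X : hilbertType R) (H T : R) (B : QfBm Y H T).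

(* The squared norm of L_2^0(Y, X) *)
Definition L20_norm2 (psi : Y -> X) : \bar R :=
  (\sum_(n <oo | n \in bm_idx B)
     (bm_lambda B n * `|psi (bm_e B n)| ^+ 2)%:E)%E.

Definition L20 (psi : Y -> X) : Prop :=
  bounded_linear psi /\ (L20_norm2 psi < +oo)%E.

Definition L20_measurable (D : set R) (phi : R -> Y -> X) : Prop :=
  forall n, bm_idx B n -> borel_fun D (fun s => phi s (bm_e B n)).

(* \sum_(p <- l) 1_[0, p.1] p.2, and its integral against [b] *)
Definition step_fun (l : seq (R * X)) (u : R) : X :=
  \sum_(p <- l | 0 <= u <= p.1) p.2.

Definition step_integral (b : R -> Omega -> R) (l : seq (R * X)) (w : Omega)
    : X :=
  \sum_(p <- l) b p.1 w *: p.2.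

(* [Z] is the value at [h] of the continuous linear extension to
   L^2([0, t], X) of 1_[0, a] v |-> b(a) v: it is the L^2 limit of the integrals
   of step functions converging to [h]. *)
Definition is_wiener_integral (b : R -> Omega -> R) (t : R) (h : R -> X)
    (Z : Omega -> X) : Prop :=
  let mu := @lebesgue_measure R in
  [/\ L2 mu `[0, t] h, L2 P setT Z &
      exists l : nat -> seq (R * X),
      [/\ forall k p, p \in l k -> 0 <= p.1 <= t,
          L2norm mu `[0, t] (step_fun (l k) \- h) @[k --> \oo] --> 0%E &
          L2norm P setT (step_integral b (l k) \- Z) @[k --> \oo] --> 0%E]].

Definition is_fBm_integral (t : R) (phi : R -> Y -> X) (Z : Omega -> X)
    : Prop :=
  [/\ forall s : R, 0 <= s <= t -> L20 (phi s),
      L20_measurable `[0, t] phi,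
      (\int[@lebesgue_measure R]_(s in `[0%R, t]) L20_norm2 (phi s) < +oo)%E,
      L2 P setT Z &
      exists2 Zn : nat -> Omega -> X,
        forall n, bm_idx B n ->
          is_wiener_integral (bm_beta B n) t
            (fun s => Num.sqrt (bm_lambda B n) *: phi s (bm_e B n)) (Zn n) &
        L2norm P setT (fun w => \sum_(0 <= n < N | n \in bm_idx B) Zn n w - Z w)
          @[N --> \oo] --> 0%E].

Definition mild_solution (tau : R) (A : R -> operator X)
    (U : R -> R -> X -> X) (f g : R -> X -> X) (sigma : R -> Y -> X)
    (r rho : R -> R) (phi x : R -> Omega -> X) : Prop :=
  [/\ continuous_L2 (- tau) T x,
      forall t : R, - tau <= t <= 0 -> {ae P, forall w, x t w = phi t w} &
      forall t : R, 0 <= t <= T ->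
      exists I1 I2 I3 : Omega -> X,
      [/\ is_bochner_integral t
            (fun s w => U t s (A s (g s (x (s - r s) w)))) I1,
          is_bochner_integral t (fun s w => U t s (f s (x (s - rho s) w))) I2,
          is_fBm_integral t (fun s y => U t s (sigma s y)) I3 &
          {ae P, forall w,
             x t w = U t 0 (phi 0 w + g 0 (phi (- r 0) w))
                     - g t (x (t - r t) w) - I1 w + I2 w + I3 w}]].

End Integral.
End L2Processes.

(* Main.v *)
(* A mild solution is a fixed point of the map sending x to the right-hand side
   of the mild equation.  In the norm sup_t e^(- lam t) ||x(t)|| on
   C([- tau, T], L^2), the neutral term is Lipschitz with constant
   Mstar * Lstar < 1, because g = A^-1 (A g), and the two Bochner integrals with
   constant M (Lstar + C1) / lam, so that the map is a contraction for lam large.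

   Its values exist and are continuous for the following reasons.  The integrand
   U(t, s) A(s) g(s, .) is a limit of difference quotients of U(t, .), which are
   norm continuous in s < t, hence is strongly measurable.  For H > 1/2 the
   covariance form of fractional Brownian motion is nonnegative and bounded on step
   functions by a multiple of the L^2 norm on [0, T], so that the integral extends
   to L^2, and independent coordinates give orthogonal series.  Continuity in t
   follows from norm continuity of U off the diagonal. *)

From HB Require Import structures.
Require Import Defs.
From mathcomp Require Import all_boot all_order all_algebra.
From mathcomp Require Import lra ring.
From mathcomp Require Import all_classical all_reals all_analysis measurable_realfun.

Set Implicit Arguments.
Unset Strict Implicit.
Unset Printing Implicit Defensive.

Import Order.TTheory GRing.Theory Num.Theory.
Import numFieldNormedType.Exports.

Local Open Scope classical_set_scope.
Local Open Scope ring_scope.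

(** * Inner products and Borel functions *)

(** The integrals are predicates that fix random variables only up to null sets, so the fixed-point
    map is a relation between processes and the contraction estimate compares arbitrary images. An
    integrand is treated as a path in the space of square-integrable variables, and its strong
    measurability is tested by its distances to countably many of them. The main obstacle is that
    [A s (g s _)] is bounded but not known to be continuous in [s]. Continuity is available for [g]
    and, below the diagonal, for [U t s]; this is why [A] is reached through difference quotients
    whose step keeps [s + h < t]. In the dependence on the upper limit only [U] moves with [t]. One
    scalar majorant of [U t' s - U t s], uniformly bounded and with small integral, therefore serves
    the Bochner integrals and the noise integral alike. Integrals over an interval of length zero
    are chosen to be exactly 0, so that the image of a process starts at [phi 0] without exceptional
    set. *)

Lemma discr_le (R : realType) (a b c : R) : 0 <= a ->
  (forall t, 0 <= a * t ^+ 2 + 2 * b * t + c) -> b ^+ 2 <= a * c.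
Proof.
move=> a0 H.
have [a_eq0|an0] := eqVneq a 0.
  rewrite a_eq0 mul0r; have [->|bn0] := eqVneq b 0; first by rewrite expr0n.
  (* With [a = 0] the polynomial is affine and takes the value -1 at this point. *)
  have := H (- (c + 1) / (2 * b)).
  rewrite a_eq0 mul0r add0r mulrC divfK ?mulf_neq0// => H1; nra.
have agt0 : 0 < a by rewrite lt_neqAle eq_sym an0.
(* The minimum of the parabola, where its value is [c - b ^+ 2 / a]. *)
have := H (- b / a).
rewrite (_ : _ + c = (a * c - b ^+ 2) / a); last by field.
by rewrite pmulr_lge0 ?invr_gt0// subr_ge0.
Qed.

Section Dot.
Context (R : realType) (X : hilbertType R).
Implicit Types x y z : X.

Lemma dotDl x y z : dot (x + y) z = dot x z + dot y z.
Proof. by rewrite -[x in LHS]scale1r dotPl mul1r. Qed.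

Lemma dot0l z : dot 0 z = 0.
Proof. by have := dotDl 0 0 z; rewrite addr0; lra. Qed.

Lemma dotZl (a : R) x z : dot (a *: x) z = a * dot x z.
Proof. by rewrite -[a *: x]addr0 dotPl dot0l addr0. Qed.

Lemma dotNl x z : dot (- x) z = - dot x z.
Proof. by rewrite -scaleN1r dotZl mulN1r. Qed.

Lemma dotDr x y z : dot z (x + y) = dot z x + dot z y.
Proof. by rewrite dotC dotDl !(dotC z). Qed.

Lemma dotNr x z : dot z (- x) = - dot z x.
Proof. by rewrite dotC dotNl dotC. Qed.

Lemma dotZr (a : R) x z : dot z (a *: x) = a * dot z x.
Proof. by rewrite dotC dotZl dotC. Qed.

Lemma dot_suml I (r : seq I) (P : pred I) (F : I -> X) z :
  dot (\sum_(i <- r | P i) F i) z = \sum_(i <- r | P i) dot (F i) z.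
Proof. by elim/big_rec2: _ => [|i a b _ <-]; rewrite ?dot0l// dotDl. Qed.

Lemma dot_sumr I (r : seq I) (P : pred I) (F : I -> X) z :
  dot z (\sum_(i <- r | P i) F i) = \sum_(i <- r | P i) dot z (F i).
Proof. by rewrite dotC dot_suml; apply: eq_bigr => i _; rewrite dotC. Qed.

Lemma sqr_normD x y : `|x + y| ^+ 2 = `|x| ^+ 2 + 2 * dot x y + `|y| ^+ 2.
Proof. by rewrite -!dotxx !(dotDl, dotDr) (dotC y x); lra. Qed.

(** Reduces the inner product to norms, whose measurability is available; [measurable_dot] rests on
    it. *)
Lemma dot_polar x y :
  dot x y = 4^-1 * (`|x + y| ^+ 2 - `|x - y| ^+ 2).
Proof. by rewrite !sqr_normD normrN dotNr; lra. Qed.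

(** The squares of [x + y] and [x - y] are nonnegative. This additive form of Cauchy-Schwarz is what
    integrability of inner products and Schur's test require. *)
Lemma dot_le_half x y : `|dot x y| <= 2^-1 * (`|x| ^+ 2 + `|y| ^+ 2).
Proof.
have := sqr_normD x y; have := sqr_normD x (- y).
have := sqr_ge0 `|x + y|; have := sqr_ge0 `|x - y|.
rewrite normrN dotNr ler_norml => *; apply/andP; split; lra.
Qed.


End Dot.

Section Borel.
Context (R : realType) (d : measure_display) (S : measurableType d).

Lemma borelP (X : normedModType R) (D : set S) (h : S -> X) :
  measurable D ->
  borel_fun D h <-> (forall O, open O -> measurable (D `&` h @^-1` O)).
Proof.
move=> mD; split=> [mh O oO|H].
  by apply: mh => //; exact: sub_sigma_algebra.
apply: (@measurability _ _ S (g_sigma_algebraType (@open X)) D h (@open X)) => //.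
by move=> _ [V oV <-]; exact: H.
Qed.

Lemma borel_comp (X Z : normedModType R) (D : set S) (h : S -> X) (F : X -> Z) :
  measurable D -> continuous F -> borel_fun D h -> borel_fun D (F \o h).
Proof.
move=> mD cF /(borelP _ mD) mh; apply/borelP => // O oO.
rewrite comp_preimage; apply: mh; exact: open_comp.
Qed.

Lemma borel_measurable (D : set S) (h : S -> R) : measurable D ->
  borel_fun D h -> measurable_fun D h.
Proof.
move=> mD /(borelP _ mD) H.
apply: (@measurability _ _ S R D h (@RGenOInfty.G R)) => //.
  exact: RGenOInfty.measurableE.
by move=> _ [_ [x ->] <-]; apply: H; exact: interval_open.
Qed.

Lemma borel_comp_measurable (X : normedModType R) (D : set S) (h : S -> X)
    (F : X -> R) :
  measurable D -> continuous F -> borel_fun D h -> measurable_fun D (F \o h).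
Proof. by move=> mD cF mh; apply: borel_measurable => //; exact: borel_comp. Qed.

(** The value 0 at index 0 is a normalisation: the best of the first points is then never farther
    from [x] than 0 is, which later yields domination. *)
Lemma separable_seq (X : normedModType R) : separable X ->
  exists v : nat -> X, v 0%N = 0 /\
    forall x e, 0 < e -> exists i, `|x - v i| < e.
Proof.
case=> D cD dD.
have [f sf] : exists f : nat -> X, forall x, D x -> exists i, f i = x.
  have /pfcard_geP[D0|[f]] := cD.
    (* A surjection from [nat] exists only onto a nonempty set; a dense set is nonempty because the
       space contains 0. *)
    have [] := dD setT _ openT; first by exists 0.
    by rewrite D0 => x [].
  by exists f => x Dx; have [i _ <-] := @surj _ _ _ _ f x Dx; exists i.
exists (fun i => if i is n.+1 then f n else 0); split => // x e e0.
have [] := dD (ball x e); [by exists x; exact: ballxx|exact: ball_open|].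
by move=> y [xy /sf [i fi]]; exists i.+1; move: xy; rewrite fi -ball_normE.
Qed.

(** In a separable space an open set is the union of the balls inside it whose centres run through a
    dense sequence and whose radii are inverses of integers, and this union is countable. *)
Lemma borel_ball (X : normedModType R) (X_sep : separable X) (D : set S)
    (h : S -> X) : measurable D ->
  (forall y, measurable_fun D (fun s => `|h s - y|)) -> borel_fun D h.
Proof.
move=> mD H; apply/borelP => // O oO; have [v [_ vd]] := separable_seq X_sep.
pose G i n := [set s | D s /\ `|h s - v i| < n.+1%:R^-1 :> R].
have mG i n : measurable (G i n).
  have := H (v i) mD `]-oo, (n.+1%:R^-1 : R)[%classic (measurable_itv _).
  congr (measurable _); apply/seteqP; split => s /=; rewrite in_itv/=.
rewrite (_ : _ `&` _ = \bigcup_(q in [set q : nat * nat |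
   ball (v q.1) q.2.+1%:R^-1 `<=` O]) G q.1 q.2).
  rewrite bigcup_mkcond; apply: countable_bigcupT_measurable => // q.
  by case: ifP => // _; exact: mG.
apply/seteqP; split => [s [Ds /= Os]|s [[i n]/= sub [Ds hs]]]; last first.
  by split => //; apply: sub; rewrite -ball_normE /=  distrC.
have /nbhs_ballP[e e0 be] : nbhs (h s) O by exact: open_nbhs_nbhs.
have [n [nn]] : exists n, [/\ True & (n.+1%:R^-1 : R) < e / 2].
  have := near_infty_natSinv_lt (PosNum (divr_gt0 e0 (ltr0n _ 2))).
  by case=> N _ /(_ N (leqnn _)) /= ?; exists N.
(* The radius is below [e / 2], so the ball around a centre this close to [h s] stays inside the
   ball of radius [e] around [h s]. *)
move=> ne; have [i hi] := vd (h s) n.+1%:R^-1 (ltac:(by [])).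
exists (i, n); last by split.
move=> y /= iy; apply: be; rewrite -ball_normE /=.
rewrite (splitr e) (le_lt_trans (ler_distD (v i) _ _))// ltrD//.
  exact: lt_trans ne.
by move: iy; rewrite -ball_normE/= => /lt_trans; apply.
Qed.

Lemma borel_dist (X : normedModType R) (D : set S) (h : S -> X) (y : X) :
  measurable D -> borel_fun D h -> measurable_fun D (fun s => `|h s - y|).
Proof.
move=> mD; apply: (borel_comp_measurable mD (F := fun x => `|x - y|)) => x.
by apply: cvg_norm; apply: cvgB; [exact: cvg_id|exact: cvg_cst].
Qed.

(** Distances to a fixed point pass to the limit as real functions, and [borel_ball] recovers the
    limit from its distances. *)
Lemma borel_cvg (X : normedModType R) (X_sep : separable X) (D : set S)
    (hn : nat -> S -> X) (h : S -> X) : measurable D ->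
  (forall n, borel_fun D (hn n)) ->
  (forall s, D s -> hn n s @[n --> \oo] --> h s) -> borel_fun D h.
Proof.
move=> mD mh hc; apply: borel_ball => // y.
apply: (measurable_fun_cvg (h := fun n s => `|hn n s - y|)).
  by move=> n; exact: borel_dist.
by move=> s Ds; apply: cvg_norm; apply: cvgB; [exact: hc|exact: cvg_cst].
Qed.

End Borel.

(** * Measurable choice of the best among finitely many candidates *)

Section Argmin.
Context (R : realType) (d : measure_display) (S : measurableType d).
Context (D : set S) (mD : measurable D) (p : nat -> S -> R).

(** Ties go to the smaller index, because the comparison is strict. For each [k] the selection takes
    finitely many values, so that gluing along it stays measurable. *)
Fixpoint argmin (k : nat) (s : S) : nat :=
  if k is k'.+1 then
    if p k s < p (argmin k' s) s then k else argmin k' s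
  else 0%N.

Lemma argmin_le k s : (argmin k s <= k)%N.
Proof. by elim: k => //= k IH; case: ifP => // _; exact: leqW. Qed.

Lemma argminP k s j : (j <= k)%N -> p (argmin k s) s <= p j s.
Proof.
elim: k => [|k IH]; first by rewrite leqn0 => /eqP ->.
rewrite leq_eqVlt ltnS /= => /orP[/eqP->|/IH jk]; case: ifPn => //.
  by rewrite -leNgt.
by move/ltW => /le_trans; exact.
Qed.

Hypothesis mp : forall i, measurable_fun D (p i).

Lemma measurable_argmin k i : measurable (D `&` [set s | argmin k s = i]).
Proof.
have mlt a b : measurable (D `&` [set s | p a s < p b s]).
  have := measurable_fun_ltr (mp a) (mp b) mD (Y := [set true]) I.
  by congr measurable; apply/seteqP; split => s.
elim: k i => [|k IH] i /=.
  have [->|/eqP i0] := eqVneq i 0%N.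
    rewrite (_ : [set _ | _] = setT) ?setIT//.
    by apply/seteqP; split.
  rewrite (_ : [set _ | _] = set0) ?setI0//.
  by apply/seteqP; split => //= s /esym.
(* Split by the previous choice [j]: the new choice is [k.+1] where that candidate is strictly
   better than [j], and remains [j] elsewhere. *)
rewrite (_ : _ `&` _ = \bigcup_(j in [set j | (j <= k)%N])
  ((D `&` [set s | argmin k s = j]) `&`
   (if i == k.+1 then D `&` [set s | p k.+1 s < p j s]
    else if i == j then D `\` (D `&` [set s | p k.+1 s < p j s]) else set0))).
  apply: bigcup_measurable => j _; apply: measurableI => //.
  case: ifP => // _; case: ifP => // _; exact: measurableD.
apply/seteqP; split => s.
  move=> [Ds /=]; case: ltP => [lt|ge] <-;
    exists (argmin k s) => //=; try exact: argmin_le; split => //.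
    by rewrite eqxx.
  by rewrite ltn_eqF ?ltnS ?argmin_le// eqxx; split => // -[_]/=; rewrite ltNge ge.
case=> j /= jk [[Ds <-]]; case: eqP => [-> [_ /= ->]//|ik].
case: eqP => // -> [_ /= nlt]; split => //; case: ifPn => // lt; exfalso; exact: nlt.
Qed.

End Argmin.

(** * Square-integrable functions *)

Section BorelOps.
Context (R : realType) (d : measure_display) (S : measurableType d).
Context (D : set S) (mD : measurable D).

Lemma measurable_borel (h : S -> R) : measurable_fun D h -> borel_fun D h.
Proof.
move=> mh; apply/borelP => // O oO; apply: mh => //; exact: open_measurable.
Qed.

Lemma borel_glue (X : normedModType R) (F : nat -> S -> X) (idx : S -> nat) :
  (forall i, borel_fun D (F i)) ->
  (forall i, measurable (D `&` [set s | idx s = i])) ->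
  borel_fun D (fun s => F (idx s) s).
Proof.
move=> mF midx; apply/borelP => // O oO.
rewrite (_ : _ `&` _ = \bigcup_i
  ((D `&` [set s | idx s = i]) `&` (D `&` F i @^-1` O))).
  apply: bigcup_measurable => i _; apply: measurableI => //.
  have /(borelP _ mD) := mF i; exact.
apply/seteqP; split => [s [Ds Os]|s [i _ [[Ds /= <-] [_ Os]]]//].
by exists (idx s).
Qed.

(* The nearest of the first [k + 1] points of a dense sequence starting at [0]:
   these approximations are dominated by the function. *)
Lemma borel_approx (X : normedModType R) (X_sep : separable X) (h : S -> X) :
  borel_fun D h ->
  exists (v : nat -> X) (idx : nat -> S -> nat),
  [/\ forall k i, measurable (D `&` [set s | idx k s = i]),
      forall k s, (idx k s <= k)%N,
      forall k s, `|h s - v (idx k s)| <= `|h s| &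
      forall s, v (idx k s) @[k --> \oo] --> h s].
Proof.
move=> mh; have [v [v0 vd]] := separable_seq X_sep.
pose p i s := `|h s - v i| : R.
have mp i : measurable_fun D (p i) by exact: borel_dist.
exists v, (argmin p); split => [k i|k s|k s|s].
- exact: measurable_argmin.
- exact: argmin_le.
- by have := argminP p s (leq0n k); rewrite /p v0 subr0.
- apply/cvgrPdist_lt => e e0; have [i hi] := vd (h s) e e0.
  exists i => // k /= ik; exact: le_lt_trans (argminP p s ik) hi.
Qed.

(** Replacing [h] by its countably valued approximations turns the composite into a gluing of the
    measurable functions [F^~ (v i)]; continuity of [F s] carries the limit. *)
Lemma borel_caratheodory (X Z : normedModType R) (X_sep : separable X)
    (Z_sep : separable Z) (F : S -> X -> Z) (h : S -> X) :
  (forall x, borel_fun D (F^~ x)) -> (forall s, D s -> continuous (F s)) ->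
  borel_fun D h -> borel_fun D (fun s => F s (h s)).
Proof.
move=> mF cF mh; have [v [idx [midx _ _ vh]]] := borel_approx X_sep mh.
apply: (@borel_cvg _ _ _ _ Z_sep _ (fun k s => F s (v (idx k s)))) => //.
  by move=> k; apply: (borel_glue (F := fun i s => F s (v i))).
move=> s Ds; apply: continuous_cvg; [exact: cF|exact: vh].
Qed.

Context (X : normedModType R) (X_sep : separable X).
Implicit Types h k : S -> X.

Lemma borel_cst (x : X) : borel_fun D (fun=> x).
Proof. exact: measurable_cst. Qed.

(** One summand is treated as a parameter, which avoids comparing the Borel sets of [X * X] with the
    product sigma-algebra. *)
Lemma borelD h k : borel_fun D h -> borel_fun D k ->
  borel_fun D (fun s => h s + k s).
Proof.
move=> mh mk; apply: (@borel_caratheodory X X _ _ (fun s x => x + k s)) => //.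
  move=> x; apply: (@borel_comp _ _ _ _ _ _ k (fun y => x + y)) => //.
  by move=> y; apply: cvgD; [exact: cvg_cst|exact: cvg_id].
by move=> s _ y; apply: cvgD; [exact: cvg_id|exact: cvg_cst].
Qed.

Lemma borelZ (a : S -> R) h : measurable_fun D a -> borel_fun D h ->
  borel_fun D (fun s => a s *: h s).
Proof.
move=> ma mh; apply: (@borel_caratheodory X X _ _ (fun s x => a s *: x)) => //.
  move=> x; apply: (@borel_comp _ _ _ _ _ _ a (fun y => y *: x)) => //.
    by move=> y; apply: cvgZl; exact: cvg_id.
  exact: measurable_borel.
by move=> s _ y; apply: cvgZr; exact: cvg_id.
Qed.

Lemma borelN h : borel_fun D h -> borel_fun D (fun s => - h s).
Proof.
move=> mh; apply: (@borel_comp _ _ _ _ _ _ h (fun y => - y)) => // y.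
by apply: cvgN; exact: cvg_id.
Qed.

Lemma borelB h k : borel_fun D h -> borel_fun D k ->
  borel_fun D (fun s => h s - k s).
Proof. by move=> mh mk; apply: borelD => //; exact: borelN. Qed.


Lemma borel_norm h : borel_fun D h -> measurable_fun D (fun s => `|h s|).
Proof.
move=> mh; under eq_fun do rewrite -[h _]subr0; exact: borel_dist.
Qed.

End BorelOps.

Section L2.
Context (R : realType) (d : measure_display) (S : measurableType d).
Context (mu : {measure set S -> \bar R}) (D : set S) (mD : measurable D).

Lemma L2normE (X : normedModType R) (h : S -> X) :
  L2norm mu D h = ((\int[mu]_(s in D) (`|h s| ^+ 2)%:E) `^ 2^-1)%E.
Proof.
rewrite /L2norm unlock; congr (_ `^ _)%E; rewrite [RHS]integral_mkcond.
apply: eq_integral => s _; rewrite /patch; case: ifPn => _.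
  by rewrite /= normr_id powR_mulrn.
(* Outside [D] the restriction takes the default value [point], which is 0 in [\bar R]. *)
by rewrite (_ : point = 0%E)// abse0 poweR0r.
Qed.

(** A real number, so that estimates can be made in [R]. The value is meaningless for a function of
    infinite norm, since [fine] sends [+oo] to 0; this is why most lemmas ask for [L2]. *)
Definition nrm (X : normedModType R) (h : S -> X) : R := fine (L2norm mu D h).

Lemma nrm_ge0 (X : normedModType R) (h : S -> X) : 0 <= nrm h.
Proof. by rewrite fine_ge0// Lnorm_ge0. Qed.

Lemma L2P (X : normedModType R) (h : S -> X) :
  L2 mu D h <->
  borel_fun D h /\ (\int[mu]_(s in D) (`|h s| ^+ 2)%:E < +oo)%E.
Proof.
rewrite /L2 L2normE; split => -[mh hoo]; split => //.
  by apply: lty_poweRy hoo; rewrite invr_neq0.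
exact: poweR_lty.
Qed.

Section Norm.
Context (X : normedModType R).
Implicit Types h k : S -> X.

Lemma L2norm_fin h : L2 mu D h -> L2norm mu D h = (nrm h)%:E.
Proof.
by move=> [_ hoo]; rewrite /nrm fineK// ge0_fin_numE// Lnorm_ge0.
Qed.

Lemma int_sqr_nrm h : L2 mu D h ->
  (\int[mu]_(s in D) (`|h s| ^+ 2)%:E = (nrm h ^+ 2)%:E)%E.
Proof.
move=> hL; have := L2norm_fin hL; rewrite L2normE => /(congr1 (fun x => x `^ 2)%E).
rewrite -poweRrM mulVf// poweRe1; last first.
  by apply: integral_ge0 => s _; rewrite lee_fin sqr_ge0.
by move=> ->; rewrite poweR_EFin powR_mulrn// nrm_ge0.
Qed.

Lemma sqr_nrm_le h c : 0 <= c -> L2 mu D h ->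
  (\int[mu]_(s in D) (`|h s| ^+ 2)%:E <= (c ^+ 2)%:E)%E -> nrm h <= c.
Proof.
by move=> c0 hL; rewrite int_sqr_nrm// lee_fin ler_sqr ?nnegrE// nrm_ge0.
Qed.

Lemma borel_sqr h : borel_fun D h -> measurable_fun D (fun s => `|h s| ^+ 2).
Proof. by move=> mh; apply: measurable_funX; exact: borel_norm. Qed.

Lemma L2_le h (k : S -> R) c : borel_fun D h -> measurable_fun D k ->
  (forall s, D s -> `|h s| ^+ 2 <= k s) ->
  (\int[mu]_(s in D) (k s)%:E <= (c ^+ 2)%:E)%E -> 0 <= c ->
  L2 mu D h /\ nrm h <= c.
Proof.
move=> mh mk hk kc c0.
have H : (\int[mu]_(s in D) (`|h s| ^+ 2)%:E <= (c ^+ 2)%:E)%E.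
  apply: le_trans kc; apply: ge0_le_integral => //.
  - exact/measurable_EFinP/borel_sqr.
  - exact/measurable_EFinP.
have hL : L2 mu D h by apply/L2P; split => //; exact: le_lt_trans H (ltry _).
by split => //; exact: sqr_nrm_le.
Qed.

End Norm.

Lemma L2_dom (X Z : normedModType R) (h : S -> X) (k : S -> Z) c : 0 <= c ->
  borel_fun D h -> L2 mu D k -> (forall s, D s -> `|h s| <= c * `|k s|) ->
  L2 mu D h /\ nrm h <= c * nrm k.
Proof.
move=> c0 mh kL hk; have mk : borel_fun D k by have [] := kL.
apply: (@L2_le _ _ (fun s => c ^+ 2 * `|k s| ^+ 2)) => //.
- apply: measurable_funM => //; apply: measurable_funX.
  exact: borel_norm.
- by move=> s Ds; rewrite -exprMn ler_sqr ?nnegrE ?mulr_ge0//; exact: hk.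
- under eq_integral do rewrite EFinM.
  rewrite ge0_integralZl_EFin ?sqr_ge0//; last first.
    by apply/measurable_EFinP/measurable_funX; exact: borel_norm.
  by rewrite int_sqr_nrm// -EFinM exprMn.
- by rewrite mulr_ge0// nrm_ge0.
Qed.

Context (X : hilbertType R) (X_sep : separable X).
Implicit Types h k : S -> X.

Definition ip h k : R := \int[mu]_(s in D) dot (h s) (k s).

Lemma measurable_dot h k : borel_fun D h -> borel_fun D k ->
  measurable_fun D (fun s => dot (h s) (k s)).
Proof.
move=> mh mk; under eq_fun do rewrite dot_polar.
apply: measurable_funM => //; apply: measurable_funB;
  apply: borel_sqr; [exact: borelD|exact: borelB].
Qed.

Lemma integrable_dot h k : L2 mu D h -> L2 mu D k ->
  mu.-integrable D (EFin \o (fun s => dot (h s) (k s))).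
Proof.
move=> hL kL; have [[mh _] [mk _]] := (hL, kL); apply/integrableP; split.
  exact/measurable_EFinP/measurable_dot.
pose b s := ((`|h s| ^+ 2)%:E + (`|k s| ^+ 2)%:E)%E.
have mb : measurable_fun D b.
  by apply: emeasurable_funD; exact/measurable_EFinP/borel_sqr.
apply: (@le_lt_trans _ _ (\int[mu]_(s in D) b s)%E).
  apply: ge0_le_integral => //.
  - apply/measurable_EFinP; apply: measurableT_comp => //.
    exact: measurable_dot.
  move=> s _; rewrite /= lee_fin (le_trans (dot_le_half _ _))//.
  by have := sqr_ge0 `|h s|; have := sqr_ge0 `|k s|; lra.
rewrite ge0_integralD//; try by move=> s _; rewrite lee_fin sqr_ge0.
- by rewrite !int_sqr_nrm// -EFinD ltry.
- exact/measurable_EFinP/borel_sqr.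
- exact/measurable_EFinP/borel_sqr.
Qed.

Lemma L2D h k : L2 mu D h -> L2 mu D k -> L2 mu D (fun s => h s + k s).
Proof.
move=> hL kL; have [[mh _] [mk _]] := (hL, kL).
have mhk : borel_fun D (fun s => h s + k s) by exact: borelD.
pose b s := ((`|h s| ^+ 2)%:E + (`|k s| ^+ 2)%:E)%E.
have mb : measurable_fun D b.
  by apply: emeasurable_funD; exact/measurable_EFinP/borel_sqr.
apply/L2P; split => //.
apply: (@le_lt_trans _ _ (\int[mu]_(s in D) (2%:E * b s))%E).
  apply: ge0_le_integral => //.
  - exact/measurable_EFinP/borel_sqr.
  - exact: emeasurable_funM.
  move=> s _; rewrite /b -EFinD -EFinM lee_fin sqr_normD.
  by have := dot_le_half (h s) (k s); rewrite ler_norml; lra.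
rewrite ge0_integralZl_EFin//; last first.
  by move=> s _; rewrite adde_ge0// lee_fin sqr_ge0.
rewrite ge0_integralD//; try by move=> s _; rewrite lee_fin sqr_ge0.
- by rewrite !int_sqr_nrm// -EFinD -EFinM ltry.
- exact/measurable_EFinP/borel_sqr.
- exact/measurable_EFinP/borel_sqr.
Qed.

Lemma L2Z (a : R) h : L2 mu D h -> L2 mu D (fun s => a *: h s).
Proof.
move=> hL; have [mh _] := hL.
have [] := @L2_dom X X (fun s => a *: h s) h `|a| => //.
  exact: borelZ.
by move=> s _; rewrite normrZ.
Qed.

Lemma L2N h : L2 mu D h -> L2 mu D (fun s => - h s).
Proof. by move=> /(L2Z (-1)); under eq_fun do rewrite scaleN1r. Qed.

Lemma L2B h k : L2 mu D h -> L2 mu D k -> L2 mu D (fun s => h s - k s).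
Proof. by move=> hL kL; apply: L2D => //; exact: L2N. Qed.

Lemma L2_0 : L2 mu D (fun=> 0 : X).
Proof.
apply/L2P; split; first exact: borel_cst.
by under eq_integral do rewrite normr0 expr0n/=; rewrite integral0.
Qed.

Lemma L2_sum I (r : seq I) (P : pred I) (F : I -> S -> X) :
  (forall i, P i -> L2 mu D (F i)) ->
  L2 mu D (fun s => \sum_(i <- r | P i) F i s).
Proof.
move=> mF; elim: r => [|i r IH].
  by under eq_fun do rewrite big_nil; exact: L2_0.
under eq_fun do rewrite big_cons.
by case Pi: (P i) => //; apply: L2D => //; exact: mF.
Qed.

Lemma ipC h k : ip h k = ip k h.
Proof. by apply: eq_Rintegral => s _; rewrite dotC. Qed.

Lemma ipD h h' k : L2 mu D h -> L2 mu D h' -> L2 mu D k ->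
  ip (fun s => h s + h' s) k = ip h k + ip h' k.
Proof.
move=> hL hL' kL; rewrite /ip -RintegralD//; try exact: integrable_dot.
by apply: eq_Rintegral => s _; rewrite dotDl.
Qed.

Lemma ipZ a h k : L2 mu D h -> L2 mu D k ->
  ip (fun s => a *: h s) k = a * ip h k.
Proof.
move=> hL kL; rewrite /ip -RintegralZl//; try exact: integrable_dot.
by apply: eq_Rintegral => s _; rewrite dotZl.
Qed.

Lemma ipN h k : L2 mu D h -> L2 mu D k ->
  ip (fun s => - h s) k = - ip h k.
Proof.
move=> hL kL; rewrite -mulN1r -ipZ//; congr ip.
by apply/funext => s; rewrite scaleN1r.
Qed.

Lemma ipB h h' k : L2 mu D h -> L2 mu D h' -> L2 mu D k ->
  ip (fun s => h s - h' s) k = ip h k - ip h' k.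
Proof. by move=> hL hL' kL; rewrite ipD ?ipN//; exact: L2N. Qed.

Lemma ip0 k : ip (fun=> 0) k = 0.
Proof.
rewrite /ip; under eq_Rintegral do rewrite dot0l.
by rewrite /Rintegral integral0.
Qed.

Lemma ip_sum I (r : seq I) (P : pred I) (F : I -> S -> X) k :
  (forall i, P i -> L2 mu D (F i)) -> L2 mu D k ->
  ip (fun s => \sum_(i <- r | P i) F i s) k = \sum_(i <- r | P i) ip (F i) k.
Proof.
move=> mF kL; elim: r => [|i r IH].
  by under eq_fun do rewrite big_nil; rewrite big_nil ip0.
under eq_fun do rewrite big_cons; rewrite big_cons; case Pi: (P i) => //.
by rewrite ipD ?IH//; [exact: mF|exact: L2_sum].
Qed.

Lemma ip_nrm h : L2 mu D h -> ip h h = nrm h ^+ 2.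
Proof.
move=> hL; have := int_sqr_nrm hL => H.
by rewrite /ip /Rintegral; under eq_integral do rewrite dotxx; rewrite H.
Qed.

Lemma sqr_nrmD h k : L2 mu D h -> L2 mu D k ->
  nrm (fun s => h s + k s) ^+ 2 = nrm h ^+ 2 + 2 * ip h k + nrm k ^+ 2.
Proof.
move=> hL kL; rewrite -!ip_nrm//; last exact: L2D.
rewrite ipD//; last exact: L2D.
by rewrite [ip h _]ipC [ip k _]ipC !ipD// (ipC k h); lra.
Qed.

Lemma nrmZ a h : L2 mu D h -> nrm (fun s => a *: h s) = `|a| * nrm h.
Proof.
move=> hL; apply/eqP; rewrite -(@eqrXn2 _ 2) ?nrm_ge0// ?mulr_ge0 ?nrm_ge0//.
apply/eqP; rewrite exprMn real_normK ?num_real// -!ip_nrm//; last exact: L2Z.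
by rewrite ipZ// 1?ipC ?ipZ//; [lra|exact: L2Z].
Qed.

(** The squared norm of [t *: h + k] is a nonnegative polynomial in [t], so its discriminant is not
    positive. Functions of norm 0 are covered as well. *)
Lemma ip_le h k : L2 mu D h -> L2 mu D k -> `|ip h k| <= nrm h * nrm k.
Proof.
move=> hL kL; rewrite -ler_sqr ?nnegrE ?mulr_ge0 ?nrm_ge0//.
rewrite real_normK ?num_real// exprMn; apply: discr_le => [|t].
  exact: sqr_ge0.
have := sqr_ge0 (nrm (fun s => t *: h s + k s)).
rewrite sqr_nrmD//; last exact: L2Z.
by rewrite nrmZ// ipZ// exprMn real_normK ?num_real//; lra.
Qed.

Lemma nrmD h k : L2 mu D h -> L2 mu D k ->
  nrm (fun s => h s + k s) <= nrm h + nrm k.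
Proof.
move=> hL kL; rewrite -ler_sqr ?nnegrE ?addr_ge0 ?nrm_ge0// sqr_nrmD//.
by have := ip_le hL kL; rewrite ler_norml sqrrD; lra.
Qed.

Lemma nrmN h : L2 mu D h -> nrm (fun s => - h s) = nrm h.
Proof.
move=> hL; have := nrmZ (-1) hL; rewrite normrN1 mul1r => <-.
by congr nrm; apply/funext => s; rewrite scaleN1r.
Qed.

Lemma nrmB h k : nrm (fun s => h s - k s) = nrm (fun s => k s - h s).
Proof.
rewrite /nrm !L2normE; congr (fine (_ `^ _)).
by apply: eq_integral => s _; rewrite distrC.
Qed.

Lemma nrm_dist h k l : L2 mu D h -> L2 mu D k -> L2 mu D l ->
  nrm (fun s => h s - l s) <= nrm (fun s => h s - k s) + nrm (fun s => k s - l s).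
Proof.
move=> hL kL lL; apply: le_trans (nrmD _ _); try exact: L2B.
by under [X in _ <= nrm X]eq_fun do rewrite addrA subrK.
Qed.

Lemma nrm0 : nrm (fun=> 0 : X) = 0.
Proof. by apply/eqP; rewrite -sqrf_eq0 -ip_nrm ?ip0//; exact: L2_0. Qed.

Lemma nrm_sub_le h k : L2 mu D h -> L2 mu D k ->
  `|nrm h - nrm k| <= nrm (fun s => h s - k s).
Proof.
move=> hL kL; rewrite ler_norml; apply/andP; split.
  rewrite lerNl opprB lerBlDr -nrmB addrC.
  have := nrmD hL (L2B kL hL).
  by under [X in nrm X <= _]eq_fun do rewrite subrKC; rewrite (nrmB k).
rewrite lerBlDr; have := nrmD (L2B hL kL) kL.
by under [X in nrm X <= _]eq_fun do rewrite subrK.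
Qed.


Lemma nrm_eq0 h : L2 mu D h -> nrm h = 0 <-> {ae mu, forall s, D s -> h s = 0}.
Proof.
move=> hL; have [mh _] := hL.
have -> : nrm h = 0 <-> (\int[mu]_(s in D) `|(`|h s| ^+ 2)%:E| = 0)%E.
  under eq_integral do rewrite gee0_abs ?lee_fin ?sqr_ge0//.
  rewrite int_sqr_nrm//; split => [->|[/eqP]]; first by rewrite expr0n.
  by rewrite sqrf_eq0 => /eqP.
rewrite (ae_eq_integral_abs mu mD); last exact/measurable_EFinP/borel_sqr.
split; apply: filterS => s /= H Ds.
  by have [/eqP] := H Ds; rewrite sqrf_eq0 normr_eq0 => /eqP.
by rewrite H// normr0 expr0n.
Qed.

End L2.

Lemma cvg_sqr (R : realType) (I : Type) (F : set_system I) {FF : Filter F}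
    (u : I -> R) (l : R) :
  u i @[i --> F] --> l -> u i ^+ 2 @[i --> F] --> l ^+ 2.
Proof.
by move=> ul; under eq_fun do rewrite expr2; rewrite expr2; exact: cvgM.
Qed.

Lemma cvg_norm_sub0 (R : realType) (X : normedModType R) (I : Type)
    (F : set_system I) {FF : Filter F} (u : I -> X) (l : X) :
  u i @[i --> F] --> l <-> `|u i - l| @[i --> F] --> (0 : R).
Proof.
split => [ul|ul].
  by rewrite -(@normr0 _ X); apply: cvg_norm; rewrite -(subrr l); apply: cvgB => //; exact: cvg_cst.
apply/cvgrPdist_lt => e e0; have /cvgrPdist_lt/(_ _ e0) := ul.
by apply: filterS => i; rewrite sub0r normrN normr_id distrC.
Qed.

(** * Convergence and completeness in L^2 *)

Section L2Conv.
Context (R : realType) (d : measure_display) (S : measurableType d).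
Context (mu : {measure set S -> \bar R}) (D : set S) (mD : measurable D).

(** [fine] forgets infinite values; membership in [L2] near the limit is what allows the way back
    from real norms. *)
Lemma cvg_L2normP (X : normedModType R) (I : Type) (F : set_system I)
    {FF : Filter F} (h : I -> S -> X) :
  (\forall i \near F, L2 mu D (h i)) ->
  L2norm mu D (h i) @[i --> F] --> 0%E <-> nrm mu D (h i) @[i --> F] --> (0 : R).
Proof.
move=> hL; split => [h0|h0].
  exact: (@fine_cvg _ _ _ _ _ (0 : R) h0).
apply: (@cvg_EFin _ _ _ _ _ (0 : R)) => //.
by apply: filterS hL => i hL; rewrite L2norm_fin.
Qed.

Context (X : hilbertType R) (X_sep : separable X).
Implicit Types h : S -> X.

Lemma L2_fatou (hn : nat -> S -> X) h c : 0 <= c ->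
  (forall n, L2 mu D (hn n)) -> (forall n, nrm mu D (hn n) <= c) ->
  (forall s, D s -> hn n s @[n --> \oo] --> h s) ->
  L2 mu D h /\ nrm mu D h <= c.
Proof.
move=> c0 hnL hnc hnh.
have mh : borel_fun D h.
  by apply: (borel_cvg X_sep mD _ hnh) => n; have [] := hnL n.
have H : (\int[mu]_(s in D) (`|h s| ^+ 2)%:E <= (c ^+ 2)%:E)%E.
  have E s : s \in D -> ((`|h s| ^+ 2)%:E =
      limn_einf (fun n => (`|hn n s| ^+ 2)%:E))%E.
    rewrite inE => Ds; apply/esym.
    have /cvg_limn_einf_sup[-> _]// : ((`|hn n s| ^+ 2)%:E @[n --> \oo] --> (`|h s| ^+ 2)%:E)%E.
    apply: cvg_EFin; first exact: nearW.
    by apply: cvg_sqr; apply: cvg_norm; exact: hnh.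
  rewrite (eq_integral _ _ E); apply: le_trans (fatou _ _ _ _) _ => //.
    by move=> n; have [mhn _] := hnL n; exact/measurable_EFinP/borel_sqr.
  rewrite limn_einf_lim; apply: lime_le; first exact: is_cvg_einfs.
  apply: nearW => n; apply: (@le_trans _ _ (nrm mu D (hn n) ^+ 2)%:E).
    by rewrite -int_sqr_nrm//; apply: ereal_inf_lbound; exists n => /=.
  by rewrite lee_fin ler_sqr ?nnegrE// nrm_ge0.
have hL : L2 mu D h by apply/L2P; split => //; exact: le_lt_trans H (ltry _).
by split => //; exact: sqr_nrm_le.
Qed.

(** The domination concerns the squared differences, so that the sequence and its limit need not be
    square-integrable separately. *)
Lemma L2_dct (hn : nat -> S -> X) h (W : S -> R) :
  (forall n, borel_fun D (hn n)) -> borel_fun D h ->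
  mu.-integrable D (EFin \o W) ->
  (forall n s, D s -> `|hn n s - h s| ^+ 2 <= W s) ->
  (forall s, D s -> hn n s @[n --> \oo] --> h s) ->
  (forall n, L2 mu D (fun s => hn n s - h s)) /\
  nrm mu D (fun s => hn n s - h s) @[n --> \oo] --> (0 : R).
Proof.
move=> mhn mh iW hW hnh.
have mD' n : borel_fun D (fun s => hn n s - h s) by exact: borelB.
have HL n : L2 mu D (fun s => hn n s - h s).
  apply/L2P; split => //; have /integrableP[mW iWoo] := iW.
  apply: le_lt_trans iWoo; apply: ge0_le_integral => //.
  - exact/measurable_EFinP/borel_sqr.
  - exact: measurableT_comp.
  by move=> s Ds; rewrite lee_fin (le_trans (hW n _ Ds))// ler_norm.
split => //.
have := @dominated_cvg _ S R mu D mD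
  (fun n s => (`|hn n s - h s| ^+ 2)%:E) (fun=> 0%E) (EFin \o W).
move=> H; have {}H : ((\int[mu]_(s in D) (`|hn n s - h s| ^+ 2)%:E)
    @[n --> \oo] --> (0 : \bar R))%E.
  rewrite -[X in _ --> X](integral0 mu D); apply: H => //.
  - by move=> n; exact/measurable_EFinP/borel_sqr.
  - move=> s Ds; apply: cvg_EFin; first exact: nearW.
    rewrite (_ : 0 = 0 ^+ 2 :> R); last by rewrite expr0n.
    by apply: cvg_sqr; apply: (proj1 (cvg_norm_sub0 _ _)); exact: hnh.
  - by move=> n s Ds; rewrite /= lee_fin ger0_norm ?sqr_ge0//; exact: hW.
have {}H : (nrm mu D (fun s => hn n s - h s) ^+ 2) @[n --> \oo] --> (0 : R).
  apply: (@fine_cvg _ _ _ _ (fun n => (nrm mu D (fun s => hn n s - h s) ^+ 2)%:E)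
    (0 : R)).
  by under eq_fun do rewrite -int_sqr_nrm//.
rewrite -(@sqrtr0 R).
rewrite (_ : (fun n => nrm mu D (fun s => hn n s - h s)) =
  Num.sqrt \o (fun n => nrm mu D (fun s => hn n s - h s) ^+ 2)); last first.
  by apply/funext => n /=; rewrite sqrtr_sqr ger0_norm// nrm_ge0.
by apply: continuous_cvg => //; exact: sqrt_continuous.
Qed.

Hypothesis muD : (mu D < +oo)%E.

(* A subsequence with summable increments converges almost everywhere, since
   [|x| <= (2 ^ k |x| ^ 2 + 2 ^ - k) / 2] makes the increments summable in L^1;
   Fatou's lemma then identifies its limit as the limit of the sequence. *)
Lemma L2_complete (u : nat -> S -> X) : (forall n, L2 mu D (u n)) ->
  (forall e : R, 0 < e -> exists N, forall n m, (N <= n)%N -> (N <= m)%N ->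
     nrm mu D (fun s => u n s - u m s) <= e) ->
  exists2 v : S -> X, L2 mu D v &
    forall e : R, 0 < e -> exists N, forall n, (N <= n)%N ->
      nrm mu D (fun s => u n s - v s) <= e.
Proof.
move=> uL uC.
have N_ (k : nat) : {N | (k <= N)%N /\ forall n m, (N <= n)%N -> (N <= m)%N ->
    nrm mu D (fun s => u n s - u m s) <= 2^-1 ^+ k}.
  apply: cid; have [|N hN] := uC (2^-1 ^+ k); first by rewrite exprn_gt0// invr_gt0.
  exists (maxn k N); split => [|n m]; first exact: leq_maxl.
  by rewrite !geq_max => /andP[_ +] /andP[_]; exact: hN.
(* Partial sums make the indices nondecreasing while keeping each one beyond [N_ k]. *)
pose nk k := (\sum_(i < k.+1) sval (N_ i))%N.
have nkS k : (nk k <= nk k.+1)%N by rewrite /nk [in leqRHS]big_ord_recr leq_addr.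
have nkN k : (sval (N_ k) <= nk k)%N by rewrite /nk big_ord_recr leq_addl.
have nk_homo : {homo nk : i j / (i <= j)%N} by exact: homo_leq leq_trans nkS.
pose w k s := u (nk k) s.
have wL k : L2 mu D (w k) by exact: uL.
pose dk k s := `|w k.+1 s - w k s| : R.
have dk0 k s : (0 <= (dk k s)%:E)%E by rewrite lee_fin normr_ge0.
have dL k : L2 mu D (fun s => w k.+1 s - w k s) by exact: L2B.
have dk_le k : nrm mu D (fun s => w k.+1 s - w k s) <= 2^-1 ^+ k.
  have [_ +] := svalP (N_ k); move/(_ (nk k.+1) (nk k)).
  by apply; rewrite ?nkN// (leq_trans (nkN k)).
have mdk k : measurable_fun D (dk k).
  by apply: borel_norm => //; have [] := dL k.
have idk k : (\int[mu]_(s in D) (dk k s)%:E <=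
    (2^-1 ^+ k * (1 + fine (mu D)))%:E)%E.
  have msq : measurable_fun D (fun s => `|w k.+1 s - w k s| ^+ 2).
    by apply: borel_sqr => //; have [] := dL k.
  apply: (@le_trans _ _ (\int[mu]_(s in D)
      ((2 ^+ k)%:E * (`|w k.+1 s - w k s| ^+ 2)%:E + (2^-1 ^+ k)%:E))%E).
    apply: ge0_le_integral => //; first exact/measurable_EFinP.
      apply: emeasurable_funD => //; apply: emeasurable_funM => //.
      exact/measurable_EFinP.
    move=> s _; rewrite -EFinM -EFinD lee_fin /dk.
    set x := `|_|; have k0 : 0 < (2 : R) ^+ k by rewrite exprn_gt0.
    rewrite exprVn -(ler_pM2l k0) mulrDr mulfV ?gt_eqF// mulrA -expr2 -exprMn.
    by have := sqr_ge0 (2 ^+ k * x - 1); rewrite sqrrB; have := sqr_ge0 (2 ^+ k * x); lra.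
  rewrite ge0_integralD//;
    try (by apply: emeasurable_funM => //; exact/measurable_EFinP);
    try (by move=> s _; rewrite -?EFinM lee_fin ?mulr_ge0 ?exprn_ge0 ?invr_ge0 ?sqr_ge0).
  rewrite ge0_integralZl_EFin ?exprn_ge0//; last exact/measurable_EFinP.
  rewrite int_sqr_nrm// integral_cst// -(@fineK _ (mu D)); last first.
    by rewrite ge0_fin_numE.
  rewrite -!EFinM -EFinD lee_fin mulrDr mulr1 lerD2r.
  apply: (@le_trans _ _ (2 ^+ k * (2^-1 ^+ k) ^+ 2)).
    by rewrite ler_wpM2l ?exprn_ge0// ler_sqr ?nnegrE ?nrm_ge0 ?exprn_ge0 ?invr_ge0.
  by rewrite expr2 mulrA -exprMn mulfV// expr1n mul1r.
pose tot s := (\sum_(k <oo) (dk k s)%:E)%E.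
have mtot : measurable_fun D tot.
  by apply: ge0_emeasurable_sum => // k _; exact/measurable_EFinP.
have itot : mu.-integrable D tot.
  apply/integrableP; split => //.
  under eq_integral => s _.
    rewrite gee0_abs; last by apply: nneseries_ge0.
    over.
  rewrite integral_nneseries//; last by move=> k; exact/measurable_EFinP.
  apply: (@le_lt_trans _ _ (\sum_(k <oo) (2^-1 ^+ k * (1 + fine (mu D)))%:E)%E).
    by apply: lee_nneseries => // k *; first [exact: idk|by apply: integral_ge0].
  (* Written as a constant over [2 ^ (k + 1)], with the constant doubled, the series is the standard
     geometric one. *)
  under eq_eseriesr => k _.
    rewrite (_ : (_ * _)%R = (2 * (1 + fine (mu D))) / (2 ^ (k + 1))%:R); last first.
      rewrite addn1 natrX exprS invfM exprVn; set m := _ ^- _; lra.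
    over.
  have /cvg_lim -> // := @cvg_geometric_eseries_half R (2 * (1 + fine (mu D))) 0.
  by rewrite ltry.
pose G := D `&` [set s | (tot s < +oo)%E].
have mG : measurable G.
  rewrite (_ : G = D `&` [set s | tot s \is a fin_num]).
    exact: emeasurable_fin_num.
  by apply/seteqP; split => s [Ds /=]; rewrite ge0_fin_numE//; exact: nneseries_ge0.
(* Setting the subsequence to 0 off the set of convergence makes it converge everywhere, as
   [L2_fatou] demands, and changes it by functions of norm 0. *)
pose ww k s := (\1_G s : R) *: w k s.
have wwL k : L2 mu D (ww k).
  have [mw _] := wL k.
  have [] := @L2_dom _ _ _ mu D mD X X (ww k) (w k) 1 => //.
    by apply: borelZ => //; exact: measurable_indic.
  move=> s _; rewrite normrZ ler_wpM2r// indicE.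
  by case: (_ \in _); rewrite ?normr1// normr0.
have ww0 k : nrm mu D (fun s => w k s - ww k s) = 0.
  apply: (proj2 (nrm_eq0 mD (L2B mD X_sep (wL k) (wwL k)))). 
  have := integrable_ae mD itot; apply: filterS => s H Ds.
  rewrite /ww indicE mem_set ?scale1r ?subrr//; split => //=.
  have := H Ds; rewrite ge0_fin_numE//.
  by apply: nneseries_ge0.
have cww s : cvgn (ww ^~ s).
  have [Gs|nGs] := pselect (G s); last first.
    rewrite (_ : ww ^~ s = fun=> 0); first exact: is_cvg_cst.
    by apply/funext => k; rewrite /ww indicE memNset ?scale0r.
  rewrite (_ : ww ^~ s = w ^~ s); last first.
    by apply/funext => k; rewrite /ww indicE mem_set ?scale1r.
  have [Ds tots] := Gs.
  have : cvgn (series (fun k => w k.+1 s - w k s)).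
    apply: normed_cvg; apply: nondecreasing_is_cvgn.
      by apply: nondecreasing_series => n *; exact: normr_ge0.
    have t0 : (0 <= tot s)%E.
      by apply: nneseries_ge0.
    exists (fine (tot s)) => _ [n _ <-].
    rewrite -lee_fin fineK ?ge0_fin_numE// /series/= -sumEFin.
    by apply: nneseries_lim_ge.
  move=> /cvg_ex[l hl]; apply/cvg_ex; exists (w 0%N s + l).
  rewrite (_ : w ^~ s = (fun n => w 0%N s + series (fun k => w k.+1 s - w k s) n)).
    by apply: cvgD => //; exact: cvg_cst.
  by apply/funext => n; rewrite /series/= telescope_sumr// subrKC.
pose v s := limn (ww ^~ s).
have H (e : R) N : 0 < e -> (forall n m, (N <= n)%N -> (N <= m)%N ->
     nrm mu D (fun s => u n s - u m s) <= e) -> forall n, (N <= n)%N ->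
   L2 mu D (fun s => u n s - v s) /\ nrm mu D (fun s => u n s - v s) <= e.
  move=> e0 hN n Nn.
  (* The shift by [N] keeps all indices of the subsequence beyond [N], so that the Cauchy bound
     holds along it from the start. *)
  apply: (L2_fatou (hn := fun k s => u n s - ww (k + N)%N s)) => //.
  - exact: ltW.
  - by move=> k; exact: L2B.
  - move=> k; apply: le_trans (nrm_dist mD X_sep (uL n) (wL (k + N)%N) (wwL _)) _.
    rewrite ww0 addr0; apply: hN => //.
    apply: leq_trans (nkN _); have [+ _] := svalP (N_ (k + N)%N).
    by apply: leq_trans; rewrite leq_addl.
  - move=> s Ds; apply: cvgB; first exact: cvg_cst.
    by have := cww s; rewrite -(cvg_shiftn N).
have vL : L2 mu D v.
  have [N hN] := uC 1 ltr01; have [L _] := H 1 N ltr01 hN N (leqnn _).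
  have := L2B mD X_sep (uL N) L.
  by congr (L2 mu D); apply/funext => s; rewrite subKr.
exists v => // e e0; have [N hN] := uC e e0.
by exists N => n Nn; have [] := H e N e0 hN n Nn.
Qed.

End L2Conv.

(** * Bochner integrals *)

(** The integral of a nonnegative function is a supremum over simple functions below it, so this
    monotonicity holds without measurability of [f]. It is applied to norms known to be measurable
    only off a null set. *)
Lemma ge0_integral_subset (R : realType) (d : measure_display)
    (S : measurableType d) (mu : {measure set S -> \bar R}) (D E : set S)
    (f : S -> \bar R) : (forall s, 0 <= f s)%E -> D `<=` E ->
  (\int[mu]_(s in D) f s <= \int[mu]_(s in E) f s)%E.
Proof.
move=> f0 DE; rewrite integral_mkcond [in leRHS]integral_mkcond.
have p0 A s : (0 <= (f \_ A) s)%E by rewrite /patch; case: ifP.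
rewrite !ge0_integralTE//; apply: le_ereal_sup => _ [h hf <-].
exists h => //= s; apply: le_trans (hf s) _.
rewrite {1}/patch; case: ifPn => [/set_mem Ds|_]; last exact: p0.
by rewrite patchE mem_set//; exact: DE.
Qed.

Section Bochner.
Context (R : realType) (d : measure_display) (Omega : measurableType d).
Context (P : probability Omega R) (X : hilbertType R) (X_sep : separable X).
Implicit Types (E : nat -> set R) (V : nat -> Omega -> X) (W : Omega -> X) (m : nat) (s : R).

Local Notation N := (nrm P setT).
Local Notation L := (L2 P setT).
Local Notation leb := (@lebesgue_measure R).
Let mT : measurable [set: Omega] := measurableT.

Definition sfun m (E : nat -> set R) (V : nat -> Omega -> X) (s : R) w : X :=
  \sum_(i < m) \1_(E i) s *: V i w.

Definition sint m (E : nat -> set R) (V : nat -> Omega -> X) w : X :=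
  \sum_(i < m) fine (leb (E i)) *: V i w.

Lemma L2_sfun m E V s : (forall i, L (V i)) -> L (sfun m E V s).
Proof. by move=> VL; apply: L2_sum => // i _; exact: L2Z. Qed.

Lemma L2_sint m E V : (forall i, L (V i)) -> L (sint m E V).
Proof. by move=> VL; apply: L2_sum => // i _; exact: L2Z. Qed.

Lemma ip_sfun m E V s W : (forall i, L (V i)) -> L W ->
  ip P setT (sfun m E V s) W = \sum_(i < m) \1_(E i) s * ip P setT (V i) W.
Proof.
move=> VL WL; rewrite /sfun ip_sum//; last by move=> i _; exact: L2Z.
by apply: eq_bigr => i _; rewrite ipZ.
Qed.

(** The squared distance expands into inner products, each a finite combination of products of
    indicators. *)
Lemma measurable_nrm_sfun m E V m' E' V' :
  (forall i, measurable (E i)) -> (forall i, measurable (E' i)) ->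
  (forall i, L (V i)) -> (forall i, L (V' i)) ->
  measurable_fun setT (fun s => N (fun w => sfun m E V s w - sfun m' E' V' s w)).
Proof.
move=> mE mE' VL VL'.
have H n F (W : nat -> Omega -> X) n' F' (W' : nat -> Omega -> X) :
    (forall i, measurable (F i)) -> (forall i, measurable (F' i)) ->
    (forall i, L (W i)) -> (forall i, L (W' i)) ->
    measurable_fun setT (fun s => ip P setT (sfun n F W s) (sfun n' F' W' s)).
  move=> mF mF' WL WL'; under eq_fun.
    move=> s; rewrite ip_sfun//; last exact: L2_sfun.
    under eq_bigr do rewrite ipC ip_sfun//.
    over.
  apply: measurable_sum => i; apply: measurable_funM.
    exact: measurable_indic.
  apply: measurable_sum => j; apply: measurable_funM => //.
under eq_fun.
  move=> s; rewrite -[N _]ger0_norm ?nrm_ge0// -sqrtr_sqr.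
  have sL := L2_sfun m E s VL; have sL' := L2_sfun m' E' s VL'.
  rewrite -ip_nrm//; last exact: L2B.
  rewrite ipB//; last exact: L2B.
  rewrite ipC [ip _ _ _ (fun _ => _ - _)]ipC !ipB//.
  over.
have msqrt : measurable_fun setT (@Num.sqrt R).
  by apply: continuous_measurable_fun; exact: sqrt_continuous.
apply: (measurableT_comp msqrt).
by apply: measurable_funB; apply: measurable_funB; exact: H.
Qed.

(** Testing against a fixed variable [W] reduces the integral of a simple function to a scalar
    Lebesgue integral. *)
Lemma ip_sint t m E V W : (forall i, measurable (E i)) ->
  (forall i, E i `<=` `[0, t]) -> (forall i, L (V i)) -> L W ->
  leb.-integrable `[0, t] (EFin \o fun s => ip P setT (sfun m E V s) W) /\
  ip P setT (sint m E V) W =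
  \int[leb]_(s in `[0, t]) ip P setT (sfun m E V s) W.
Proof.
move=> mE Et VL WL.
have lebEt i : (E i `&` `[0, t]) = E i by apply/setIidPl; exact: Et.
have fE i : (leb (E i) < +oo)%E.
  apply: (@le_lt_trans _ _ (leb `[0, t])).
    by apply: le_measure; rewrite ?inE//; exact: mE.
  by rewrite lebesgue_measure_itv/=; case: ifP => _; rewrite ?ltry// ltey.
have iE i : leb.-integrable `[0, t] (EFin \o \1_(E i)).
  apply/integrableP; split.
    by apply/measurable_EFinP; apply: measurable_indic; exact: mE.
  under eq_integral do rewrite gee0_abs ?lee_fin//.
  by rewrite integral_indic; [rewrite lebEt; exact: fE|exact: measurable_itv|exact: mE].
have iEc i c : leb.-integrable `[0, t] (EFin \o (fun s => \1_(E i) s * c)).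
  rewrite (_ : _ \o _ = fun s => ((EFin \o \1_(E i)) s * c%:E)%E)//.
  exact: integrableZr.
have -> : (fun s => ip P setT (sfun m E V s) W) =
    (fun s => \sum_(i < m) \1_(E i) s * ip P setT (V i) W).
  by apply/funext => s; rewrite ip_sfun.
rewrite /sint ip_sum//; last by move=> i _; exact: L2Z.
elim: m => [|m [IH1 IH2]].
  split; last by rewrite big_ord0 /Rintegral; under eq_integral do rewrite big_ord0; rewrite integral0.
  by rewrite (_ : _ \o _ = fun=> 0%E); [exact: integrable0|apply/funext => s /=; rewrite big_ord0].
split.
  pose a s := \sum_(i < m) \1_(E i) s * ip P setT (V i) W.
  pose b s := \1_(E m) s * ip P setT (V m) W.
  rewrite (_ : _ \o _ = ((EFin \o a) \+ (EFin \o b))%E).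
    by apply: integrableD => //; exact: iEc.
  by apply/funext => s /=; rewrite big_ord_recr.
rewrite big_ord_recr /= {}IH2; under [in RHS]eq_Rintegral do rewrite big_ord_recr/=.
rewrite RintegralD//; congr (_ + _); rewrite ipZ// RintegralZr//.
by rewrite /Rintegral integral_indic; [rewrite lebEt|exact: measurable_itv|exact: mE].
Qed.

(** Test the difference [Z] of the integrals against itself: its squared norm is an integral of
    inner products with [Z], Cauchy-Schwarz bounds these by norms times that of [Z], and one factor
    cancels. *)
Lemma sint_le t m E V m' E' V' :
  (forall i, measurable (E i)) -> (forall i, measurable (E' i)) ->
  (forall i, E i `<=` `[0, t]) -> (forall i, E' i `<=` `[0, t]) ->
  (forall i, L (V i)) -> (forall i, L (V' i)) ->
  ((N (fun w => sint m E V w - sint m' E' V' w))%:E <=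
   \int[leb]_(s in `[0%R, t])
     (N (fun w => sfun m E V s w - sfun m' E' V' s w))%:E)%E.
Proof.
move=> mE mE' Et Et' VL VL'; set Z := (fun w => sint m E V w - _).
have ZL : L Z by apply: L2B => //; exact: L2_sint.
have [i1 e1] := ip_sint m mE Et VL ZL.
have [i2 e2] := ip_sint m' mE' Et' VL' ZL.
have mN := measurable_nrm_sfun m m' mE mE' VL VL'.
have mNt : measurable_fun `[0, t] (fun s =>
    (N (fun w => sfun m E V s w - sfun m' E' V' s w))%:E).
  by apply/measurable_EFinP; exact: measurable_funS mN.
have [Z0|Zn0] := eqVneq (N Z) 0.
  by rewrite Z0; apply: integral_ge0 => s _; rewrite lee_fin nrm_ge0.
have Zgt0 : 0 < N Z by rewrite lt_neqAle eq_sym Zn0 nrm_ge0.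
pose a s := ip P setT (sfun m E V s) Z; pose b s := ip P setT (sfun m' E' V' s) Z.
have iB : leb.-integrable `[0, t] (EFin \o (fun s => a s - b s)).
  rewrite (_ : _ \o _ = ((EFin \o a) \- (EFin \o b))%E)//.
  exact: integrableB.
have [mab _] := integrableP _ _ _ iB.
rewrite -(@lee_pmul2l _ (N Z)%:E)// -EFinM -expr2 -ip_nrm// {1}/Z ipB//; try exact: L2_sint.
rewrite e1 e2 -RintegralB// -/(a _) -/(b _).
rewrite -ge0_integralZl_EFin//;
  [|by move=> s _; rewrite lee_fin nrm_ge0|exact: nrm_ge0].
rewrite /Rintegral fineK; last exact: integrable_fin_num.
apply: (@le_trans _ _ (\int[leb]_(s in `[0%R, t]) `|(a s - b s)%:E|)%E).
  by apply: le_trans (lee_abs _) _; exact: le_abse_integral.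
apply: ge0_le_integral => //.
- exact: measurableT_comp.
- exact: emeasurable_funM.
- move=> s _; rewrite -EFinM lee_fin -ipB//; try exact: L2_sfun.
  by rewrite mulrC; apply: ip_le => //; apply: L2B => //; exact: L2_sfun.
Qed.

(** A majorant [G] stands in for the norm of the difference, so that in the applications only [G]
    has to be shown measurable. With [G = 0] this is uniqueness of the integral up to null sets. *)
Lemma bochner_le t (Phi Phi' : R -> Omega -> X) (Z Z' : Omega -> X) (G : R -> R) :
  is_bochner_integral P t Phi Z -> is_bochner_integral P t Phi' Z' ->
  measurable_fun `[0, t] G ->
  (forall s, 0 <= s <= t -> N (fun w => Phi s w - Phi' s w) <= G s) ->
  ((N (fun w => Z w - Z' w))%:E <= \int[leb]_(s in `[0%R, t]) (G s)%:E)%E.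
Proof.
move=> [PL ZL [m [E [V [HE ae1 int1 cv1]]]]].
move=> [PL' ZL' [m' [E' [V' [HE' ae2 int2 cv2]]]]] mG leG.
pose S k := sfun (m k) (E k) (V k); pose S' k := sfun (m' k) (E' k) (V' k).
pose I k := sint (m k) (E k) (V k); pose I' k := sint (m' k) (E' k) (V' k).
have mE k i : measurable (E k i) by have [] := HE k i.
have mE' k i : measurable (E' k i) by have [] := HE' k i.
have VL k i : L (V k i) by have [] := HE k i.
have VL' k i : L (V' k i) by have [] := HE' k i.
have SL k s : L (S k s) by exact: L2_sfun.
have SL' k s : L (S' k s) by exact: L2_sfun.
have IL k : L (I k) by exact: L2_sint.
have IL' k : L (I' k) by exact: L2_sint.
have [A0 [mA0 A00 subA]] := ae1; have [A1 [mA1 A10 subA']] := ae2.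
(* Off the two exceptional sets both sequences of simple functions converge; there the errors are
   limits of distances between simple functions, hence measurable. *)
pose D := `[0, t] `\` (A0 `|` A1) : set R.
have mD : measurable D by apply: measurableD => //; exact: measurableU.
have Dt s : D s -> 0 <= s <= t by move=> [/=]; rewrite in_itv.
have DE s : D s -> N (fun w => S k s w - Phi s w) @[k --> \oo] --> (0 : R) /\
                   N (fun w => S' k s w - Phi' s w) @[k --> \oo] --> (0 : R).
  move=> Ds; have st := Dt _ Ds; have [_ nA] := Ds; split.
    apply/cvg_L2normP; first by apply: nearW => k; apply: L2B => //; exact: PL.
    by apply: contrapT => H; apply: nA; left; apply: subA => /= /(_ st).
  apply/cvg_L2normP; first by apply: nearW => k; apply: L2B => //; exact: PL'.
  by apply: contrapT => H; apply: nA; right; apply: subA' => /= /(_ st).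
have lim_nrm (F : nat -> Omega -> X) (f W : Omega -> X) :
    (forall k, L (F k)) -> L f -> L W ->
    N (fun w => F k w - f w) @[k --> \oo] --> (0 : R) ->
    N (fun w => W w - F k w) @[k --> \oo] --> N (fun w => W w - f w).
  move=> FL fL WL Ff; apply/cvgrPdist_le => e e0.
  have /cvgrPdist_le/(_ _ e0) := Ff; apply: filterS => k.
  rewrite sub0r normrN ger0_norm ?nrm_ge0// => /(le_trans _); apply.
  apply: le_trans (nrm_sub_le _ _ _ _) _ => //; try exact: L2B.
  rewrite (_ : (fun w => _) = (fun w => F k w - f w))//.
  by apply/funext => w; rewrite opprB addrC addrA subrK.
have mS k : measurable_fun D (fun s => N (fun w => S k s w - Phi s w)).
  apply: (measurable_fun_cvg (h := fun j s => N (fun w => S k s w - S j s w))).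
    by move=> j; apply: measurable_funS (measurable_nrm_sfun _ _ _ _ _ _).
  move=> s Ds; have [cs _] := DE s Ds.
  by apply: lim_nrm => //; apply: PL; exact: Dt.
have mS' k : measurable_fun D (fun s => N (fun w => S' k s w - Phi' s w)).
  apply: (measurable_fun_cvg (h := fun j s => N (fun w => S' k s w - S' j s w))).
    by move=> j; apply: measurable_funS (measurable_nrm_sfun _ _ _ _ _ _).
  move=> s Ds; have [_ cs] := DE s Ds.
  by apply: lim_nrm => //; apply: PL'; exact: Dt.
have mGD : measurable_fun D G by apply: measurable_funS mG => // s [].
pose e k := (\int[leb]_(s in `[0%R, t]) L2norm P setT (S k s \- Phi s)%R)%E.
pose e' k := (\int[leb]_(s in `[0%R, t]) L2norm P setT (S' k s \- Phi' s)%R)%E.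
(* The integrands are inserted between the two simple functions; [e k] and [e' k] collect the
   approximation errors, which vanish in the limit. *)
have key k : ((N (fun w => I k w - I' k w))%:E <=
    e k + \int[leb]_(s in `[0%R, t]) (G s)%:E + e' k)%E.
  apply: le_trans (sint_le _ _ _ _ (t := t) _ _ _ _) _ => //;
    try by move=> i; have [] := HE k i.
    by move=> i; have [] := HE' k i.
  have mS1 : measurable_fun D (fun s => (N (fun w => S k s w - Phi s w))%:E).
    exact/measurable_EFinP.
  have mS2 : measurable_fun D (fun s => (N (fun w => S' k s w - Phi' s w))%:E).
    exact/measurable_EFinP.
  have mG1 : measurable_fun D (fun s => (G s)%:E) by exact/measurable_EFinP.
  have mSS A : measurable_fun A (fun s => (N (fun w => S k s w - S' k s w))%:E).
    apply/measurable_EFinP.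
    by apply: measurable_funS (measurable_nrm_sfun _ _ _ _ _ _).
  rewrite (@ge0_negligible_integral _ _ _ _ _ (A0 `|` A1))//; last 4 first.
  - exact: measurableU.
  - exact: mSS.
  - by move=> s _; rewrite lee_fin nrm_ge0.
  - by transitivity (leb A0); [exact: measureU0|exact: A00].
  apply: (@le_trans _ _ (\int[leb]_(s in D)
     ((N (fun w => S k s w - Phi s w))%:E + (G s)%:E
       + (N (fun w => S' k s w - Phi' s w))%:E)))%E.
    apply: ge0_le_integral => //.
    - by move=> s _; rewrite lee_fin nrm_ge0.
    - exact: mSS.
    - by apply: emeasurable_funD => //; apply: emeasurable_funD.
    move=> s Ds; rewrite -!EFinD lee_fin.
    have [PsL PsL'] := (PL s (Dt _ Ds), PL' s (Dt _ Ds)).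
    apply: le_trans (nrm_dist mT X_sep (SL k s) PsL (SL' k s)) _.
    rewrite -addrA lerD2l.
    apply: le_trans (nrm_dist mT X_sep PsL PsL' (SL' k s)) _.
    by rewrite (nrmB _ _ (Phi' s) (S' k s)) lerD2r; apply: leG; exact: Dt.
  have G0 s : D s -> (0 <= (G s)%:E)%E.
    by move=> /Dt/leG; rewrite lee_fin; apply: le_trans; exact: nrm_ge0.
  rewrite ge0_integralD; [|exact: mD|
    by move=> s Ds; rewrite adde_ge0// ?G0// lee_fin nrm_ge0|
    exact: emeasurable_funD|by move=> s _; rewrite lee_fin nrm_ge0|exact: mS2].
  rewrite ge0_integralD; [|exact: mD|by move=> s _; rewrite lee_fin nrm_ge0|exact: mS1|exact: G0|exact: mG1].
  have DI : D `<=` `[0, t] by move=> s [].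
  apply: leeD; first apply: leeD.
  - apply: (@le_trans _ _ (\int[leb]_(s in D) L2norm P setT (S k s \- Phi s)%R)%E).
      rewrite le_eqVlt; apply/orP; left; apply/eqP; apply: eq_integral => s.
      rewrite inE => /Dt st; rewrite -L2norm_fin//.
      by apply: L2B => //; exact: PL.
    by apply: ge0_integral_subset => // s; exact: Lnorm_ge0.
  - apply: ge0_subset_integral => //; first exact/measurable_EFinP.
    move=> s /=; rewrite in_itv/= => /leG; rewrite lee_fin.
    by apply: le_trans; exact: nrm_ge0.
  - apply: (@le_trans _ _ (\int[leb]_(s in D) L2norm P setT (S' k s \- Phi' s)%R)%E).
      rewrite le_eqVlt; apply/orP; left; apply/eqP; apply: eq_integral => s.
      rewrite inE => /Dt st; rewrite -L2norm_fin//.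
      by apply: L2B => //; exact: PL'.
    by apply: ge0_integral_subset => // s; exact: Lnorm_ge0.
set J := (\int[leb]_(s in _) _)%E in key *.
(* An infinite majorant makes the claim trivial; a finite [J] allows limits to be added in
   [\bar R]. *)
have [->|Joo] := eqVneq J +oo%E; first by rewrite leey.
have J0 : (0 <= J)%E.
  apply: integral_ge0 => s /=; rewrite in_itv/= => /leG; rewrite lee_fin.
  by apply: le_trans; exact: nrm_ge0.
have Jfin : J \is a fin_num by rewrite ge0_fin_numE// ltey.
have cI : N (fun w => I k w - Z w) @[k --> \oo] --> (0 : R).
  by apply/cvg_L2normP => //; apply: nearW => k; exact: L2B.
have cI' : N (fun w => I' k w - Z' w) @[k --> \oo] --> (0 : R).
  by apply/cvg_L2normP => //; apply: nearW => k; exact: L2B.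
have c1 : ((N (fun w => I k w - I' k w))%:E @[k --> \oo] -->
    (N (fun w => Z w - Z' w))%:E)%E.
  apply: cvg_EFin; first exact: nearW.
  apply/cvgrPdist_le => e0 e0gt0.
  have : (N (fun w => I k w - Z w) + N (fun w => I' k w - Z' w))
    @[k --> \oo] --> (0 + 0 : R) by exact: cvgD.
  rewrite addr0 => /cvgrPdist_le/(_ _ e0gt0).
  apply: filterS => k; rewrite sub0r normrN ger0_norm ?addr_ge0 ?nrm_ge0//.
  move=> H; apply: le_trans H.
  apply: le_trans (nrm_sub_le mT X_sep (L2B mT X_sep ZL ZL') (L2B mT X_sep (IL k) (IL' k))) _.
  rewrite (nrmB _ _ (I k)).
  apply: le_trans (nrmD mT X_sep (L2B mT X_sep ZL (IL k)) (L2B mT X_sep (IL' k) ZL')).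
  rewrite le_eqVlt; apply/orP; left; apply/eqP; congr nrm; apply/funext => w.
  by rewrite opprB addrACA [RHS]addrACA (addrC (- Z' w)).
have c2 : (e k + J + e' k @[k --> \oo] --> J)%E.
  rewrite -[X in _ --> X]adde0; apply: cvgeD; [|rewrite -[X in _ --> X]add0e; apply: cvgeD|exact: int2].
  - by rewrite fin_num_adde_defl.
  - by rewrite fin_num_adde_defr.
  - exact: int1.
  - exact: cvg_cst.
rewrite -(cvg_lim _ c1)// -(cvg_lim _ c2)//; apply: lee_lim.
- exact: cvgP c1.
- exact: cvgP c2.
- exact: nearW.
Qed.

End Bochner.

(** * Existence of Bochner integrals *)

Section BochnerExists.
Context (R : realType) (d : measure_display) (Omega : measurableType d).
Context (P : probability Omega R) (X : hilbertType R) (X_sep : separable X).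

Local Notation N := (nrm P setT).
Local Notation L := (L2 P setT).
Local Notation leb := (@lebesgue_measure R).
Let mT : measurable [set: Omega] := measurableT.

Lemma L2P_complete (u : nat -> Omega -> X) : (forall n, L (u n)) ->
  (forall e : R, 0 < e -> exists K, forall n m, (K <= n)%N -> (K <= m)%N ->
     N (fun w => u n w - u m w) <= e) ->
  exists2 v : Omega -> X, L v &
    N (fun w => u n w - v w) @[n --> \oo] --> (0 : R).
Proof.
move=> uL uC; have Poo : (P setT < +oo)%E by rewrite probability_setT ltry.
have [v vL hv] := L2_complete mT X_sep Poo uL uC.
exists v => //; apply/cvgrPdist_le => e e0; have [K hK] := hv e e0.
exists K => // n /= Kn.
by rewrite sub0r normrN ger0_norm ?nrm_ge0//; exact: hK.
Qed.

(** A criterion in the style of Pettis: the [k]-th simple function takes the value nearest to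
    [Phi s] among the first [k + 1] of the [v i]. Density is asked only around the values of [Phi],
    measurability only of scalar distances, and [v 0 = 0] bounds the errors by [C]. *)
Lemma bochner_exists (t : R) (Phi : R -> Omega -> X) (v : nat -> Omega -> X) (C : R) :
  0 <= t -> (forall s : R, 0 <= s <= t -> L (Phi s)) ->
  (forall s : R, 0 <= s <= t -> N (Phi s) <= C) ->
  (forall i, L (v i)) -> v 0%N = (fun=> 0) ->
  (forall i, measurable_fun `[0, t] (fun s => N (fun w => Phi s w - v i w))) ->
  (forall s e : R, 0 <= s <= t -> 0 < e -> exists i, N (fun w => Phi s w - v i w) < e) ->
  exists Z, is_bochner_integral P t Phi Z.
Proof.
move=> t0 PL PC vL v0 mv dv.
pose p i s := N (fun w => Phi s w - v i w).
pose D : set R := `[0, t]%classic.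
have mD : measurable D by exact: measurable_itv.
have Doo : (leb D < +oo)%E.
  by rewrite lebesgue_measure_itv/=; case: ifP => _; rewrite ?ltry// ltey.
pose E k i := D `&` [set s | argmin p k s = i].
have mE k i : measurable (E k i) by exact: (measurable_argmin mD mv).
have Et k i : E k i `<=` `[0, t] by move=> s [].
have sE k s : D s -> sfun k.+1 (E k) v s = v (argmin p k s).
  move=> Ds; apply/funext => w; rewrite /sfun.
  have ak : (argmin p k s < k.+1)%N by rewrite ltnS argmin_le.
  rewrite (bigD1 (Ordinal ak))//= indicE mem_set ?scale1r; last by split.
  rewrite big1 ?addr0// => i /eqP ni; rewrite indicE memNset ?scale0r// => -[_ /= ai].
  by apply: ni; exact/val_inj.
have sL k s : L (sfun k.+1 (E k) v s) by exact: L2_sfun.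
pose e k s := N (fun w => sfun k.+1 (E k) v s w - Phi s w).
have eE k s : D s -> e k s = p (argmin p k s) s.
  by move=> Ds; rewrite /e sE// nrmB.
have me k : measurable_fun D (e k).
  apply: (eq_measurable_fun (fun s => p (argmin p k s) s)).
    by move=> s; rewrite inE => /(eE k) ->.
  apply: (borel_measurable mD); apply: (borel_glue mD (F := p)); last exact: mE.
  by move=> i; apply: (measurable_borel mD); exact: mv.
have e_le k s : D s -> e k s <= C.
  move=> Ds; rewrite eE//; apply: le_trans (argminP p s (leq0n k)) _.
  rewrite /p v0; under [X in N X]eq_fun do rewrite subr0.
  by apply: PC; move: Ds; rewrite /D /= in_itv.
have e_cvg s : D s -> e k s @[k --> \oo] --> (0 : R).
  move=> Ds; have st : 0 <= s <= t by move: Ds; rewrite /D /= in_itv.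
  apply/cvgrPdist_lt => eps eps0; have [i hi] := dv s eps st eps0.
  exists i => // k /= ik; rewrite sub0r normrN ger0_norm ?nrm_ge0// eE//.
  exact: le_lt_trans (argminP p s ik) hi.
have int_e : (\int[leb]_(s in D) (e k s)%:E @[k --> \oo] --> 0)%E.
  rewrite -[X in _ --> X](integral0 leb D).
  apply: (@dominated_cvg _ _ _ leb D _ (fun k s => (e k s)%:E) _ (fun=> C%:E)) => //.
  - by move=> k; apply/measurable_EFinP; exact: me.
  - by move=> s Ds; apply: cvg_EFin; [exact: nearW|exact: e_cvg].
  - apply/integrableP; split; first exact: measurable_cst.
    by rewrite integral_cst//; exact: lte_mul_pinfty.
  - by move=> k s Ds; rewrite /= lee_fin ger0_norm ?nrm_ge0//; exact: e_le.
have sIL k : L (sint k.+1 (E k) v) by exact: L2_sint.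
(* The integrals form a Cauchy sequence, because [sint_le] bounds their distance by the sum of the
   two integrated errors. *)
have [Z ZL hZ] : exists2 Z, L Z &
    N (fun w => sint k.+1 (E k) v w - Z w) @[k --> \oo] --> (0 : R).
  apply: L2P_complete => // eps eps0.
  have /fine_cvgP[fin_e /cvgrPdist_le/(_ (eps / 2))] := int_e.
  rewrite divr_gt0// => /(_ isT) He; have [K _ HK] := filterI fin_e He.
  exists K => n m Kn Km; have [fn hn] := HK n Kn; have [fm hm] := HK m Km.
  have H := @sint_le R d Omega P X X_sep t n.+1 (E n) v m.+1 (E m) v
    (mE n) (mE m) (Et n) (Et m) vL vL.
  rewrite -lee_fin; apply: (le_trans H).
  apply: (@le_trans _ _ (\int[leb]_(s in D) ((e n s)%:E + (e m s)%:E))%E).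
    apply: ge0_le_integral => //.
    - by move=> s _; rewrite lee_fin nrm_ge0.
    - apply/measurable_EFinP.
      by apply: measurable_funS (measurable_nrm_sfun X_sep n.+1 m.+1 (mE n) (mE m) vL vL).
    - by apply: emeasurable_funD; apply/measurable_EFinP; exact: me.
    move=> s Ds; rewrite -EFinD lee_fin.
    have PsL : L (Phi s) by apply: PL; move: Ds; rewrite /D /= in_itv.
    apply: le_trans (nrm_dist mT X_sep (sL n s) PsL (sL m s)) _.
    by rewrite (nrmB _ _ (Phi s)).
  rewrite ge0_integralD//; last 4 first.
  - by move=> s _; rewrite lee_fin nrm_ge0.
  - by apply/measurable_EFinP; exact: me.
  - by move=> s _; rewrite lee_fin nrm_ge0.
  - by apply/measurable_EFinP; exact: me.
  rewrite -(fineK fn) -(fineK fm) -EFinD lee_fin (splitr eps).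
  move: hn hm; rewrite /= !sub0r !normrN => hn hm.
  by rewrite lerD// (le_trans (ler_norm _)).
exists Z; split => //.
exists (fun k => k.+1), E, (fun=> v) => /=; split.
- by move=> k i; split.
- apply: aeW => s st.
  have Ds : D s by rewrite /D /= in_itv.
  apply/cvg_L2normP; last exact: e_cvg.
  by apply: nearW => k; apply: (L2B mT X_sep (sL _ _)); exact: PL.
- move: int_e; apply: cvg_trans; apply: near_eq_cvg; apply: nearW => k.
  apply: eq_integral => s; rewrite inE => Ds; rewrite -L2norm_fin//.
  by apply: (L2B mT X_sep (sL _ _)); apply: PL; move: Ds; rewrite /D /= in_itv.
- apply/cvg_L2normP => //; apply: nearW => k; apply: L2B => //; exact: sIL.
Qed.

End BochnerExists.

Section BochnerLim.
Context (R : realType) (d : measure_display) (Omega : measurableType d).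
Context (P : probability Omega R) (X : hilbertType R) (X_sep : separable X).

Local Notation N := (nrm P setT).
Local Notation L := (L2 P setT).
Let mT : measurable [set: Omega] := measurableT.

(** The countable family for [bochner_exists] consists essentially of the values of all [F n] at
    rational times: each [F n] is continuous on [[0, t[] and they approach [Phi] pointwise there.
    The interval is half-open because norm continuity of [U t s] stops at [s = t]. *)
Lemma bochner_exists_lim (t C : R) (Phi : R -> Omega -> X)
    (F : nat -> R -> Omega -> X) :
  0 <= t -> (forall s : R, 0 <= s <= t -> L (Phi s)) ->
  (forall s : R, 0 <= s <= t -> N (Phi s) <= C) ->
  (forall n (s : R), 0 <= s < t -> L (F n s)) ->
  (forall n (s : R), 0 <= s < t ->
    N (fun w => F n s' w - F n s w) @[s' --> within `[0, t[ (nbhs s)] --> (0 : R)) ->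
  (forall s : R, 0 <= s < t ->
    N (fun w => F n s w - Phi s w) @[n --> \oo] --> (0 : R)) ->
  exists Z, is_bochner_integral P t Phi Z.
Proof.
move=> t0 PL PC FL cF FP.
have ltt (s : R) : 0 <= s < t -> 0 <= s <= t by move=> /andP[-> /ltW].
(* Index 0 carries the value 0. For the others, the outer [None] is a number that codes nothing, the
   inner one stands for the endpoint value [Phi t], which the [F n] do not reach, and [(n, q)] for
   [F n] at the rational [q]. *)
pose v (i : nat) : Omega -> X := if i is j.+1 then
  match unpickle j : option (option (nat * rat)) with
  | Some None => Phi t
  | Some (Some (n, q)) => if 0 <= (ratr q : R) < t then F n (ratr q) else fun=> 0
  | None => fun=> 0
  end else fun=> 0.
have vL i : L (v i).
  case: i => [|j]; first exact: L2_0.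
  rewrite /v; case: unpickle => [[[n q]|]|]; try exact: L2_0.
    by case: ifPn => [|_]; [exact: FL|exact: L2_0].
  by apply: PL; rewrite t0 lexx.
apply: (bochner_exists X_sep (v := v) (C := C)) => // [i|s e st e0].
  (* The endpoint is a single point; on the rest the distance is a limit of continuous functions. *)
  have -> : `[0, t]%classic = `[0, t[%classic `|` [set t] :> set R.
    by rewrite setUitv1// bnd_simp.
  apply/(measurable_funU _ (measurable_itv _) (measurable_set1 _)); split; last exact: measurable_fun_set1.
  apply: (measurable_fun_cvg (h := fun n s => N (fun w => F n s w - v i w))).
    move=> n; apply: subspace_continuous_measurable_fun => //.
    apply/subspace_continuousP => s; rewrite /= in_itv /= => st.
    apply/cvgrPdist_le => e e0; have /cvgrPdist_le/(_ _ e0) := cF n s st.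
    rewrite !near_withinE; apply: filterS => s' H /[dup] s't /H.
    rewrite sub0r normrN ger0_norm ?nrm_ge0// nrmB; apply: le_trans.
    have Fs := FL n s st.
    have Fs' : L (F n s') by apply: FL; move: s't; rewrite /= in_itv.
    apply: le_trans (nrm_sub_le mT X_sep (L2B mT X_sep Fs (vL i)) (L2B mT X_sep Fs' (vL i))) _.
    rewrite le_eqVlt; apply/orP; left; apply/eqP; congr nrm; apply/funext => w.
    by rewrite opprB addrA subrK.
  move=> s; rewrite /= in_itv/= => st.
  apply/cvgrPdist_le => e e0; have /cvgrPdist_le/(_ _ e0) := FP s st.
  apply: filterS => n; rewrite sub0r normrN ger0_norm ?nrm_ge0// nrmB.
  apply: le_trans; have PsL := PL s (ltt _ st); have Fs := FL n s st.
  apply: le_trans (nrm_sub_le mT X_sep (L2B mT X_sep PsL (vL i)) (L2B mT X_sep Fs (vL i))) _.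
  rewrite le_eqVlt; apply/orP; left; apply/eqP; congr nrm; apply/funext => w.
  by rewrite opprB addrA subrK.
have [st'|ts] := ltP s t; last first.
  have -> : s = t by apply/eqP; rewrite eq_le ts andbT; case/andP: st.
  exists (pickle (@None (nat * rat))).+1; rewrite /v pickleK.
  by rewrite (_ : (fun w => _) = fun=> 0) ?nrm0//; apply/funext => w; rewrite subrr.
have {}st' : 0 <= s < t by rewrite st'; case/andP: st => ->.
have e20 : 0 < e / 2 by rewrite divr_gt0.
have /cvgrPdist_lt/(_ _ e20)[n _ /(_ _ (leqnn _))] := FP s st'.
rewrite sub0r normrN ger0_norm ?nrm_ge0// => Hn.
have /cvgrPdist_lt/(_ _ e20) := cF n s st'.
rewrite near_withinE => /nbhs_ballP[dl /= dl0 Hdl].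
(* A rational to the right of [s], before [t] and within the radius of continuity of [F n] at
   [s]. *)
have [q] : exists q : rat, (ratr q : R) \in `]s, (Num.min t (s + dl))[.
  by apply: rat_in_itvoo; rewrite lt_min ltrDl dl0 andbT; case/andP: st'.
rewrite in_itv/= lt_min => /and3P[sq qt qdl].
have qt' : 0 <= (ratr q : R) < t.
  by rewrite qt andbT (le_trans _ (ltW sq))//; case/andP: st'.
exists (pickle (Some (n, q))).+1; rewrite /v pickleK qt'.
have PsL := PL s st; have Fs := FL n s st'; have Fq := FL n _ qt'.
apply: le_lt_trans (nrm_dist mT X_sep PsL Fs Fq) _.
rewrite (splitr e); apply: ltrD; first by rewrite nrmB.
rewrite nrmB.
have := Hdl (ratr q); rewrite sub0r normrN ger0_norm ?nrm_ge0//; apply.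
  rewrite -ball_normE /=; set y : R := ratr q in sq qdl *.
  by rewrite ltr_norml; apply/andP; split; lra.
by rewrite /= in_itv.
Qed.

Lemma continuous_L2P (a b : R) (x : R -> Omega -> X) :
  continuous_L2 P a b x <-> forall t : R, a <= t <= b -> L (x t) /\
    N (fun w => x s w - x t w) @[s --> within `[a, b] (nbhs t)] --> (0 : R).
Proof.
split => H t tab; have [xL Hx] := H t tab; split => //.
  apply: (proj1 (cvg_L2normP _)) Hx; rewrite near_withinE.
  apply: nearW => s; rewrite /= in_itv /= => sab.
  by apply: L2B => //; have [] := H s sab.
apply: (proj2 (cvg_L2normP _)) Hx; rewrite near_withinE.
apply: nearW => s; rewrite /= in_itv /= => sab.
by apply: L2B => //; have [] := H s sab.
Qed.

End BochnerLim.

(** * Evolution operators *)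

Section Linear.
Context (R : realType) (V W : normedModType R) (F : V -> W) (F_lin : linear F).

Lemma linear_fun0 : F 0 = 0.
Proof. by have := F_lin 1 0 0; rewrite !scale1r addr0 => /eqP; rewrite -[X in X == _]addr0 (inj_eq (addrI _)) eq_sym => /eqP. Qed.

Lemma linear_funZ a x : F (a *: x) = a *: F x.
Proof. by have := F_lin a x 0; rewrite !addr0 linear_fun0 addr0. Qed.

Lemma linear_funD x y : F (x + y) = F x + F y.
Proof. by have := F_lin 1 x y; rewrite !scale1r. Qed.

Lemma linear_funB x y : F (x - y) = F x - F y.
Proof. by rewrite linear_funD -scaleN1r linear_funZ scaleN1r. Qed.

Lemma normL_le c x : (normL F <= c%:E)%E -> `|F x| <= c * `|x|.
Proof.
move=> Fc; have [->|x0] := eqVneq x 0; first by rewrite linear_fun0 !normr0 mulr0.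
have x_gt0 : 0 < `|x| by rewrite normr_gt0.
rewrite -ler_pdivrMr// mulrC -[_^-1]ger0_norm ?invr_ge0// -normrZ -linear_funZ.
rewrite -lee_fin; apply: le_trans Fc; apply: ereal_sup_ubound.
exists (`|x|^-1 *: x) => //=.
by rewrite normrZ ger0_norm ?invr_ge0// mulVf// gt_eqF.
Qed.

End Linear.

Lemma linear_sub (R : realType) (V W : normedModType R) (F G : V -> W) :
  linear F -> linear G -> linear (fun x => F x - G x).
Proof.
by move=> lF lG a x y /=; rewrite lF lG scalerBr opprD addrACA.
Qed.

Lemma lip_continuous (R : realType) (V W : normedModType R) (F : V -> W) (c : R) :
  (forall x y, `|F x - F y| <= c * `|x - y|) -> continuous F.
Proof.
move=> Fc x; apply/cvgrPdist_lt => e e0.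
(* [c] may vanish or be negative, while a positive constant is needed to divide by. *)
have c1 : 0 < `|c| + 1 by rewrite ltr_wpDl.
near=> y; apply: le_lt_trans (Fc _ _) _.
apply: (@le_lt_trans _ _ ((`|c| + 1) * `|x - y|)).
  by rewrite ler_wpM2r// (le_trans (ler_norm _))// lerDl.
rewrite mulrC -ltr_pdivlMr//; near: y.
by apply: (@cvgr_dist_lt _ _ _ (nbhs x) _ id); rewrite ?divr_gt0//; exact: cvg_id.
Unshelve. all: by end_near. Qed.

Section L2Lin.
Context (R : realType) (d : measure_display) (Omega : measurableType d).
Context (P : probability Omega R) (X : hilbertType R) (X_sep : separable X).

Local Notation N := (nrm P setT).
Local Notation L := (L2 P setT).
Let mT : measurable [set: Omega] := measurableT.

Lemma L2_lin (F : X -> X) (c : R) (V : Omega -> X) : 0 <= c -> linear F ->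
  (forall x, `|F x| <= c * `|x|) -> L V ->
  L (fun w => F (V w)) /\ N (fun w => F (V w)) <= c * N V.
Proof.
move=> c0 lF Fc VL; apply: L2_dom => //; have [mV _] := VL.
apply: (borel_comp mT _ mV); apply: (@lip_continuous _ _ _ _ c) => x y.
by rewrite -linear_funB.
Qed.

End L2Lin.

Section Inverse.
Context (R : realType) (X : normedModType R) (A : operator X).
Hypotheses (A_lin : op_linear A) (A_bij : set_bij (dom A) setT A).

Lemma op_inv_dom y : dom A (op_inv A y).
Proof. by have [H _ _] := bijpinv_bij (fun=> point) A_bij; exact: H. Qed.

Lemma op_invK x : dom A x -> op_inv A (A x) = x.
Proof. by move=> Ax; apply: pinvKV; [case: A_bij|rewrite inE]. Qed.

Lemma op_invVK y : A (op_inv A y) = y.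
Proof.
have [_ _ sA] := A_bij; rewrite /op_inv.
by apply: (surjpK (fun=> point) sA); rewrite inE.
Qed.

Lemma op_inv_lin : linear (op_inv A).
Proof.
move=> a x y; have [_ AD] := A_lin.
have [D E] := AD a _ _ (op_inv_dom x) (op_inv_dom y).
by rewrite -[RHS](op_invK D) E !op_invVK.
Qed.

Lemma op_linB x y : dom A x -> dom A y -> dom A (x - y) /\ A (x - y) = A x - A y.
Proof.
move=> Ax Ay; have [_ AD] := A_lin.
by have := AD (-1) y x Ay Ax; rewrite !scaleN1r !(addrC (- _)).
Qed.

Lemma op_inv_sub_le c x y : (normL (op_inv A) <= c%:E)%E ->
  dom A x -> dom A y -> `|x - y| <= c * `|A x - A y|.
Proof.
move=> Ac Ax Ay; have [Axy <-] := op_linB Ax Ay.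
rewrite -{1}(op_invK Axy); exact: (normL_le op_inv_lin).
Qed.

End Inverse.

Lemma cvg0_le (R : realType) (I : Type) (F : set_system I) {FF : Filter F}
    (u r : I -> R) : (\forall i \near F, 0 <= u i <= r i) ->
  r i @[i --> F] --> (0 : R) -> u i @[i --> F] --> (0 : R).
Proof.
move=> ur r0; apply: (squeeze_cvgr _ (cvg_cst 0) r0); exact: ur.
Qed.

Section Evolution.
Context (R : realType) (d : measure_display) (Omega : measurableType d).
Context (P : probability Omega R) (X : hilbertType R) (X_sep : separable X).
Context (T M : R) (A : R -> operator X) (U : R -> R -> X -> X).
Hypotheses (U_gen : generates T A U) (M_ge0 : 0 <= M).
Hypothesis U_M : forall t s : R, 0 <= s -> s <= t -> t <= T ->
  (normL (U t s) <= M%:E)%E.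

Local Notation N := (nrm P setT).
Local Notation L := (L2 P setT).
Let mT : measurable [set: Omega] := measurableT.

Lemma U_lin (t s : R) : 0 <= s -> s <= t -> t <= T -> linear (U t s).
Proof. by move=> s0 st tT; have [[H _ _ _] _] := U_gen; have [] := H t s s0 st tT. Qed.

Lemma U_le (t s : R) x : 0 <= s -> s <= t -> t <= T -> `|U t s x| <= M * `|x|.
Proof. by move=> s0 st tT; apply: normL_le; [exact: U_lin|exact: U_M]. Qed.

Lemma U_comp (t s r : R) x : 0 <= r -> r <= s -> s <= t -> t <= T ->
  U t s (U s r x) = U t r x.
Proof. by have [[_ H _ _] _] := U_gen => *; apply: H. Qed.

Lemma U_id (s : R) x : 0 <= s <= T -> U s s x = x.
Proof. by have [[_ _ H _] _] := U_gen => *; apply: H. Qed.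

Lemma U_L2 (t s : R) (V : Omega -> X) : 0 <= s -> s <= t -> t <= T -> L V ->
  L (fun w => U t s (V w)) /\ N (fun w => U t s (V w)) <= M * N V.
Proof.
move=> s0 st tT VL; apply: L2_lin => // [|x]; [exact: U_lin|exact: U_le].
Qed.

(** Operator-norm continuity off the diagonal as an inequality for every vector, a form that can be
    used under the L^2 norm of a random argument. *)
Lemma U_norm_cvg (t s e : R) : 0 <= s < t -> t <= T -> 0 < e ->
  exists2 dl : R, 0 < dl & forall t' s' : R, 0 <= s' < t' -> t' <= T ->
    `|t - t'| < dl -> `|s - s'| < dl ->
    forall x, `|U t' s' x - U t s x| <= e * `|x|.
Proof.
move=> st tT e0; have [_ [/(_ (t, s)) H _ _ _ _]] := U_gen.
have /fine_cvgP[Hfin /cvgrPdist_le/(_ _ e0) He] := H (conj st tT).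
have : \forall p \near within [set p : R * R | 0 <= p.2 < p.1 /\ p.1 <= T]
    (nbhs (t, s)), (normL (fun x => U p.1 p.2 x - U t s x)%R <= e%:E)%E.
  apply: filterS2 Hfin He => p pfin; rewrite sub0r normrN => pe.
  by rewrite -(fineK pfin) lee_fin; apply: le_trans pe; rewrite ler_norm.
rewrite near_withinE => /nbhs_ballP[dl /= dl0 Hdl]; exists dl => // t' s' st' tT' tt' ss' x.
apply: (normL_le (F := fun x => U t' s' x - U t s x)).
  apply: linear_sub; apply: U_lin => //.
  - by case/andP: st'.
  - by apply: ltW; case/andP: st'.
  - by case/andP: st.
  - by apply: ltW; case/andP: st.
by apply: (Hdl (t', s')) => //; split.
Qed.

(** [gam] is the identity for [U t s] itself and [s + h] for the shifted operator of a difference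
    quotient. Inserting [U t (gam s') (G s)] separates the variation of the argument, controlled by
    [M], from that of the operator, small in norm. *)
Lemma U_cont2 (t : R) (G : R -> Omega -> X) (gam : R -> R) (D : set R) (s : R) :
  t <= T -> D s -> (forall s', D s' -> 0 <= gam s' < t) ->
  gam s' @[s' --> within D (nbhs s)] --> gam s ->
  (forall s', D s' -> L (G s')) ->
  N (fun w => G s' w - G s w) @[s' --> within D (nbhs s)] --> (0 : R) ->
  N (fun w => U t (gam s') (G s' w) - U t (gam s) (G s w))
    @[s' --> within D (nbhs s)] --> (0 : R).
Proof.
move=> tT Ds gamD cgam GL cG.
have [gs0 gst] := andP (gamD _ Ds).
apply/cvgrPdist_le => e e0.
have N1 : 0 < N (G s) + 1 by rewrite ltr_wpDl ?nrm_ge0.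
have M1 : 0 < M + 1 by rewrite ltr_wpDl.
have e1 : 0 < e / 2 / (N (G s) + 1) by rewrite !divr_gt0.
have e2 : 0 < e / 2 / (M + 1) by rewrite !divr_gt0.
have [dl dl0 Hdl] := U_norm_cvg (gamD _ Ds) tT e1.
have /cvgrPdist_lt/(_ _ dl0) := cgam; have /cvgrPdist_le/(_ _ e2) := cG.
rewrite !near_withinE; apply: filterS2 => s' + + Ds' => /(_ Ds') + /(_ Ds').
rewrite !sub0r !normrN !(ger0_norm (nrm_ge0 _ _ _)) => HG Hg.
have [gs'0 gst'] := andP (gamD _ Ds').
have GsL := GL _ Ds; have GsL' := GL _ Ds'.
have [UGs _] := U_L2 gs0 (ltW gst) tT GsL.
have [UGs' _] := U_L2 gs'0 (ltW gst') tT GsL'.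
have [UGss' _] := U_L2 gs'0 (ltW gst') tT GsL.
apply: le_trans (nrm_dist mT X_sep UGs' UGss' UGs) _.
rewrite (splitr e); apply: lerD.
  have [_] := U_L2 gs'0 (ltW gst') tT (L2B mT X_sep GsL' GsL).
  under [X in N X <= _]eq_fun do rewrite (linear_funB (U_lin gs'0 (ltW gst') tT)).
  move=> /le_trans; apply.
  apply: (@le_trans _ _ ((M + 1) * (e / 2 / (M + 1)))); last by rewrite mulrC divfK// gt_eqF.
  by rewrite ler_pM ?nrm_ge0// lerDl.
have lin2 : linear (fun x => U t (gam s') x - U t (gam s) x).
  by apply: linear_sub; apply: U_lin => //; exact: ltW.
have [|_] := L2_lin (ltW e1) lin2 _ GsL.
  by move=> x; apply: Hdl => //; rewrite ?subrr ?normr0//; exact: gamD.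
move=> /le_trans; apply.
apply: (@le_trans _ _ (e / 2 / (N (G s) + 1) * (N (G s) + 1))); last by rewrite divfK// gt_eqF.
by rewrite ler_wpM2l ?lerDl// ltW.
Qed.

(** The integrand is already continuous on [[0, t[], so the approximating sequence of
    [bochner_exists_lim] is constant. *)
Lemma U_bochner (t C : R) (G : R -> Omega -> X) : 0 <= t <= T ->
  (forall s : R, 0 <= s <= t -> L (G s)) ->
  (forall s : R, 0 <= s <= t -> N (G s) <= C) ->
  (forall s : R, 0 <= s < t ->
    N (fun w => G s' w - G s w) @[s' --> within `[0, t[ (nbhs s)] --> (0 : R)) ->
  exists Z, is_bochner_integral P t (fun s w => U t s (G s w)) Z.
Proof.
move=> /andP[t0 tT] GL GC cG.
have UL (s : R) : 0 <= s <= t -> L (fun w => U t s (G s w)) /\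
    N (fun w => U t s (G s w)) <= M * C.
  move=> st; have [s0 st'] := andP st; have [UL UN] := U_L2 s0 st' tT (GL s st).
  by split => //; apply: le_trans UN _; rewrite ler_wpM2l// GC.
apply: (bochner_exists_lim X_sep (C := M * C) (F := fun _ s w => U t s (G s w))) => //.
- by move=> s st; have [] := UL s st.
- by move=> s st; have [] := UL s st.
- move=> _ s /andP[s0 st]; have [|] := UL s => //; by rewrite s0 ltW.
- move=> _ s st; apply: (@U_cont2 t G id `[0, t[%classic s) => //.
  + exact: cvg_within.
  + by move=> s'; rewrite /= in_itv /= => /andP[s0 st']; apply: GL; rewrite s0 ltW.
  + exact: cG.
- move=> s st; under eq_fun.
    move=> n; rewrite (_ : (fun w => _) = fun=> 0); last by apply/funext => w; rewrite subrr.
    rewrite nrm0.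
    over.
  exact: cvg_cst.
Qed.

End Evolution.

Section NrmCvg.
Context (R : realType) (d : measure_display) (Omega : measurableType d).
Context (P : probability Omega R) (X : hilbertType R) (X_sep : separable X).

Local Notation N := (nrm P setT).
Local Notation L := (L2 P setT).
Let mT : measurable [set: Omega] := measurableT.

Context (I : Type) (F : set_system I) (FF : Filter F).

Lemma nrm_scale_cvg (c : I -> R) (c0 : R) (K : I -> Omega -> X) (K0 : Omega -> X) :
  c i @[i --> F] --> c0 -> (\forall i \near F, L (K i)) -> L K0 ->
  N (fun w => K i w - K0 w) @[i --> F] --> (0 : R) ->
  N (fun w => c i *: K i w - c0 *: K0 w) @[i --> F] --> (0 : R).
Proof.
move=> cc KL K0L cK.
apply: (@cvg0_le _ _ _ _ _ (fun i => `|c i| * N (fun w => K i w - K0 w) +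
    `|c i - c0| * N K0)).
  apply: filterS KL => i KiL; rewrite nrm_ge0/=.
  have KK0 := L2B mT X_sep KiL K0L.
  rewrite -!(nrmZ mT X_sep)//.
  apply: le_trans (nrmD mT X_sep (L2Z mT X_sep (c i) KK0) (L2Z mT X_sep (c i - c0) K0L)).
  rewrite le_eqVlt; apply/orP; left; apply/eqP; congr nrm; apply/funext => w.
  by rewrite scalerBr scalerBl addrA subrK.
rewrite [X in _ --> X](_ : _ = `|c0| * 0 + `|c0 - c0| * N K0); last first.
  by rewrite subrr normr0 mulr0 mul0r addr0.
apply: cvgD; apply: cvgM => //; last exact: cvg_cst.
  exact: cvg_norm.
by apply: cvg_norm; apply: cvgB => //; exact: cvg_cst.
Qed.

Lemma nrm_sub_cvg (K K' : I -> Omega -> X) (K0 K0' : Omega -> X) :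
  (\forall i \near F, L (K i)) -> L K0 ->
  (\forall i \near F, L (K' i)) -> L K0' ->
  N (fun w => K i w - K0 w) @[i --> F] --> (0 : R) ->
  N (fun w => K' i w - K0' w) @[i --> F] --> (0 : R) ->
  N (fun w => (K i w - K' i w) - (K0 w - K0' w)) @[i --> F] --> (0 : R).
Proof.
move=> KL K0L KL' K0L' cK cK'.
apply: (@cvg0_le _ _ _ _ _ (fun i => N (fun w => K i w - K0 w) +
    N (fun w => K' i w - K0' w))).
  apply: filterS2 KL KL' => i KiL KiL'; rewrite nrm_ge0/= (nrmB _ _ (K' i)).
  apply: le_trans (nrmD mT X_sep (L2B mT X_sep KiL K0L) (L2B mT X_sep K0L' KiL')).
  rewrite le_eqVlt; apply/orP; left; apply/eqP; congr nrm; apply/funext => w.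
  by rewrite opprB addrACA [RHS]addrACA (addrC (- K' i w)).
by rewrite -[X in _ --> X](addr0 (0 : R)); exact: cvgD.
Qed.

End NrmCvg.

(** * Integrands containing the generator *)

Section EvolutionGenerator.
Context (R : realType) (d : measure_display) (Omega : measurableType d).
Context (P : probability Omega R) (X : hilbertType R) (X_sep : separable X).
Context (T M : R) (A : R -> operator X) (U : R -> R -> X -> X).
Hypotheses (U_gen : generates T A U) (M_ge0 : 0 <= M).
Hypothesis U_M : forall t s : R, 0 <= s -> s <= t -> t <= T ->
  (normL (U t s) <= M%:E)%E.

Local Notation N := (nrm P setT).
Local Notation L := (L2 P setT).
Let mT : measurable [set: Omega] := measurableT.

Hypothesis A_lin : forall t : R, 0 <= t <= T -> op_linear (A t).
Hypothesis A_dense : forall t : R, 0 <= t <= T -> closure (dom (A t)) = setT.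
Hypothesis A_inv : forall t : R, 0 <= t <= T ->
  exists c : R, (normL (op_inv (A t)) <= c%:E)%E.
Hypothesis A_bij : forall t : R, 0 <= t <= T -> set_bij (dom (A t)) setT (A t).

(* The difference quotients composed with [A(s)^-1] converge strongly, hence are
   uniformly bounded, which provides the domination. *)
Lemma U_quotient_cvg (t s : R) (h : nat -> R) (V : Omega -> X) :
  0 <= s < t -> t <= T -> (forall n, 0 < h n) -> (forall n, s + h n <= t) ->
  h n @[n --> \oo] --> (0 : R) ->
  (forall w, dom (A s) (V w)) -> L V -> L (fun w => A s (V w)) ->
  N (fun w => (h n)^-1 *: (U t s (V w) - U t (s + h n) (V w)) - U t s (A s (V w)))
    @[n --> \oo] --> (0 : R).
Proof.
move=> /[dup] st /andP[s0 s_lt_t] tT h0 ht hc VA VL AVL.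
have sT : 0 <= s <= T by rewrite s0 (le_trans (ltW s_lt_t)).
have sh0 n : 0 <= s + h n by rewrite addr_ge0// ltW.
have hV0 n : 0 <= (h n)^-1 by rewrite invr_ge0 ltW.
pose Q n x := (h n)^-1 *: (U t s x - U t (s + h n) x).
have Qlin n : linear (Q n).
  have ls := linear_sub (U_lin U_gen s0 (ltW s_lt_t) tT) (U_lin U_gen (sh0 n) (ht n) tT).
  move=> a x y; rewrite /Q (ls a x y) /= scalerDr; congr (_ + _).
  by rewrite !scalerA mulrC.
have Qcvg x : dom (A s) x -> Q n x @[n --> \oo] --> U t s (A s x).
  move=> Ax; have [_ [_ _ _ _ H]] := U_gen.
  (* As the domain is dense, the closure condition on [A s x] is automatic and the right derivative
     exists at every point of the domain. *)
  have {}H := H t s x st tT Ax (ltac:(by rewrite A_dense)).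
  rewrite -[U t s (A s x)]opprK.
  rewrite (_ : (fun n => Q n x) =
     (fun n => - ((h n)^-1 *: (U t (s + h n) x - U t s x)))); last first.
    by apply/funext => n; rewrite /Q -scalerN opprB.
  apply: cvgN; apply: (cvg_comp h _ _ H).
  move=> S HS; have HS' : \forall n \near \oo, 0 < h n -> S (h n).
    exact: (hc (fun y => 0 < y -> S y) HS).
  suff : \forall n \near \oo, S (h n) by [].
  by apply: filterS HS' => n; apply; exact: h0.
have [K K0 QK] : exists2 K : R, 0 <= K &
    forall n x, dom (A s) x -> `|Q n x| <= K * `|A s x|.
  pose B := range (fun n u => Q n (op_inv (A s) u)).
  have Alin := A_lin sT; have Abij := A_bij sT.
  have linB n : linear (fun u => Q n (op_inv (A s) u)).
    by move=> a x y /=; rewrite (op_inv_lin Alin Abij) Qlin.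
  have [|u|K HK] := @Banach_Steinhauss R X X B _ _ 1.
  - move=> _ [n _ <-]; split; last exact: linB.
    move=> r; have [c Hc] := A_inv sT.
    exists ((h n)^-1 * ((M + M) * (`|c| * r))) => x xr.
    rewrite /Q normrZ ger0_norm ?hV0// ler_wpM2l ?hV0//.
    apply: le_trans (ler_normB _ _) _; rewrite mulrDl.
    have ic : `|op_inv (A s) x| <= `|c| * r.
      apply: le_trans (normL_le (op_inv_lin Alin Abij) _ Hc) _.
      by apply: (@le_trans _ _ (`|c| * `|x|)); [rewrite ler_wpM2r// ler_norm|rewrite ler_wpM2l].
    by apply: lerD; apply: le_trans (U_le U_gen U_M _ _ _ _) _ => //;
      rewrite ?ler_wpM2l//; exact: ltW.
  - have := Qcvg _ (op_inv_dom Abij u) => /cvgP/cvg_seq_bounded [K [Kr HK]].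
    exists (K + 1) => _ [n _ <-].
    by apply: (HK (K + 1)); rewrite ?ltrDl.
  exists `|K| => // n x Ax.
  have Kb z : `|z| <= 1 -> `|Q n (op_inv (A s) z)| <= K.
    by apply: (HK (fun u => Q n (op_inv (A s) u))); exists n.
  rewrite -{1}(op_invK Abij Ax).
  apply: (normL_le (linB n)); apply: ub_ereal_sup => _ [z /= z1 <-].
  by rewrite lee_fin (le_trans (Kb _ z1))// ler_norm.
have mAV : borel_fun setT (fun w => A s (V w)) by have [] := AVL.
have mV : borel_fun setT V by have [] := VL.
have clin (F : X -> X) c : linear F -> (forall x, `|F x| <= c * `|x|) -> continuous F.
  by move=> lF Fc; apply: (@lip_continuous _ _ _ _ c) => x y; rewrite -linear_funB.
have Uc : continuous (U t s).
  apply: (clin _ M); first exact: (U_lin U_gen s0 (ltW s_lt_t) tT).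
  by move=> x; apply: (U_le U_gen U_M) => //; exact: ltW.
have Qc n : continuous (Q n).
  apply: (clin _ ((h n)^-1 * (M + M))) => // x.
  rewrite /Q normrZ ger0_norm ?hV0// -mulrA ler_wpM2l ?hV0//.
  apply: le_trans (ler_normB _ _) _; rewrite mulrDl.
  by apply: lerD; apply: (U_le U_gen U_M) => //; exact: ltW.
(* The quotient is at most [K] times, and its limit at most [M] times, the norm of [A s (V w)]. *)
have iW : P.-integrable setT (EFin \o (fun w => (K + M) ^+ 2 * `|A s (V w)| ^+ 2)).
  rewrite (_ : _ \o _ = (fun w => ((K + M) ^+ 2)%:E * (EFin \o (fun w => dot (A s (V w)) (A s (V w)))) w)%E).
    apply: integrableZl => //; exact: integrable_dot.
  by apply/funext => w /=; rewrite dotxx EFinM.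
have [] := L2_dct mT X_sep (hn := fun n w => Q n (V w))
  (h := fun w => U t s (A s (V w))) _ _ iW _ _ => //.
- by move=> n; exact: (borel_comp mT (Qc n) mV).
- exact: (borel_comp mT Uc mAV).
- move=> n w _; rewrite -exprMn ler_sqr ?nnegrE ?mulr_ge0 ?addr_ge0//.
  apply: le_trans (ler_normB _ _) _; rewrite mulrDl; apply: lerD; first exact: QK.
  by apply: (U_le U_gen U_M) => //; exact: ltW.
- by move=> w _; exact: Qcvg.
Qed.

(** [G] is continuous in time while [A s (G s _)] is only bounded. Continuity is therefore asked of
    the difference quotients, which involve [U] and [G] but not [A]. *)
Lemma UA_bochner (t C : R) (G : R -> Omega -> X) : 0 <= t <= T ->
  (forall s : R, 0 <= s <= t -> L (G s)) ->
  (forall s w, 0 <= s <= t -> dom (A s) (G s w)) ->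
  (forall s : R, 0 <= s <= t -> L (fun w => A s (G s w))) ->
  (forall s : R, 0 <= s <= t -> N (fun w => A s (G s w)) <= C) ->
  (forall s : R, 0 <= s < t ->
    N (fun w => G s' w - G s w) @[s' --> within `[0, t[ (nbhs s)] --> (0 : R)) ->
  exists Z, is_bochner_integral P t (fun s w => U t s (A s (G s w))) Z.
Proof.
move=> /andP[t0 tT] GL GA AGL AGC cG.
have ltt (s : R) : 0 <= s < t -> 0 <= s <= t by move=> /andP[-> /ltW].
have UL (s : R) : 0 <= s <= t -> L (fun w => U t s (A s (G s w))) /\
    N (fun w => U t s (A s (G s w))) <= M * C.
  move=> st; have [s0 st'] := andP st.
  have [UL UN] := U_L2 U_gen M_ge0 U_M s0 st' tT (AGL s st).
  by split => //; apply: le_trans UN _; rewrite ler_wpM2l// AGC.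
(* The divisor is at least 2, whence [s + h n s < t] and both operators of the quotient stay off the
   diagonal; the step varies continuously with [s]. *)
pose h n s := (t - s) / n.+2%:R : R.
have h0 n s : s < t -> 0 < h n s by move=> st; rewrite divr_gt0// subr_gt0.
have ht n s : s < t -> s + h n s < t.
  move=> st; rewrite -ltrBrDl /h ltr_pdivrMr// ltr_pMr ?subr_gt0//.
  by rewrite ltr1n.
have FL n (s : R) : 0 <= s < t -> L (fun w => U t s (G s w)) /\
    L (fun w => U t (s + h n s) (G s w)).
  move=> /[dup] st /andP[s0 st']; have GsL := GL s (ltt s st); split.
    by have [] := U_L2 U_gen M_ge0 U_M s0 (ltW st') tT GsL.
  have s'0 : 0 <= s + h n s by rewrite addr_ge0// ltW// h0.
  by have [] := U_L2 U_gen M_ge0 U_M s'0 (ltW (ht n s st')) tT GsL.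
apply: (bochner_exists_lim X_sep (C := M * C) (F := fun n s w =>
  (h n s)^-1 *: (U t s (G s w) - U t (s + h n s) (G s w)))) => //.
- by move=> s st; have [] := UL s st.
- by move=> s st; have [] := UL s st.
- by move=> n s st; have [Ls Ls'] := FL n s st; apply: L2Z => //; exact: L2B.
- move=> n s st; have [s0 s_lt_t] := andP st; have [Ls Ls'] := FL n s st.
  have hc : h n s' @[s' --> within `[0, t[ (nbhs s)] --> h n s.
    apply: cvgM; last exact: cvg_cst.
    by apply: cvgB; [exact: cvg_cst|exact: cvg_within].
  have near_in (Q : R -> Prop) : (forall s', 0 <= s' < t -> Q s') ->
      \forall s' \near within `[0, t[ (nbhs s), Q s'.
    move=> H; rewrite near_withinE; apply: nearW => s'; rewrite /= in_itv /=.
    exact: H.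
  apply: nrm_scale_cvg => //.
  + by apply: cvgV => //; rewrite gt_eqF// h0.
  + by apply: near_in => s' st'; have [] := FL n s' st'; exact: L2B.
  + exact: L2B.
  apply: nrm_sub_cvg => //.
  + by apply: near_in => s' st'; have [] := FL n s' st'.
  + by apply: near_in => s' st'; have [] := FL n s' st'.
  + apply: (@U_cont2 _ _ _ P X X_sep T M A U U_gen M_ge0 U_M t G id `[0, t[%classic s) => //.
    * exact: cvg_within.
    * by move=> s'; rewrite /= in_itv /= => st'; apply: GL; exact: ltt.
    * exact: cG.
  + apply: (@U_cont2 _ _ _ P X X_sep T M A U U_gen M_ge0 U_M t G (fun s => s + h n s) `[0, t[%classic s) => //.
    * move=> s'; rewrite /= in_itv /= => /andP[s'0 s't].
      by rewrite ht// addr_ge0// ltW// h0.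
    * by apply: cvgD => //; exact: cvg_within.
    * by move=> s'; rewrite /= in_itv /= => st'; apply: GL; exact: ltt.
    * exact: cG.
- move=> s st; have [s0 s_lt_t] := andP st.
  apply: (U_quotient_cvg (h := fun n => h n s)) => //.
  + by move=> n; exact: h0.
  + by move=> n; rewrite ltW// ht.
  + rewrite -(mulr0 (t - s)); apply: cvgM; first exact: cvg_cst.
    by have := @cvg_harmonic R; rewrite -(cvg_shiftS (@harmonic R)).
  + by move=> w; apply: GA; exact: ltt.
  + by apply: GL; exact: ltt.
  + by apply: AGL; exact: ltt.
Qed.

End EvolutionGenerator.

(** * Covariance of fractional Brownian motion *)

Section FbmKernel.
Context (R : realType).

Lemma powR_convex (p l x y : R) : 1 <= p -> 0 <= l <= 1 -> 0 <= x -> 0 <= y ->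
  (l * x + (1 - l) * y) `^ p <= l * x `^ p + (1 - l) * y `^ p.
Proof.
move=> p1 /andP[l0 l1] x0 y0.
have l0' : 0 <= 1 - l by rewrite subr_ge0.
have l1' : 1 - l <= 1 by rewrite gerBl.
have := @convex_powR R p p1 (Itv01 l0 l1) x y.
by rewrite !convRE /=; apply; rewrite ?inE /= ?in_itv /= ?x0 ?y0.
Qed.

Lemma norm_powR_convex (p l x y : R) : 1 <= p -> 0 <= l <= 1 ->
  `|l * x + (1 - l) * y| `^ p <= l * `|x| `^ p + (1 - l) * `|y| `^ p.
Proof.
move=> p1 /[dup] l01 /andP[l0 l1]; apply: le_trans (powR_convex p1 l01 _ _) => //.
have l0' : 0 <= 1 - l by rewrite subr_ge0.
apply: ge0_ler_powR; rewrite ?nnegrE ?(le_trans _ p1)// ?addr_ge0 ?mulr_ge0//.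
by apply: le_trans (ler_normD _ _) _; rewrite !normrM !(ger0_norm l0) !(ger0_norm l0').
Qed.

Definition fbm_cov (H a c : R) : R :=
  2^-1 * (a `^ (2 * H) + c `^ (2 * H) - `|a - c| `^ (2 * H)).

Context (H : R) (H_range : 2^-1 < H < 1).

Let p1 : 1 <= 2 * H. Proof. by case/andP: H_range => ? _; lra. Qed.

Lemma fbm_covC a c : fbm_cov H a c = fbm_cov H c a.
Proof. by rewrite /fbm_cov distrC (addrC (a `^ _)). Qed.

Lemma fbm_cov0 c : 0 <= c -> fbm_cov H 0 c = 0.
Proof.
move=> c0; rewrite /fbm_cov powR0; last by rewrite gt_eqF// (lt_le_trans _ p1).
by rewrite sub0r normrN ger0_norm// add0r subrr mulr0.
Qed.

(* Increments of a fractional Brownian motion with H > 1/2 are positively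
   correlated, by convexity of [|x| ^ (2 H)]. *)
Lemma fbm_incr_ge0 (a b c e : R) : a <= b -> c <= e ->
  0 <= fbm_cov H b e - fbm_cov H a e - fbm_cov H b c + fbm_cov H a c.
Proof.
move=> ab ce; set psi := fun x : R => `|x| `^ (2 * H).
suff : psi (b - e) + psi (a - c) <= psi (a - e) + psi (b - c).
  by rewrite /fbm_cov /psi; lra.
have [uw|uw] := eqVneq (a - e) (b - c).
  by have [-> ->] : b = a /\ e = c by split; lra.
have d0 : 0 < (b - c) - (a - e) by rewrite lt_neqAle eq_sym subr_eq0 eq_sym uw; lra.
(* The points [b - e] and [a - c] lie between [a - e] and [b - c] and have the same sum, so their
   weights are complementary and the two convexity inequalities add up to the claim. *)
pose l := (e - c) / ((b - c) - (a - e)).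
have l01 : 0 <= l <= 1.
  apply/andP; split; first by apply: divr_ge0; [lra|exact: ltW].
  by rewrite ler_pdivrMr// mul1r; lra.
have l01' : 0 <= 1 - l <= 1 by lra.
have e1 : b - e = l * (a - e) + (1 - l) * (b - c).
  by rewrite /l; field; rewrite gt_eqF.
have e2 : a - c = (1 - l) * (a - e) + (1 - (1 - l)) * (b - c).
  by rewrite /l; field; rewrite gt_eqF.
rewrite /psi e1 e2.
have := norm_powR_convex (a - e) (b - c) p1 l01.
have := norm_powR_convex (a - e) (b - c) p1 l01'.
lra.
Qed.

(** By convexity the power lies below its chord from [a] to [T + 1]. The endpoint [T + 1] instead of
    [T] keeps the denominator of the slope at least 1, so the value there bounds the slope. *)
Lemma powR_incr_le (a b T : R) : 0 <= a -> a <= b -> b <= T ->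
  b `^ (2 * H) - a `^ (2 * H) <= (T + 1) `^ (2 * H) * (b - a).
Proof.
move=> a0 ab bT.
have d0 : 0 < T + 1 - a by lra.
pose l := (b - a) / (T + 1 - a).
have l01 : 0 <= l <= 1.
  apply/andP; split; first by apply: divr_ge0; [lra|exact: ltW].
  by rewrite ler_pdivrMr// mul1r; lra.
have e1 : b = l * (T + 1) + (1 - l) * a.
  by rewrite /l; field; rewrite gt_eqF.
have T1 : 0 <= T + 1 by lra.
have := powR_convex p1 l01 T1 a0; rewrite -e1 => Hb.
have ap := powR_ge0 a (2 * H); have Tp := powR_ge0 (T + 1) (2 * H).
have lb : l <= b - a.
  rewrite /l ler_pdivrMr//; have : 0 <= (b - a) * (T - a) by apply: mulr_ge0; lra.
  lra.
have [l0 l1] := andP l01.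
have : 0 <= l * a `^ (2 * H) by rewrite mulr_ge0.
have : l * (T + 1) `^ (2 * H) <= (b - a) * (T + 1) `^ (2 * H) by rewrite ler_wpM2r.
lra.
Qed.

(** The increment is half the sum of two increments of the power function, over [[a, b]] and over
    [[e - b, e - a]], both of length [b - a]. *)
Lemma fbm_cov_incr_le (a b e T : R) : 0 <= a -> a <= b -> b <= e -> e <= T ->
  fbm_cov H b e - fbm_cov H a e <= (T + 1) `^ (2 * H) * (b - a).
Proof.
move=> a0 ab be eT.
have := powR_incr_le a0 ab (le_trans be eT).
have h1 : 0 <= e - b by lra.
have h2 : e - b <= e - a by lra.
have h3 : e - a <= T by lra.
have := powR_incr_le h1 h2 h3.
rewrite /fbm_cov (ler0_norm (_ : b - e <= 0)); last lra.
rewrite (ler0_norm (_ : a - e <= 0)); last lra.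
rewrite !opprB; lra.
Qed.

(** Summation by parts; [f 0 = 0] removes the boundary term. *)
Lemma abel_sum (f u : nat -> R) n : f 0%N = 0 ->
  \sum_(0 <= i < n) f i.+1 * u i =
  \sum_(0 <= k < n) (f k.+1 - f k) * \sum_(k <= i < n) u i.
Proof.
move=> f0; elim: n => [|n IH]; first by rewrite !big_geq.
rewrite big_nat_recr//= [in RHS]big_nat_recr//= big_nat1.
under [in RHS]eq_big_nat => k /andP[_ kn] do rewrite big_nat_recr 1?ltnW//= mulrDr.
rewrite big_split /= -IH -addrA; congr (_ + _).
by rewrite -mulr_suml -mulrDl telescope_sumr// f0 subr0 subrKC.
Qed.

End FbmKernel.

(** * Quadratic forms of step functions *)

Section KernelForm.
Context (R : realType) (X : hilbertType R).

(** With the fractional covariance as [kap] this is the squared norm of a step integral, with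
    [Num.min] that of the step function in L^2; comparing the two forms gives continuity of the
    Wiener integral. *)
Definition kform (kap : R -> R -> R) (l : seq (R * X)) : R :=
  \sum_(p <- l) \sum_(q <- l) kap p.1 q.1 * dot p.2 q.2.

Let incr2 (kap : R -> R -> R) (a : nat -> R) k j : R :=
  kap (a k.+1) (a j.+1) - kap (a k) (a j.+1) - kap (a k.+1) (a j) + kap (a k) (a j).

(** Summation by parts in both variables. The tail sum from [k] is the value of the step function
    between the times [a k] and [a k.+1], so that overlapping intervals starting at 0 are replaced
    by disjoint ones. *)
Lemma kform_abel (kap : R -> R -> R) (a : nat -> R) (v : nat -> X) n :
  (forall i, kap (a i) (a 0%N) = 0) -> (forall i, kap (a 0%N) (a i) = 0) ->
  \sum_(0 <= i < n) \sum_(0 <= j < n) kap (a i.+1) (a j.+1) * dot (v i) (v j) =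
  \sum_(0 <= k < n) \sum_(0 <= j < n)
    incr2 kap a k j * dot (\sum_(k <= i < n) v i) (\sum_(j <= i < n) v i).
Proof.
move=> k0 k0'.
under eq_bigr => i _.
  rewrite (@abel_sum _ (fun j => kap (a i.+1) (a j)) (fun j => dot (v i) (v j)))//.
  over.
rewrite exchange_big /= [RHS]exchange_big /=; apply: eq_bigr => j _.
under eq_bigr => i _ do rewrite -dot_sumr.
rewrite (@abel_sum _ (fun i => kap (a i) (a j.+1) - kap (a i) (a j))
  (fun i => dot (v i) (\sum_(j <= l < n) v l)) n); last by rewrite !k0' subrr.
apply: eq_bigr => k _; rewrite -dot_suml /incr2; congr (_ * _); lra.
Qed.

Lemma kform_nth (kap : R -> R -> R) (l : seq (R * X)) :
  kform kap l = \sum_(0 <= i < size l) \sum_(0 <= j < size l)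
    kap (nth (0, 0) l i).1 (nth (0, 0) l j).1 *
    dot (nth (0, 0) l i).2 (nth (0, 0) l j).2.
Proof.
rewrite /kform (big_nth (0, 0)); apply: eq_bigr => i _.
by rewrite (big_nth (0, 0)).
Qed.

Lemma kform_perm (kap : R -> R -> R) (l l' : seq (R * X)) : perm_eq l l' ->
  kform kap l = kform kap l'.
Proof.
move=> ll'; rewrite /kform (perm_big _ ll') /=; apply: eq_bigr => p _.
by rewrite (perm_big _ ll').
Qed.

(* In the kernel of an increasing sequence of times, the double increments of
   [min] form a diagonal matrix, and those of the covariance are nonnegative with
   row sums bounded by [K] times the diagonal: Schur's test. *)
Lemma fbm_form_le (H T : R) (l : seq (R * X)) : 2^-1 < H < 1 ->
  (forall p, p \in l -> 0 <= p.1 <= T) ->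
  kform (fbm_cov H) l <= (T + 1) `^ (2 * H) * kform Num.min l.
Proof.
move=> H_range.
pose le1 (p q : R * X) := p.1 <= q.1.
(* The forms do not depend on the order of the list, while the double increments have a sign only
   along increasing times. *)
move=> lT; pose s := sort le1 l.
have ps : perm_eq s l by rewrite /s perm_sort.
rewrite -!(kform_perm _ ps).
have {}sT p : p \in s -> 0 <= p.1 <= T by rewrite (perm_mem ps); apply: lT.
have ss : sorted le1 s by apply: sort_sorted => p q; exact: le_total.
have le1_tr : transitive le1 by move=> p q r; exact: le_trans.
pose n := size s.
(* Shifted by one: [a 0 = 0] is the common left endpoint, where both kernels vanish, and [a i.+1] is
   the [i]-th time. The value [T] past the end keeps [a] monotone on all of [nat]. *)
pose a i := if i is j.+1 then if (j < n)%N then (nth (0, 0) s j).1 else T else 0 : R.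
pose v i := (nth (0, 0) s i).2.
(* The sign of [T] is known only through an element of the list. *)
have [n0|n0] := eqVneq n 0%N.
  by rewrite /kform (size0nil n0) !big_nil mulr0.
have T0 : 0 <= T.
  have : nth (0, 0) s 0 \in s by apply: mem_nth; rewrite lt0n.
  by move=> /sT /andP[]; exact: le_trans.
have aT i : 0 <= a i <= T.
  case: i => [|i] /=; first by rewrite lexx.
  by case: ifPn => [ni|_]; [apply: sT; exact: mem_nth|rewrite T0 lexx].
have a_mono i j : (i <= j)%N -> a i <= a j.
  case: i j => [|i] [|j] //=; first by have := aT j.+1 => /andP[].
  rewrite ltnS => ij; case: ifPn => [ni|]; case: ifPn => // nj.
  - by apply: (sorted_leq_nth le1_tr _ (0, 0) ss) => //; move=> p; exact: lexx.
  - by have /andP[] := sT _ (mem_nth (0, 0) ni).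
  - by rewrite -leqNgt => /leq_trans/(_ ij); rewrite leqNgt nj.
have E kap : (forall i, kap (a i) (a 0%N) = 0) -> (forall i, kap (a 0%N) (a i) = 0) ->
    kform kap s = \sum_(0 <= k < n) \sum_(0 <= j < n)
    incr2 kap a k j * dot (\sum_(k <= i < n) v i) (\sum_(j <= i < n) v i).
  move=> k0 k0'; rewrite -kform_abel// kform_nth.
  apply: eq_big_nat => i /andP[_ ni]; apply: eq_big_nat => j /andP[_ nj].
  by rewrite /= ni nj.
have a0 i : 0 <= a i by have /andP[] := aT i.
rewrite !E; try by move=> i; rewrite ?fbm_cov0// fbm_covC fbm_cov0.
all: try by move=> i; first [by rewrite min_r ?a_mono|by rewrite min_l ?a_mono].
set h := fun k => \sum_(k <= i < n) v i.
rewrite -/(h _).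
have minE k j : incr2 Num.min a k j = if k == j then a k.+1 - a k else 0.
  rewrite /incr2; case: ltngtP => [kj|jk|->].
  - by rewrite !min_l ?a_mono ?ltnS ?(leqW (ltnW kj)) ?(ltnW kj)//; lra.
  - by rewrite !min_r ?a_mono ?ltnS ?(leqW (ltnW jk)) ?(ltnW jk)//; lra.
  - rewrite !minxx min_l ?a_mono// min_r ?a_mono//; lra.
set K := _ `^ _.
have -> : \sum_(0 <= k < n) \sum_(0 <= j < n) incr2 Num.min a k j * dot (h k) (h j) =
    \sum_(0 <= k < n) (a k.+1 - a k) * `|h k| ^+ 2.
  apply: eq_big_nat => k /andP[_ kn].
  rewrite (bigD1_seq k) ?iota_uniq ?mem_index_iota//= minE eqxx dotxx.
  by rewrite big1 ?addr0// => j /negbTE jk; rewrite minE eq_sym jk mul0r.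
pose q k j := incr2 (fbm_cov H) a k j.
have q0 k j : 0 <= q k j by apply: fbm_incr_ge0 => //; exact: a_mono.
have qC k j : q k j = q j k.
  by rewrite /q /incr2 ![fbm_cov H (a k.+1) _]fbm_covC ![fbm_cov H (a k) _]fbm_covC; lra.
(* The weights [q] are nonnegative, so each inner product may be replaced by half a sum of squares;
   symmetry of [q] then leaves only row sums. *)
apply: (@le_trans _ _ (\sum_(0 <= k < n) \sum_(0 <= j < n)
    q k j * (2^-1 * (`|h k| ^+ 2 + `|h j| ^+ 2)))).
  apply: ler_sum => k _; apply: ler_sum => j _; rewrite ler_wpM2l//.
  by apply: le_trans (dot_le_half _ _); exact: ler_norm.
have -> : \sum_(0 <= k < n) \sum_(0 <= j < n) q k j * (2^-1 * (`|h k| ^+ 2 + `|h j| ^+ 2))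
    = \sum_(0 <= k < n) `|h k| ^+ 2 * \sum_(0 <= j < n) q k j.
  under eq_bigr => k _.
    under eq_bigr => j _ do rewrite mulrA mulrDr.
    rewrite big_split /=.
    over.
  rewrite big_split /= [X in _ + X]exchange_big /= -big_split /=.
  apply: eq_bigr => k _; rewrite -!mulr_suml.
  by rewrite (eq_bigr (q k) (fun i _ => qC i k)); lra.
rewrite mulr_sumr; apply: ler_sum_nat => k /andP[_ kn].
rewrite [leLHS]mulrC mulrA ler_wpM2r ?sqr_ge0//.
(* The row sum telescopes to one increment of the covariance against the last time [a n]. *)
have -> : \sum_(0 <= j < n) q k j = fbm_cov H (a k.+1) (a n) - fbm_cov H (a k) (a n).
  rewrite (@telescope_sumr_eq _ 0 n (fun j => fbm_cov H (a k.+1) (a j) - fbm_cov H (a k) (a j)))//.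
    by rewrite ![fbm_cov H _ (a 0%N)]fbm_covC !fbm_cov0// subrr subr0.
  by move=> j _; rewrite /q /incr2; lra.
apply: fbm_cov_incr_le => //; try exact: a_mono.
by have /andP[] := aT n.
Qed.

End KernelForm.

(** * Independence and second moments of the coordinate processes *)

Section Independent.
Context (R : realType) (d : measure_display) (Omega : measurableType d).
Context (P : probability Omega R).

(** Independence on rectangles identifies the joint law with the product of the laws; Fubini's
    theorem then integrates first in the centred variable. *)
Lemma indep_mul0 (Y Z : Omega -> R) :
  measurable_fun setT Y -> measurable_fun setT Z ->
  (forall A B : set R, measurable A -> measurable B ->
    P (Y @^-1` A `&` Z @^-1` B) = (P (Y @^-1` A) * P (Z @^-1` B))%E) ->
  P.-integrable setT (EFin \o (fun w => Y w * Z w)) ->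
  P.-integrable setT (EFin \o Z) -> (\int[P]_w (Z w)%:E)%E = 0%E ->
  (\int[P]_w (Y w * Z w)%:E)%E = 0%E.
Proof.
move=> mY mZ YZ iYZ iZ EZ0.
pose Y' : {mfun Omega >-> R} := HB.pack Y (isMeasurableFun.Build _ _ _ _ Y mY).
pose Z' : {mfun Omega >-> R} := HB.pack Z (isMeasurableFun.Build _ _ _ _ Z mZ).
pose YZ0 w := (Y w, Z w).
have mYZ : measurable_fun setT YZ0 by exact: measurable_fun_pair.
pose YZ' : {mfun Omega >-> (R * R)%type} :=
  HB.pack YZ0 (isMeasurableFun.Build _ _ _ _ YZ0 mYZ).
pose m1 := distribution P Y'; pose m2 := distribution P Z'.
pose m := distribution P YZ'.
pose f (z : R * R) := (z.1 * z.2)%:E.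
have mf : measurable_fun setT f.
  by apply/measurable_EFinP; apply: measurable_funM; [exact: measurable_fst|exact: measurable_snd].
have mE (C : set (R * R)) : measurable C -> (m1 \x m2)%E C = m C.
  apply: product_measure_unique => A B mA mB.
  exact: YZ.
have iEf : (\int[m1 \x m2]_z f z = \int[P]_w (Y w * Z w)%:E)%E.
  rewrite (eq_measure_integral m); last by move=> C mC _; exact: mE.
  by rewrite integral_distribution.
have if_ : (m1 \x m2)%E.-integrable setT f.
  apply/integrableP; split => //.
  rewrite (eq_measure_integral m); last by move=> C mC _; exact: mE.
  rewrite ge0_integral_distribution//; last exact: measurableT_comp.
  by have /integrableP[] := iYZ.
rewrite -iEf -integral12_prod_meas1// /fubini_F.
have EZ x : (\int[m2]_y f (x, y) = 0)%E.
  rewrite /f /=; under eq_integral do rewrite EFinM.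
  rewrite integralZl//; last first.
    apply/integrableP; split; first exact/measurable_EFinP.
    rewrite ge0_integral_distribution//; last exact: measurableT_comp.
    by have /integrableP[] := iZ.
  rewrite /m2. rewrite integral_distribution//=.
  by rewrite (_ : (\int[P]_x _)%E = 0%E) ?mule0.
by under eq_integral do rewrite EZ; rewrite integral0.
Qed.

End Independent.

Section Fbm.
Context (R : realType) (d : measure_display) (Omega : measurableType d).
Context (P : probability Omega R).

Lemma integrable_mul (Y Z : Omega -> R) :
  measurable_fun setT Y -> measurable_fun setT Z ->
  P.-integrable setT (EFin \o (fun w => Y w * Y w)) ->
  P.-integrable setT (EFin \o (fun w => Z w * Z w)) ->
  P.-integrable setT (EFin \o (fun w => Y w * Z w)).
Proof.
move=> mY mZ iY iZ.
apply: (le_integrable measurableT _ _ (integrableD measurableT iY iZ)).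
  by apply/measurable_EFinP; exact: measurable_funM.
move=> w _ /=; rewrite lee_fin [leRHS]ger0_norm.
  by rewrite normrM; have := sqr_ge0 (`|Y w| - `|Z w|); rewrite sqrrB !real_normK ?num_real//;
    have := sqr_ge0 (Y w); have := sqr_ge0 (Z w); lra.
by rewrite addr_ge0// -expr2 sqr_ge0.
Qed.

(** Measurability comes from linear combinations with a single term, square integrability from the
    covariance on the diagonal, and integrability from the product with the constant 1. *)
Lemma fbm_props (H T : R) (b : R -> Omega -> R) : is_fBm P H T b ->
  (forall a : R, 0 <= a <= T -> measurable_fun setT (b a)) /\
  (forall a : R, 0 <= a <= T -> P.-integrable setT (EFin \o b a) /\
      (\int[P]_w (b a w)%:E = 0)%E) /\
  (forall a c : R, 0 <= a <= T -> 0 <= c <= T ->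
      P.-integrable setT (EFin \o (fun w => b a w * b c w)) /\
      \int[P]_w (b a w * b c w) = fbm_cov H a c).
Proof.
move=> [gp E0 _ Ec].
have mb a : 0 <= a <= T -> measurable_fun setT (b a).
  move=> aT; have [|] := gp [:: (1, a)].
    by move=> p; rewrite inE => /eqP ->.
  by under eq_fun do rewrite big_seq1 mul1r.
have E a c : 0 <= a <= T -> 0 <= c <= T ->
    (\int[P]_w (b a w * b c w)%:E = (fbm_cov H a c)%:E)%E.
  by move=> aT cT; have := Ec a c aT cT; rewrite unlock.
have isq a : 0 <= a <= T -> P.-integrable setT (EFin \o (fun w => b a w * b a w)).
  move=> aT; apply/integrableP; split.
    by apply/measurable_EFinP; apply: measurable_funM; exact: mb.
  under eq_integral => w _.
    rewrite /= ger0_norm; last by rewrite -expr2 sqr_ge0.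
    over.
  by rewrite E// ltry.
split => //; split => [a aT|a c aT cT].
  split; last by have := E0 a aT; rewrite unlock.
  have i1 : P.-integrable setT (EFin \o (fun _ : Omega => (1 : R) * 1)).
    by rewrite mulr1; exact: finite_measure_integrable_cst.
  have m1 : measurable_fun setT (fun _ : Omega => (1 : R)) by exact: measurable_cst.
  have := integrable_mul (mb a aT) m1 (isq a aT) i1.
  by rewrite (_ : (fun w => b a w * 1) = b a)//; apply/funext => w; rewrite mulr1.
have iac : P.-integrable setT (EFin \o (fun w => b a w * b c w)).
  by apply: integrable_mul; [exact: mb|exact: mb|exact: isq|exact: isq].
by split => //; rewrite /Rintegral E.
Qed.

Lemma fbm_uncorrelated (H T : R) (J : set nat) (b : nat -> R -> Omega -> R) :
  (forall n, J n -> is_fBm P H T (b n)) -> independent_processes P T J b ->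
  forall n m (a c : R), J n -> J m -> n <> m -> 0 <= a <= T -> 0 <= c <= T ->
    P.-integrable setT (EFin \o (fun w => b n a w * b m c w)) /\
    \int[P]_w (b n a w * b m c w) = 0.
Proof.
move=> bfbm bind n m a c Jn Jm nm aT cT.
have [mn [_ in2]] := fbm_props (bfbm n Jn).
have [mm [im im2]] := fbm_props (bfbm m Jm).
have inm : P.-integrable setT (EFin \o (fun w => b n a w * b m c w)).
  apply: integrable_mul; [exact: mn|exact: mm| |].
    by have [] := in2 a a aT aT.
  by have [] := im2 c c cT cT.
split => //; rewrite /Rintegral.
have [imc Emc] := im c cT.
rewrite (@indep_mul0 _ _ _ P (b n a) (b m c))//; [exact: mn|exact: mm|].
move=> A B mA mB.
(* Independence of the processes is used for two of them, with events that depend on one time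
   each. *)
have := bind [:: n; m] (fun k => if k == n then b n a @^-1` A else b m c @^-1` B).
rewrite !big_cons !big_nil eqxx setIT mule1.
have -> : (m == n) = false by apply/negbTE/eqP => mn'; exact: nm.
apply.
  by rewrite /= inE andbT; apply/eqP.
move=> k; rewrite !inE => /orP[]/eqP ->.
  rewrite eqxx; split => //; apply: sub_sigma_algebra.
  by exists a; split => //; exists A.
have -> : (m == n) = false by apply/negbTE/eqP => mn'; exact: nm.
split => //; apply: sub_sigma_algebra.
by exists c; split => //; exists B.
Qed.

Context (X : hilbertType R) (X_sep : separable X).
Local Notation N := (nrm P setT).
Local Notation L := (L2 P setT).
Let mT : measurable [set: Omega] := measurableT.

Lemma L2_rv (Y : Omega -> R) (v : X) : measurable_fun setT Y ->
  P.-integrable setT (EFin \o (fun w => Y w * Y w)) ->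
  L (fun w => Y w *: v).
Proof.
move=> mY iY; apply/L2P; split.
  by apply: borelZ => //; exact: borel_cst.
under eq_integral => w _.
  rewrite normrZ exprMn real_normK ?num_real// mulrC expr2 EFinM.
  over.
rewrite ge0_integralZl_EFin ?sqr_ge0//.
- by apply: lte_mul_pinfty => //; exact: integrable_lty.
- by move=> w _; rewrite lee_fin sqr_ge0.
- by apply/measurable_EFinP; exact: measurable_funX.
Qed.

Lemma ip_rv (Y Z : Omega -> R) (v z : X) :
  P.-integrable setT (EFin \o (fun w => Y w * Z w)) ->
  ip P setT (fun w => Y w *: v) (fun w => Z w *: z) =
  (\int[P]_w (Y w * Z w)) * dot v z.
Proof.
move=> iYZ; rewrite /ip -RintegralZr//; apply: eq_Rintegral => w _.
by rewrite dotZl dotZr; lra.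
Qed.

Section StepIntegral.
Context (H T : R) (b : R -> Omega -> R) (b_fbm : is_fBm P H T b).

Lemma L2_step_integral (l : seq (R * X)) :
  (forall p, p \in l -> 0 <= p.1 <= T) -> L (step_integral b l).
Proof.
move=> lT; have [mb [_ ib]] := fbm_props b_fbm.
rewrite /step_integral; under eq_fun do rewrite big_seq.
apply: L2_sum => // p pl; apply: L2_rv; first exact/mb/lT.
by have [] := ib _ _ (lT p pl) (lT p pl).
Qed.

Lemma nrm_step_integral (l : seq (R * X)) :
  (forall p, p \in l -> 0 <= p.1 <= T) ->
  N (step_integral b l) ^+ 2 = kform (fbm_cov H) l.
Proof.
move=> lT; have [mb [_ ib]] := fbm_props b_fbm.
have Lp p : p \in l -> L (fun w => b p.1 w *: p.2).
  move=> pl; apply: L2_rv; first exact/mb/lT.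
  by have [] := ib _ _ (lT p pl) (lT p pl).
have lL := L2_step_integral lT; rewrite -ip_nrm//.
rewrite {1}/step_integral; under eq_fun do rewrite big_seq.
rewrite ip_sum// /kform [RHS]big_seq; apply: eq_bigr => p pl.
rewrite ipC /step_integral; under eq_fun do rewrite big_seq.
rewrite ip_sum//; last exact: Lp.
rewrite [RHS]big_seq; apply: eq_bigr => q ql.
have [iqp <-] := ib _ _ (lT p pl) (lT q ql).
rewrite ipC ip_rv//.
Qed.

End StepIntegral.

Lemma ip_step_integral0 (H T : R) (J : set nat) (b : nat -> R -> Omega -> R) :
  (forall n, J n -> is_fBm P H T (b n)) -> independent_processes P T J b ->
  forall n m (l l' : seq (R * X)), J n -> J m -> n <> m ->
  (forall p, p \in l -> 0 <= p.1 <= T) -> (forall p, p \in l' -> 0 <= p.1 <= T) ->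
  ip P setT (step_integral (b n) l) (step_integral (b m) l') = 0.
Proof.
move=> bfbm bind n m l l' Jn Jm nm lT lT'.
have Lp k (s : seq (R * X)) p : J k -> (forall p, p \in s -> 0 <= p.1 <= T) ->
    p \in s -> L (fun w => b k p.1 w *: p.2).
  move=> Jk sT ps; have [mb [_ ib]] := fbm_props (bfbm k Jk).
  apply: L2_rv; first exact/mb/sT.
  by have [] := ib _ _ (sT p ps) (sT p ps).
have lL' := L2_step_integral (bfbm m Jm) lT'.
rewrite {1}/step_integral; under eq_fun do rewrite big_seq.
rewrite ip_sum//; last by move=> p pl; exact: (Lp n l).
rewrite big1// => p pl.
rewrite ipC /step_integral; under eq_fun do rewrite big_seq.
rewrite ip_sum//; last 2 first.
- by move=> q ql; exact: (Lp m l').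
- exact: (Lp n l).
rewrite big1// => q ql.
have [iqp E0] := fbm_uncorrelated bfbm bind Jn Jm nm (lT p pl) (lT' q ql).
by rewrite ipC ip_rv// E0 mul0r.
Qed.

End Fbm.

(** * Wiener integrals *)

Section StepFun.
Context (R : realType) (X : hilbertType R) (X_sep : separable X) (T : R).
Hypothesis T_ge0 : 0 <= T.

Local Notation leb := (@lebesgue_measure R).
Let D : set R := `[0, T]%classic.
Let mD : measurable (D : set (measurableTypeR R)). Proof. exact: measurable_itv. Qed.
Local Notation N := (nrm leb D).
Local Notation L := (L2 leb D).

Lemma leb_itv0 (a : R) : 0 <= a -> leb `[0, a] = a%:E.
Proof.
move=> a0; rewrite lebesgue_measure_itv/= lte_fin.
by case: ltP => [_|a0']; [rewrite sube0|congr EFin; apply/eqP; rewrite eq_le a0 a0'].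
Qed.

Let leb_D : (leb D < +oo)%E. Proof. by rewrite leb_itv0// ltry. Qed.

Lemma eq_nrm (h k : R -> X) : (forall s, D s -> h s = k s) -> N h = N k.
Proof.
move=> hk; rewrite /nrm !L2normE; congr (fine (_ `^ _)).
by apply: eq_integral => s; rewrite inE => Ds; rewrite hk.
Qed.

Lemma integrable_cstD (c : R) : leb.-integrable D (EFin \o (fun=> c)).
Proof.
apply/integrableP; split; first exact: measurable_cst.
under eq_integral do rewrite /=.
by rewrite integral_cst//; apply: lte_mul_pinfty.
Qed.

Lemma step_funE (l : seq (R * X)) (u : R) :
  step_fun l u = \sum_(p <- l) \1_(`[0, p.1]%classic) u *: p.2.
Proof.
rewrite /step_fun big_mkcond; apply: eq_bigr => p _; rewrite indicE mem_setE in_itv/=.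
by case: ifP => _; rewrite ?scale1r ?scale0r.
Qed.

Lemma L2_indic (E : set R) (v : X) : measurable E -> L (fun s => \1_E s *: v).
Proof.
move=> mE; have mEv : borel_fun D (fun s => \1_E s *: v).
  by apply: borelZ => //; exact: borel_cst.
apply/L2P; split => //; have /integrableP[_] := integrable_cstD (`|v| ^+ 2).
apply: le_lt_trans; apply: ge0_le_integral => //.
- exact/measurable_EFinP/borel_sqr.
- move=> s _; rewrite /= lee_fin [leRHS]ger0_norm ?sqr_ge0// normrZ indicE.
  by case: (_ \in _); rewrite ?normr1 ?normr0 ?mul1r ?mul0r// expr0n sqr_ge0.
Qed.

Lemma L2_step_fun (l : seq (R * X)) : L (step_fun l).
Proof.
rewrite (_ : step_fun l = fun u => \sum_(p <- l) \1_(`[0, p.1]%classic) u *: p.2).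
  by apply: L2_sum => // p _; apply: L2_indic; exact: measurable_itv.
by apply/funext => u; exact: step_funE.
Qed.

(** The intervals from 0 to [a] and from 0 to [c] overlap in length [min a c], so the Gram matrix
    has the covariance kernel of Brownian motion. *)
Lemma nrm_step_fun (l : seq (R * X)) :
  (forall p, p \in l -> 0 <= p.1 <= T) -> N (step_fun l) ^+ 2 = kform Num.min l.
Proof.
move=> lT; rewrite -ip_nrm//; last exact: L2_step_fun.
have E : step_fun l = fun u => \sum_(p <- l) \1_(`[0, p.1]%classic) u *: p.2.
  by apply/funext => u; exact: step_funE.
have Lp (p : R * X) : L (fun u => \1_(`[0, p.1]%classic) u *: p.2).
  by apply: L2_indic; exact: measurable_itv.
rewrite {1}E ip_sum//; last exact: L2_step_fun.
rewrite /kform [LHS]big_seq [RHS]big_seq; apply: eq_bigr => p pl.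
rewrite ipC E ip_sum// [LHS]big_seq [RHS]big_seq; apply: eq_bigr => q ql.
have /andP[p0 pT] := lT p pl; have /andP[q0 qT] := lT q ql.
have m0 : 0 <= Num.min p.1 q.1 by rewrite le_min p0.
have mT : Num.min p.1 q.1 <= T by rewrite ge_min pT.
have iI : leb.-integrable D (EFin \o \1_(`[0, Num.min p.1 q.1]%classic)).
  apply/integrableP; split; first by apply/measurable_EFinP; exact: measurable_indic.
  under eq_integral do rewrite /= ger0_norm//.
  rewrite integral_indic//.
  apply: (@le_lt_trans _ _ (leb D)); last exact: leb_D.
  by apply: le_measure; rewrite ?inE//; apply: measurableI => //; exact: measurable_itv.
transitivity (\int[leb]_(u in D)
    (\1_(`[0, Num.min p.1 q.1]%classic) u * dot p.2 q.2)).
  apply: eq_Rintegral => u _; rewrite dotZl dotZr dotC mulrA; congr (_ * _).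
  rewrite !indicE !mem_setE !in_itv/= le_min.
  by case: (0 <= u); case: (u <= p.1); case: (u <= q.1); rewrite ?mulr1 ?mulr0.
rewrite RintegralZr//; congr (_ * _); rewrite /Rintegral integral_indic//.
rewrite (_ : _ `&` _ = `[0, Num.min p.1 q.1]%classic); first exact: (congr1 fine (leb_itv0 m0)).
apply/setIidPl => u; rewrite /D /= !in_itv/= => /andP[-> /le_trans]; exact.
Qed.

(** Being approximable is stable under sums, opposites and L^2 limits, which is what the Dynkin
    argument for indicators requires. *)
Definition step_appr (h : R -> X) := forall e : R, 0 < e -> exists l : seq (R * X),
  (forall p, p \in l -> 0 <= p.1 <= T) /\ N (fun s => step_fun l s - h s) <= e.

Lemma step_fun_cat (l l' : seq (R * X)) u :
  step_fun (l ++ l') u = step_fun l u + step_fun l' u.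
Proof. by rewrite /step_fun big_cat. Qed.

Definition opp_steps (l : seq (R * X)) : seq (R * X) := [seq (p.1, - p.2) | p <- l].

Lemma step_fun_opp (l : seq (R * X)) u : step_fun (opp_steps l) u = - step_fun l u.
Proof. by rewrite /step_fun big_map /= sumrN. Qed.

Lemma opp_steps_dom (l : seq (R * X)) : (forall p, p \in l -> 0 <= p.1 <= T) ->
  forall p, p \in opp_steps l -> 0 <= p.1 <= T.
Proof. by move=> lT p /mapP[q ql ->]; exact: (lT q ql). Qed.

Lemma step_appr_eq (h k : R -> X) : (forall s, D s -> h s = k s) ->
  step_appr h -> step_appr k.
Proof.
move=> hk Hh e e0; have [l [lT hl]] := Hh e e0; exists l; split => //.
by rewrite (@eq_nrm _ (fun s => step_fun l s - h s))// => s Ds; rewrite hk.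
Qed.

Lemma step_apprD (h k : R -> X) : L h -> L k -> step_appr h -> step_appr k ->
  step_appr (fun s => h s + k s).
Proof.
move=> hL kL Hh Hk e e0; have e20 : 0 < e / 2 by rewrite divr_gt0.
have [l [lT hl]] := Hh _ e20; have [l' [lT' hl']] := Hk _ e20.
exists (l ++ l'); split.
  by move=> p; rewrite mem_cat => /orP[/lT|/lT'].
rewrite (splitr e); apply: (le_trans _ (lerD hl hl')).
apply: (le_trans _ (nrmD mD X_sep (L2B mD X_sep (L2_step_fun l) hL)
  (L2B mD X_sep (L2_step_fun l') kL))).
rewrite le_eqVlt; apply/orP; left; apply/eqP; apply: eq_nrm => s _.
by rewrite step_fun_cat opprD addrACA.
Qed.

Lemma step_apprN (h : R -> X) : L h -> step_appr h -> step_appr (fun s => - h s).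
Proof.
move=> hL Hh e e0; have [l [lT hl]] := Hh _ e0.
exists (opp_steps l); split; first exact: opp_steps_dom.
rewrite -(nrmN mD X_sep) in hl; last by apply: L2B => //; exact: L2_step_fun.
rewrite (@eq_nrm _ (fun s => - (step_fun l s - h s)))// => s _.
by rewrite step_fun_opp opprB opprK addrC.
Qed.

Lemma step_appr0 : step_appr (fun=> 0).
Proof.
move=> e e0; exists [::]; split => //.
rewrite (@eq_nrm _ (fun=> 0)); first by rewrite nrm0// ltW.
by move=> s _; rewrite /step_fun big_nil subrr.
Qed.

Lemma step_appr_sum n (h : nat -> R -> X) : (forall i, L (h i)) ->
  (forall i, step_appr (h i)) -> step_appr (fun s => \sum_(i < n) h i s).
Proof.
move=> hL Hh; elim: n => [|n IH].
  by apply: step_appr_eq step_appr0 => s _; rewrite big_ord0.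
have HL : L (fun s => \sum_(i < n) h i s) by apply: L2_sum.
by apply: step_appr_eq (step_apprD HL (hL n) IH (Hh n)) => s _; rewrite big_ord_recr.
Qed.

Lemma step_appr_lim (h : R -> X) : L h ->
  (forall e : R, 0 < e -> exists k, [/\ L k, step_appr k & N (fun s => k s - h s) <= e]) ->
  step_appr h.
Proof.
move=> hL H e e0; have e20 : 0 < e / 2 by rewrite divr_gt0.
have [k [kL Hk kh]] := H _ e20; have [l [lT hl]] := Hk _ e20.
exists l; split => //; rewrite (splitr e).
exact: le_trans (nrm_dist mD X_sep (L2_step_fun l) kL hL) (lerD hl kh).
Qed.

End StepFun.

Section StepDense.
Context (R : realType) (X : hilbertType R) (X_sep : separable X) (T : R).
Hypothesis T_ge0 : 0 <= T.

Local Notation leb := (@lebesgue_measure R).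
Let D : set R := `[0, T]%classic.
Let mD : measurable (D : set (measurableTypeR R)). Proof. exact: measurable_itv. Qed.
Local Notation N := (nrm leb D).
Local Notation L := (L2 leb D).

(** Rays generate the Borel sets, and on [[0, T]] the ray beyond [x] is exactly the difference of
    the indicators of [[0, T]] and [[0, x]]. The cases are [x] left of, inside and right of the
    interval. *)
Lemma step_appr_ray (x : R) (v : X) :
  step_appr T (fun s => \1_(`]x, +oo[%classic) s *: v).
Proof.
have exact_appr (l : seq (R * X)) h : (forall p, p \in l -> 0 <= p.1 <= T) ->
    (forall s, D s -> step_fun l s = h s) -> step_appr T h.
  move=> lT lh e e0; exists l; split => //.
  rewrite (@eq_nrm _ _ _ _ (fun=> 0)); first by rewrite nrm0// ltW.
  by move=> s Ds; rewrite lh// subrr.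
have [x0|x0] := ltP x 0.
  apply: (exact_appr [:: (T, v)]).
    by move=> p; rewrite inE => /eqP -> /=; rewrite T_ge0 lexx.
  move=> s; rewrite /D /= in_itv /= => /andP[s0 sT].
  by rewrite step_funE big_seq1 /= !indicE !mem_setE !in_itv /= s0 sT (lt_le_trans x0).
have [xT|xT] := leP x T.
  apply: (exact_appr [:: (T, v); (x, - v)]).
    by move=> p; rewrite !inE => /orP[] /eqP -> /=; rewrite ?T_ge0 ?lexx// x0.
  move=> s; rewrite /D /= in_itv /= => /andP[s0 sT].
  rewrite step_funE big_cons big_seq1 /= !indicE !mem_setE !in_itv /= s0 sT /= andbT.
  by case: ltP => xs; rewrite ?scale1r ?scale0r ?addr0// subrr.
apply: (exact_appr [::]) => // s; rewrite /D /= in_itv /= => /andP[s0 sT].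
rewrite step_funE big_nil indicE mem_setE in_itv /= andbT ltNge (le_trans sT)/= ?scale0r//.
exact: ltW.
Qed.

Lemma step_appr_indic (E : set (measurableTypeR R)) : measurable E ->
  forall v : X, step_appr T (fun s => \1_E s *: v).
Proof.
move=> mE.
have : (@RGenOInfty.G R).-sigma.-measurable E by rewrite -RGenOInfty.measurableE.
move: E {mE}; apply: (@dynkin_induction _ (measurableTypeR R) (@RGenOInfty.G R)
  (fun E => forall v : X, step_appr T (fun s => \1_E s *: v))).
- exact: RGenOInfty.measurableE.
- move=> _ _ [x ->] [y ->]; exists (Num.max x y).
  by apply/seteqP; split => s /=; rewrite !in_itv /= !andbT gt_max; [move=> [-> ->]|move=> /andP[]].
(* Only [[0, T]] counts, so a ray starting before 0 stands for the whole line. *)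
- move=> v; apply: step_appr_eq (step_appr_ray (-1) v) => s.
  rewrite /D /= in_itv /= => /andP[s0 sT].
  by rewrite !indicE mem_setE in_itv /= andbT (lt_le_trans _ s0)// in_setT.
- by move=> _ [x ->] v; exact: step_appr_ray.
- move=> E mE HE v.
  have LE : L (fun s => \1_E s *: v) by apply: L2_indic.
  have H1 := step_appr_ray (-1) v.
  have L1 : L (fun s => \1_(`]-1, +oo[%classic) s *: v).
    by apply: L2_indic => //; exact: measurable_itv.
  apply: step_appr_eq (step_apprD X_sep T_ge0 L1 (L2N mD X_sep LE) H1 (step_apprN X_sep T_ge0 LE (HE v))) => s.
  rewrite /D /= in_itv /= => /andP[s0 sT].
  rewrite !indicE mem_setE in_itv /= andbT (lt_le_trans _ s0)// in_setC.
  by case: (_ \in _); rewrite ?scale1r ?scale0r ?subrr ?subr0.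
- move=> F mF tF HF v.
  have mU : measurable (\bigcup_k F k) by apply: bigcup_measurable => k _; exact: mF.
  have LF i : L (fun s => \1_(F i) s *: v) by apply: L2_indic => //; exact: mF.
  have LU : L (fun s => \1_(\bigcup_k F k) s *: v) by apply: L2_indic.
  pose hn n s := \sum_(i < n) \1_(F i) s *: v.
  have Lhn n : L (hn n) by apply: L2_sum.
  have hnE n s j : F j s -> hn n s = if (j < n)%N then v else 0.
    move=> Fj; rewrite /hn; elim: n => [|n IH]; first by rewrite big_ord0.
    rewrite big_ord_recr /= {}IH indicE ltnS [(j <= n)%N]leq_eqVlt.
    have [jn|jn] := eqVneq j n.
      by rewrite -jn ltnn mem_set// scale1r add0r.
    rewrite memNset ?scale0r ?addr0// => Fn; move/eqP: jn; apply.
    by apply: (tF j n) => //; exists s.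
  have hn0 n s : ~ (\bigcup_k F k) s -> hn n s = 0.
    move=> nF; rewrite /hn big1// => i _; rewrite indicE memNset ?scale0r// => Fi.
    by apply: nF; exists (i : nat).
  (* By disjointness a partial sum is either [v] or 0, so the squared error is dominated by the
     constant [|v| ^ 2]. *)
  have [Lsub Hcvg] : (forall n, L (fun s => hn n s - \1_(\bigcup_k F k) s *: v)) /\
      N (fun s => hn n s - \1_(\bigcup_k F k) s *: v) @[n --> \oo] --> (0 : R).
    apply: (L2_dct mD X_sep (W := fun=> `|v| ^+ 2)).
    + by move=> n; have [] := Lhn n.
    + by have [] := LU.
    + exact: integrable_cstD.
    + move=> n s _; have [[j _ Fj]|nF] := pselect ((\bigcup_k F k) s).
        rewrite (hnE n s j)// indicE mem_set ?scale1r; last by exists j.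
        by case: ifP => _; rewrite ?subrr ?normr0 ?expr0n ?sqr_ge0// sub0r normrN.
      by rewrite hn0// indicE memNset// scale0r subrr normr0 expr0n sqr_ge0.
    + move=> s _; have [[j _ Fj]|nF] := pselect ((\bigcup_k F k) s).
        apply: (@cvg_near_cst _ _ _ _ _ eventually_filter); exists j.+1 => // n /= jn.
        by rewrite (hnE n s j)// jn indicE mem_set ?scale1r//; exists j.
      rewrite indicE memNset// scale0r; under eq_fun do rewrite hn0//.
      exact: cvg_cst.
  apply: (step_appr_lim X_sep T_ge0 LU) => e e0.
  have /cvgrPdist_le/(_ _ e0)[n _ /(_ n (leqnn n))] := Hcvg.
  rewrite sub0r normrN ger0_norm ?nrm_ge0// => Hn.
  exists (hn n); split => //.
  exact: (step_appr_sum X_sep T_ge0 n LF (fun i => HF i v)).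
Qed.

(** [borel_approx] supplies finitely valued approximations whose error is dominated by the norm of
    [h]; dominated convergence applies, and each approximation is a finite sum of indicators times
    vectors. *)
Lemma step_dense (h : R -> X) : L h -> step_appr T h.
Proof.
move=> hL; have [mh _] := hL.
have [v [idx [midx idxk le_h cvg_h]]] := borel_approx mD X_sep mh.
pose sk k s := v (idx k s).
pose E k i : set (measurableTypeR R) := D `&` [set s | idx k s = i].
have skE k s : D s -> sk k s = \sum_(i < k.+1) \1_(E k i) s *: v i.
  move=> Ds; have ak : (idx k s < k.+1)%N by rewrite ltnS idxk.
  rewrite (bigD1 (Ordinal ak))//= indicE mem_set ?scale1r; last by split.
  rewrite big1 ?addr0// => i /eqP ni; rewrite indicE memNset ?scale0r// => -[_ /= ai].
  by apply: ni; exact/val_inj.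
have skB k : borel_fun D (sk k).
  by apply: (borel_glue mD (F := fun i _ => v i)) => // i; exact: borel_cst.
have iW : leb.-integrable D (EFin \o (fun s => `|h s| ^+ 2)).
  rewrite (_ : _ \o _ = (EFin \o (fun s => dot (h s) (h s)))); first exact: integrable_dot.
  by apply/funext => s /=; rewrite dotxx.
have [Lsub Hcvg] := L2_dct mD X_sep skB mh iW
  (fun k s _ => (ltac:(rewrite ler_sqr ?nnegrE// distrC; exact: le_h)))
  (fun s _ => cvg_h s).
have Lsk k : L (sk k).
  have := L2D mD X_sep (Lsub k) hL.
  by congr (L2 leb D); apply/funext => s; rewrite subrK.
apply: (step_appr_lim X_sep T_ge0 hL) => e e0.
have /cvgrPdist_le/(_ _ e0)[n _ /(_ n (leqnn n))] := Hcvg.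
rewrite sub0r normrN ger0_norm ?nrm_ge0// => Hn.
exists (sk n); split => //.
apply: (@step_appr_eq _ _ _ (fun s => \sum_(i < n.+1) \1_(E n i) s *: v i)).
  by move=> s Ds; rewrite skE.
apply: (step_appr_sum X_sep T_ge0 n.+1 (h := fun i s => \1_(E n i) s *: v i)).
  by move=> i; apply: L2_indic => //; exact: midx.
by move=> i; apply: step_appr_indic; exact: midx.
Qed.

End StepDense.

(** * The Wiener integral as a continuous extension *)

Section Wiener.
Context (R : realType) (d : measure_display) (Omega : measurableType d).
Context (P : probability Omega R) (X : hilbertType R) (X_sep : separable X).
Context (H T : R) (H_range : 2^-1 < H < 1) (T_ge0 : 0 <= T).

Local Notation leb := (@lebesgue_measure R).
Local Notation N := (nrm P setT).
Local Notation L := (L2 P setT).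
Local Notation NT := (nrm leb `[0, T]%classic).
Local Notation LT := (L2 leb `[0, T]%classic).
Let mT : measurable [set: Omega] := measurableT.
Let mI (t : R) : measurable (`[0, t]%classic : set (measurableTypeR R)).
Proof. exact: measurable_itv. Qed.

(** Extension by zero past [t]: integrands over different intervals become elements of one space L^2
    over [[0, T]] and can be subtracted. Values at negative times are irrelevant. *)
Definition ext0 (t : R) (h : R -> X) (s : R) : X := if s <= t then h s else 0.

Lemma int_ext0 (t : R) (h : R -> X) : t <= T ->
  (\int[leb]_(s in `[0%R, T]) (`|ext0 t h s| ^+ 2)%:E =
   \int[leb]_(s in `[0%R, t]) (`|h s| ^+ 2)%:E)%E.
Proof.
move=> tT; rewrite [LHS]integral_mkcond [RHS]integral_mkcond.
apply: eq_integral => s _; rewrite /patch /ext0 !mem_setE !in_itv/=.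
have [st|st] := leP s t; first by rewrite (le_trans st tT).
by rewrite andbF; case: ifP => //; rewrite normr0 expr0n.
Qed.

Lemma borel_ext0 (t : R) (h : R -> X) : borel_fun `[0, t]%classic h -> t <= T ->
  borel_fun (`[0, T]%classic : set (measurableTypeR R)) (ext0 t h).
Proof.
move=> mh tT; apply/(borelP _ (mI T)) => O oO.
have -> : `[0, T]%classic `&` ext0 t h @^-1` O =
    ((`[0, t]%classic `&` h @^-1` O) `|`
     (`]t, T]%classic `&` `[0, T]%classic `&` (if 0 \in O then setT else set0))).
  apply/seteqP; split => s /=; rewrite /ext0 !in_itv /=.
    move=> [/andP[s0 sT]]; case: leP => st Os; [left|right].
      by rewrite s0.
    by rewrite s0 sT; split => //; rewrite mem_set.
  case=> [[/andP[s0 st] Os]|[[/andP[ts _] /andP[s0 sT]]]].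
    by rewrite s0 st (le_trans st tT).
  rewrite s0 sT leNgt ts /=; case: ifPn => // /set_mem O0 _; split => //.
apply: measurableU; first by move/(borelP _ (mI t)) : mh; apply.
apply: measurableI.
  by apply: measurableI => //; exact: measurable_itv.
by case: ifP.
Qed.

Lemma L2_ext0 (t : R) (h : R -> X) : L2 leb `[0, t]%classic h -> t <= T ->
  LT (ext0 t h).
Proof.
move=> /L2P[mh hoo] tT; apply/L2P; split; first exact: borel_ext0.
by rewrite int_ext0.
Qed.

(** A difference of step integrals is the step integral of a concatenated list, to which
    [fbm_form_le] applies. *)
Lemma wiener_step_le (b : R -> Omega -> R) (l l' : seq (R * X)) : is_fBm P H T b ->
  (forall p, p \in l -> 0 <= p.1 <= T) -> (forall p, p \in l' -> 0 <= p.1 <= T) ->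
  N (fun w => step_integral b l w - step_integral b l' w) ^+ 2 <=
  (T + 1) `^ (2 * H) * NT (fun s => step_fun l s - step_fun l' s) ^+ 2.
Proof.
move=> b_fbm lT lT'.
pose ll := l ++ opp_steps l'.
have llT p : p \in ll -> 0 <= p.1 <= T.
  by rewrite mem_cat => /orP[/lT//|]; exact: opp_steps_dom.
have -> : (fun w => step_integral b l w - step_integral b l' w) = step_integral b ll.
  apply/funext => w; rewrite /step_integral big_cat big_map /= -sumrN; congr (_ + _).
  by apply: eq_bigr => p _; rewrite scalerN.
have -> : (fun s => step_fun l s - step_fun l' s) = step_fun ll.
  by apply/funext => s; rewrite step_fun_cat step_fun_opp.
rewrite (nrm_step_integral X_sep b_fbm)// nrm_step_fun//.
exact: fbm_form_le.
Qed.

Lemma wiener_exists (b : R -> Omega -> R) (t : R) (h : R -> X) :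
  is_fBm P H T b -> 0 <= t <= T -> L2 leb `[0, t]%classic h ->
  exists Z, is_wiener_integral P b t h Z.
Proof.
move=> b_fbm /andP[t0 tT] hL.
have lk_ k : {l : seq (R * X) | (forall p, p \in l -> 0 <= p.1 <= t) /\
    nrm leb `[0, t]%classic (fun s => step_fun l s - h s) <= k.+1%:R^-1}.
  by apply: cid; apply: (step_dense X_sep t0 hL); rewrite invr_gt0.
pose lk k := sval (lk_ k).
have lkt k p : p \in lk k -> 0 <= p.1 <= t by have [H1 _] := svalP (lk_ k); exact: H1.
have lkT k p : p \in lk k -> 0 <= p.1 <= T.
  by move=> /lkt /andP[-> pt]; exact: le_trans tT.
have lkh k : nrm leb `[0, t]%classic (fun s => step_fun (lk k) s - h s) <= k.+1%:R^-1.
  by have [_ H1] := svalP (lk_ k).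
have sL k : L2 leb `[0, t]%classic (step_fun (lk k)) by apply: L2_step_fun.
have siL k : L (step_integral b (lk k)) by exact: (L2_step_integral X_sep b_fbm (lkT k)).
have lkc : nrm leb `[0, t]%classic (fun s => step_fun (lk k) s - h s) @[k --> \oo] --> (0 : R).
  apply: (cvg0_le _ (@cvg_harmonic R)).
  by apply: nearW => k; rewrite nrm_ge0; exact: lkh.
have K0 : 0 <= (T + 1) `^ (2 * H) by exact: powR_ge0.
have [Z ZL hZ] : exists2 Z, L Z &
    N (fun w => step_integral b (lk k) w - Z w) @[k --> \oo] --> (0 : R).
  apply: L2P_complete => // e e0.
  (* Chosen so that the square of [c + c] times [(T + 1) ^ (2 H) + 1] equals [e ^ 2]; the added 1
     makes the root positive. *)
  pose c := e / 2 / Num.sqrt ((T + 1) `^ (2 * H) + 1).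
  have sK : 0 < Num.sqrt ((T + 1) `^ (2 * H) + 1) by rewrite sqrtr_gt0 ltr_wpDl.
  have c0 : 0 < c by rewrite !divr_gt0.
  have /cvgrPdist_le/(_ _ c0)[K _ HK] := lkc.
  exists K => n m /HK /= + /HK /=.
  rewrite !sub0r !normrN !(ger0_norm (nrm_ge0 _ _ _)) => Hn Hm.
  rewrite -ler_sqr ?nnegrE ?nrm_ge0//; last exact: ltW.
  apply: le_trans (wiener_step_le b_fbm (lkT n) (lkT m)) _.
  (* All jump times lie in [[0, t]], so the step functions vanish beyond [t]. *)
  have -> : NT (fun s => step_fun (lk n) s - step_fun (lk m) s) =
      nrm leb `[0, t]%classic (fun s => step_fun (lk n) s - step_fun (lk m) s).
    rewrite /nrm !L2normE -(int_ext0 _ tT); congr (fine (_ `^ _)); apply: eq_integral => s.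
    rewrite inE /= in_itv /= => /andP[s0 sT]; rewrite /ext0; case: leP => // ts.
    by rewrite /step_fun !big1_seq ?subrr// => p /andP[/andP[_ sp]] /lkt/andP[_ pt];
      move: ts; rewrite ltNge (le_trans sp pt).
  have Hnm : nrm leb `[0, t]%classic (fun s => step_fun (lk n) s - step_fun (lk m) s) <= c + c.
    apply: le_trans (nrm_dist (mI t) X_sep (sL n) hL (sL m)) _.
    by apply: lerD => //; rewrite nrmB.
  apply: (@le_trans _ _ (((T + 1) `^ (2 * H) + 1) * (c + c) ^+ 2)).
    apply: ler_pM => //; rewrite ?sqr_ge0 ?lerDl//.
    by rewrite ler_sqr ?nnegrE ?nrm_ge0 ?addr_ge0// ltW.
  rewrite -{1}(@sqr_sqrtr _ ((T + 1) `^ (2 * H) + 1)) ?addr_ge0// -exprMn.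
  rewrite le_eqVlt; apply/orP; left; apply/eqP; congr (_ ^+ 2).
  by rewrite /c; field; rewrite gt_eqF.
exists Z; split => //; exists lk; split => //.
  by apply/cvg_L2normP => //; apply: nearW => k; apply: L2B.
by apply/cvg_L2normP => //; apply: nearW => k; apply: L2B.
Qed.

End Wiener.

Section NrmLimits.
Context (R : realType) (d : measure_display) (S : measurableType d).
Context (mu : {measure set S -> \bar R}) (D : set S) (mD : measurable D).
Context (X : hilbertType R) (X_sep : separable X).
Local Notation N := (nrm mu D).
Local Notation L := (L2 mu D).

Lemma nrm_cvg (u : nat -> S -> X) (u0 : S -> X) :
  (forall k, L (u k)) -> L u0 ->
  N (fun s => u k s - u0 s) @[k --> \oo] --> (0 : R) ->
  N (u k) @[k --> \oo] --> N u0.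
Proof.
move=> uL u0L cu; apply/cvgrPdist_le => e e0.
have /cvgrPdist_le/(_ _ e0) := cu; apply: filterS => k.
rewrite sub0r normrN (ger0_norm (nrm_ge0 _ _ _)) nrmB; apply: le_trans.
exact: nrm_sub_le.
Qed.

Lemma nrm_cvg_sub (u v : nat -> S -> X) (u0 v0 : S -> X) :
  (forall k, L (u k)) -> L u0 -> (forall k, L (v k)) -> L v0 ->
  N (fun s => u k s - u0 s) @[k --> \oo] --> (0 : R) ->
  N (fun s => v k s - v0 s) @[k --> \oo] --> (0 : R) ->
  N (fun s => u k s - v k s) @[k --> \oo] --> N (fun s => u0 s - v0 s).
Proof.
move=> uL u0L vL v0L cu cv.
apply: nrm_cvg => [k||]; try exact: L2B.
apply: (cvg0_le (r := fun k => N (fun s => u k s - u0 s) + N (fun s => v k s - v0 s))).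
  apply: nearW => k; rewrite nrm_ge0/= (nrmB _ _ (v k)).
  apply: (le_trans _ (nrmD mD X_sep (L2B mD X_sep (uL k) u0L) (L2B mD X_sep v0L (vL k)))).
  rewrite le_eqVlt; apply/orP; left; apply/eqP; congr nrm; apply/funext => s.
  by rewrite opprB addrACA [RHS]addrACA (addrC (- v k s)).
by rewrite -[X in _ --> X](addr0 (0 : R)); exact: cvgD.
Qed.

Lemma ip_cvg (u v : nat -> S -> X) (u0 v0 : S -> X) :
  (forall k, L (u k)) -> L u0 -> (forall k, L (v k)) -> L v0 ->
  N (fun s => u k s - u0 s) @[k --> \oo] --> (0 : R) ->
  N (fun s => v k s - v0 s) @[k --> \oo] --> (0 : R) ->
  ip mu D (u k) (v k) @[k --> \oo] --> ip mu D u0 v0.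
Proof.
move=> uL u0L vL v0L cu cv.
apply/(cvg_norm_sub0 (X := R^o)).
apply: (cvg0_le (r := fun k => N (fun s => u k s - u0 s) * N (v k) +
   N u0 * N (fun s => v k s - v0 s))).
  apply: nearW => k; rewrite normr_ge0/=.
  have -> : ip mu D (u k) (v k) - ip mu D u0 v0 =
      ip mu D (fun s => u k s - u0 s) (v k) + ip mu D u0 (fun s => v k s - v0 s).
    have e1 : ip mu D (fun s => u k s - u0 s) (v k) = ip mu D (u k) (v k) - ip mu D u0 (v k).
      exact: ipB.
    have e2 : ip mu D u0 (fun s => v k s - v0 s) = ip mu D u0 (v k) - ip mu D u0 v0.
      by rewrite ipC (ipB mD X_sep (vL k) v0L u0L) (ipC _ _ (v k)) (ipC _ _ v0).
    by rewrite e1 e2; lra.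
  apply: le_trans (ler_normD _ _) _.
  by apply: lerD; apply: ip_le => //; exact: L2B.
rewrite [X in _ --> X](_ : 0 = 0 * N v0 + N u0 * 0 :> R); last by rewrite mul0r mulr0 addr0.
apply: cvgD; apply: cvgM => //; last exact: cvg_cst.
exact: nrm_cvg.
Qed.

End NrmLimits.

Section WienerLe.
Context (R : realType) (d : measure_display) (Omega : measurableType d).
Context (P : probability Omega R) (X : hilbertType R) (X_sep : separable X).
Context (H T : R) (H_range : 2^-1 < H < 1) (T_ge0 : 0 <= T).

Local Notation leb := (@lebesgue_measure R).
Local Notation N := (nrm P setT).
Local Notation L := (L2 P setT).
Local Notation NT := (nrm leb `[0, T]%classic).
Local Notation LT := (L2 leb `[0, T]%classic).
Let mT : measurable [set: Omega] := measurableT.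
Let mI (t : R) : measurable (`[0, t]%classic : set (measurableTypeR R)).
Proof. exact: measurable_itv. Qed.

Lemma wiener_data (b : R -> Omega -> R) (t : R) (h : R -> X) (Z : Omega -> X) :
  is_fBm P H T b -> 0 <= t <= T -> is_wiener_integral P b t h Z ->
  [/\ LT (ext0 t h), L Z & exists l : nat -> seq (R * X),
    [/\ forall k p, p \in l k -> 0 <= p.1 <= T,
        NT (fun s => step_fun (l k) s - ext0 t h s) @[k --> \oo] --> (0 : R) &
        N (fun w => step_integral b (l k) w - Z w) @[k --> \oo] --> (0 : R)]].
Proof.
move=> b_fbm /andP[t0 tT] [hL ZL [l [lt lh lZ]]].
split => //; first exact: L2_ext0.
have lT k p : p \in l k -> 0 <= p.1 <= T.
  by move=> /lt /andP[-> pt]; exact: le_trans tT.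
exists l; split => //.
  have : nrm leb `[0, t]%classic (fun s => step_fun (l k) s - h s) @[k --> \oo] --> (0 : R).
    apply/cvg_L2normP => //; apply: nearW => k.
    exact: (L2B (mI t) X_sep (L2_step_fun X_sep t0 (l k)) hL).
  apply: cvg_trans; apply: near_eq_cvg; apply: nearW => k.
  rewrite /nrm !L2normE -(int_ext0 _ tT); congr (fine (_ `^ _)); apply: eq_integral => s.
  rewrite inE /= in_itv /= => /andP[s0 sT]; rewrite /ext0; case: leP => // ts.
  by rewrite /step_fun big1_seq ?subrr// => p /andP[/andP[_ sp]] /lt/andP[_ pt];
    move: ts; rewrite ltNge (le_trans sp pt).
apply/cvg_L2normP => //; apply: nearW => k.
exact: (L2B mT X_sep (L2_step_integral X_sep b_fbm (lT k)) ZL).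
Qed.

(** Limit of [wiener_step_le]. Two upper limits are allowed because both integrands are extended to
    [[0, T]]; for equal data it gives uniqueness. *)
Lemma wiener_le (b : R -> Omega -> R) (t t' : R) (h h' : R -> X) (Z Z' : Omega -> X) :
  is_fBm P H T b -> 0 <= t <= T -> 0 <= t' <= T ->
  is_wiener_integral P b t h Z -> is_wiener_integral P b t' h' Z' ->
  N (fun w => Z w - Z' w) ^+ 2 <=
  (T + 1) `^ (2 * H) * NT (fun s => ext0 t h s - ext0 t' h' s) ^+ 2.
Proof.
move=> b_fbm tT tT' /(wiener_data b_fbm tT)[hL ZL [l [lT lh lZ]]].
move=> /(wiener_data b_fbm tT')[hL' ZL' [l' [lT' lh' lZ']]].
have sL k : LT (step_fun (l k)) by exact: L2_step_fun.
have sL' k : LT (step_fun (l' k)) by exact: L2_step_fun.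
have iL k : L (step_integral b (l k)) by exact: (L2_step_integral X_sep b_fbm (lT k)).
have iL' k : L (step_integral b (l' k)) by exact: (L2_step_integral X_sep b_fbm (lT' k)).
have c1 := nrm_cvg_sub mT X_sep iL ZL iL' ZL' lZ lZ'.
have c2 := nrm_cvg_sub (mI T) X_sep sL hL sL' hL' lh lh'.
apply: (ler_cvg_to (cvg_sqr c1) (cvgM (cvg_cst _) (cvg_sqr c2))).
by apply: nearW => k; exact: (wiener_step_le X_sep H_range T_ge0 b_fbm (lT k) (lT' k)).
Qed.

Lemma wiener_ip0 (J : set nat) (b : nat -> R -> Omega -> R) (n m : nat) (t t' : R)
    (h h' : R -> X) (Z Z' : Omega -> X) :
  (forall n, J n -> is_fBm P H T (b n)) -> independent_processes P T J b ->
  J n -> J m -> n <> m -> 0 <= t <= T -> 0 <= t' <= T ->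
  is_wiener_integral P (b n) t h Z -> is_wiener_integral P (b m) t' h' Z' ->
  ip P setT Z Z' = 0.
Proof.
move=> bfbm bind Jn Jm nm tT tT' /(wiener_data (bfbm n Jn) tT)[hL ZL [l [lT lh lZ]]].
move=> /(wiener_data (bfbm m Jm) tT')[hL' ZL' [l' [lT' lh' lZ']]].
have iL k : L (step_integral (b n) (l k)).
  by exact: (L2_step_integral X_sep (bfbm n Jn) (lT k)).
have iL' k : L (step_integral (b m) (l' k)).
  by exact: (L2_step_integral X_sep (bfbm m Jm) (lT' k)).
have := ip_cvg mT X_sep iL ZL iL' ZL' lZ lZ'.
under eq_fun do rewrite (ip_step_integral0 X_sep bfbm bind Jn Jm nm (lT _) (lT' _)).
by move=> /(cvg_unique _ (cvg_cst _)) <-.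
Qed.

End WienerLe.

Lemma nneg_sum_cauchy (R : realType) (a : nat -> R) (J : pred nat) (C : R) :
  (forall n, J n -> 0 <= a n) -> (forall k, \sum_(0 <= n < k | J n) a n <= C) ->
  forall e : R, 0 < e -> exists K, forall m k, (K <= m)%N -> (m <= k)%N ->
    \sum_(m <= n < k | J n) a n <= e.
Proof.
move=> a0 aC e e0; pose s k := \sum_(0 <= n < k | J n) a n.
have ndS : {homo s : m n / (m <= n)%N >-> m <= n}.
  move=> m n mn; rewrite /s (big_cat_nat _ mn)//= lerDl sumr_ge0//.
have cs : cvgn s by apply: (@nondecreasing_is_cvgn R s ndS); exists C => _ [k _ <-]; exact: aC.
have e2 : 0 < e / 2 by lra.
have /cvgrPdist_le/(_ _ e2)[K _ HK] := cs.
exists K => m k Km mk.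
have : s k = s m + \sum_(m <= n < k | J n) a n by rewrite /s (big_cat_nat _ mk).
have /= := HK m Km; have /= := HK k (leq_trans Km mk).
move: (lim _) (s k) (s m) => l x y; rewrite !ler_norml; lra.
Qed.

Section OrthogonalSum.
Context (R : realType) (d : measure_display) (S : measurableType d).
Context (mu : {measure set S -> \bar R}) (D : set S) (mD : measurable D).
Context (X : hilbertType R) (X_sep : separable X).

Lemma nrm_orth_sum (J : pred nat) (Z : nat -> S -> X) (r : seq nat) : uniq r ->
  (forall n, J n -> L2 mu D (Z n)) ->
  (forall n m, J n -> J m -> n <> m -> ip mu D (Z n) (Z m) = 0) ->
  nrm mu D (fun w => \sum_(n <- r | J n) Z n w) ^+ 2 = \sum_(n <- r | J n) nrm mu D (Z n) ^+ 2.
Proof.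
move=> + ZL Z0; elim: r => [_|n r IH /= /andP[nr ur]].
  by rewrite big_nil (_ : (fun _ => _) = fun=> 0) ?nrm0 ?expr0n//; apply/funext => w; rewrite big_nil.
rewrite big_cons; case: ifPn => Jn; last first.
  by rewrite -IH//; congr (nrm _ _ _ ^+ 2); apply/funext => w; rewrite big_cons (negbTE Jn).
rewrite (_ : (fun _ => _) = fun w => Z n w + \sum_(i <- r | J i) Z i w); last first.
  by apply/funext => w; rewrite big_cons Jn.
rewrite sqr_nrmD//; [|exact: ZL|exact: L2_sum].
rewrite IH// ipC ip_sum//; last exact: ZL.
rewrite big_seq_cond big1 ?mulr0 ?addr0// => i /andP[ir Ji]; apply: Z0 => // in_.
by move: nr; rewrite -in_ ir.
Qed.

(** Only finite sums are exchanged with the integral; the series enters as an upper bound of its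
    partial sums. *)
Lemma sum_nrm_le (J : pred nat) (h : nat -> S -> X) (c : R) :
  (forall n, J n -> L2 mu D (h n)) ->
  (\int[mu]_(s in D) (\sum_(n <oo | J n) (`|h n s| ^+ 2)%:E) <= c%:E)%E ->
  forall k, \sum_(0 <= n < k | J n) nrm mu D (h n) ^+ 2 <= c.
Proof.
move=> hL hc k; rewrite -lee_fin; apply: le_trans hc.
pose F n s := if J n then (`|h n s| ^+ 2)%:E else 0%E.
have F0 n s : (0 <= F n s)%E by rewrite /F; case: ifP => // _; rewrite lee_fin sqr_ge0.
have mF n : measurable_fun D (F n).
  rewrite /F; case: (boolP (J n)) => [Jn|_]; last exact: measurable_cst.
  by apply/measurable_EFinP; apply: borel_sqr => //; have [] := hL n Jn.
have -> : (\sum_(0 <= n < k | J n) nrm mu D (h n) ^+ 2)%:E =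
    (\int[mu]_(s in D) \sum_(n <- index_iota 0 k) F n s)%E.
  rewrite ge0_integral_sum// -sumEFin big_mkcond; apply: eq_bigr => n _; rewrite /F.
  by case: (boolP (J n)) => [Jn|_]; [rewrite int_sqr_nrm//; exact: hL|rewrite integral0].
apply: ge0_le_integral => //.
- by move=> s _; apply: sume_ge0.
- exact: emeasurable_sum.
- apply: (ge0_emeasurable_sum (P := J)) => [n s _ _|n Jn]; first by rewrite lee_fin sqr_ge0.
  by apply/measurable_EFinP; apply: borel_sqr => //; have [] := hL n Jn.
- move=> s _; rewrite /F -big_mkcond; apply: nneseries_lim_ge => n _ _.
  by rewrite lee_fin sqr_ge0.
Qed.

End OrthogonalSum.

(** * Integrals against the Hilbert space valued fractional Brownian motion *)

Section FbmIntegral.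
Context (R : realType) (d : measure_display) (Omega : measurableType d).
Context (P : probability Omega R) (X Y : hilbertType R) (X_sep : separable X).
Context (H T : R) (H_range : 2^-1 < H < 1) (T_ge0 : 0 <= T) (B : QfBm P Y H T).

Local Notation leb := (@lebesgue_measure R).
Local Notation N := (nrm P setT).
Local Notation L := (L2 P setT).
Local Notation NT := (nrm leb `[0, T]%classic).
Local Notation LT := (L2 leb `[0, T]%classic).
Local Notation J := (bm_idx B).
Local Notation K := ((T + 1) `^ (2 * H)).
Let mT : measurable [set: Omega] := measurableT.
Let mI (t : R) : measurable (`[0, t]%classic : set (measurableTypeR R)).
Proof. exact: measurable_itv. Qed.

(** The integrand of the [n]-th coordinate, with the weight absorbed so that the squares of these
    functions sum to the squared norm in L_2^0. *)
Definition coef (phi : R -> Y -> X) (n : nat) (s : R) : X :=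
  Num.sqrt (bm_lambda B n) *: phi s (bm_e B n).

Lemma sqr_coef (phi : R -> Y -> X) (n : nat) (s : R) : n \in J ->
  `|coef phi n s| ^+ 2 = bm_lambda B n * `|phi s (bm_e B n)| ^+ 2.
Proof.
move=> /set_mem Jn; rewrite normrZ exprMn real_normK ?num_real// sqr_sqrtr//.
exact: bm_lambda_ge0.
Qed.

Lemma L20_coef (phi : R -> Y -> X) (s : R) :
  L20_norm2 B (phi s) = (\sum_(n <oo | n \in J) (`|coef phi n s| ^+ 2)%:E)%E.
Proof. by apply: eq_eseriesr => n Jn; rewrite sqr_coef. Qed.

Lemma L20_norm2_ge0 (psi : Y -> X) : (0 <= L20_norm2 B psi)%E.
Proof.
apply: nneseries_ge0 => n _ /set_mem Jn; rewrite lee_fin mulr_ge0 ?sqr_ge0//.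
exact: bm_lambda_ge0.
Qed.

Lemma coef_L2 (phi : R -> Y -> X) (t : R) (n : nat) : 0 <= t <= T -> n \in J ->
  L20_measurable B `[0, t]%classic phi ->
  (\int[leb]_(s in `[0%R, t]) L20_norm2 B (phi s) < +oo)%E ->
  L2 leb `[0, t]%classic (coef phi n).
Proof.
move=> /andP[t0 tT] Jn mphi oo.
have mc : forall m, m \in J -> borel_fun (`[0, t]%classic : set (measurableTypeR R)) (coef phi m).
  move=> m /set_mem Jm; apply: (borelZ (mI t) X_sep); last exact: mphi.
  exact: measurable_cst.
apply/L2P; split; first exact: mc.
apply: le_lt_trans oo; apply: ge0_le_integral.
- exact: mI.
- by move=> s _; rewrite lee_fin sqr_ge0.
- by apply/measurable_EFinP; apply: borel_sqr; [exact: mI|exact: mc].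
- rewrite (_ : (fun s => _) = fun s => (\sum_(n <oo | n \in J) (`|coef phi n s| ^+ 2)%:E)%E);
    last by apply/funext => s; rewrite L20_coef.
  apply: (ge0_emeasurable_sum (P := mem J)) => [m s _ _|m Jm]; first by rewrite lee_fin sqr_ge0.
  by apply/measurable_EFinP; apply: borel_sqr; [exact: mI|exact: mc].
- move=> s _; rewrite L20_coef.
  have := @nneseries_lim_ge R (fun n => (`|coef phi n s| ^+ 2)%:E) (mem J) 0 n.+1
    (fun n _ _ => ltac:(by rewrite lee_fin sqr_ge0)).
  apply: le_trans; rewrite big_mkcond big_nat_recr//= ifT// leeDr//.
  by apply: sume_ge0 => i _; case: ifP => // _; rewrite lee_fin sqr_ge0.
Qed.

(** The coordinate differences are pairwise orthogonal by independence, so the squared norms of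
    partial sums add up and [wiener_le] applies term by term. With [c = 0] this is uniqueness; with
    two upper limits it gives continuity in time. *)
Lemma fbm_integral_le (t t' c : R) (phi phi' : R -> Y -> X) (Z Z' : Omega -> X) :
  0 <= t <= T -> 0 <= t' <= T ->
  is_fBm_integral B t phi Z -> is_fBm_integral B t' phi' Z' ->
  (\int[leb]_(s in `[0%R, T]) (\sum_(n <oo | n \in J)
      (`|ext0 t (coef phi n) s - ext0 t' (coef phi' n) s| ^+ 2)%:E) <= c%:E)%E ->
  N (fun w => Z w - Z' w) ^+ 2 <= K * c.
Proof.
move=> tT tT' [pL mp poo ZL [Zn hZn cZ]] [pL' mp' poo' ZL' [Zn' hZn' cZ'] hc].
pose h n s := ext0 t (coef phi n) s - ext0 t' (coef phi' n) s.
have hZ n : n \in J -> is_wiener_integral P (bm_beta B n) t (coef phi n) (Zn n).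
  by move=> /set_mem; exact: hZn.
have hZ' n : n \in J -> is_wiener_integral P (bm_beta B n) t' (coef phi' n) (Zn' n).
  by move=> /set_mem; exact: hZn'.
have bF n : J n -> is_fBm P H T (bm_beta B n) by exact: bm_beta_fBm.
have ZnL n : n \in J -> L (Zn n) by move=> /hZ[].
have ZnL' n : n \in J -> L (Zn' n) by move=> /hZ'[].
have DL n : n \in J -> L (fun w => Zn n w - Zn' n w) by move=> Jn; apply: L2B; auto.
have hL n : n \in J -> LT (h n).
  move=> Jn; apply: (L2B (mI T) X_sep).
    by case/andP: (tT) => _; apply: L2_ext0; exact: coef_L2.
  by case/andP: (tT') => _; apply: L2_ext0; exact: coef_L2.
have D0 n m : n \in J -> m \in J -> n <> m ->
    ip P setT (fun w => Zn n w - Zn' n w) (fun w => Zn m w - Zn' m w) = 0.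
  move=> Jn Jm nm; have Jn' := set_mem Jn; have Jm' := set_mem Jm.
  rewrite ipB//; [|exact: ZnL|exact: ZnL'|exact: DL].
  rewrite ![ip P setT _ (fun w => Zn m w - _)]ipC.
  rewrite (ipB mT X_sep (ZnL m Jm) (ZnL' m Jm) (ZnL n Jn)).
  rewrite (ipB mT X_sep (ZnL m Jm) (ZnL' m Jm) (ZnL' n Jn)).
  have mn : m <> n by move=> /esym.
  have W := wiener_ip0 X_sep bF (@bm_beta_indep _ _ _ _ _ _ _ B) Jm' Jn' mn.
  rewrite (W _ _ _ _ _ _ tT tT (hZ m Jm) (hZ n Jn)) (W _ _ _ _ _ _ tT tT' (hZ m Jm) (hZ' n Jn)).
  rewrite (W _ _ _ _ _ _ tT' tT (hZ' m Jm) (hZ n Jn)) (W _ _ _ _ _ _ tT' tT' (hZ' m Jm) (hZ' n Jn)).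
  by rewrite !subr0.
pose S k w := \sum_(0 <= n < k | n \in J) Zn n w.
pose S' k w := \sum_(0 <= n < k | n \in J) Zn' n w.
have SL k : L (S k) by apply: L2_sum.
have SL' k : L (S' k) by apply: L2_sum.
have cS : N (fun w => S k w - Z w) @[k --> \oo] --> (0 : R).
  by apply/cvg_L2normP => //; apply: nearW => k; apply: L2B.
have cS' : N (fun w => S' k w - Z' w) @[k --> \oo] --> (0 : R).
  by apply/cvg_L2normP => //; apply: nearW => k; apply: L2B.
have c1 := cvg_sqr (nrm_cvg_sub mT X_sep SL ZL SL' ZL' cS cS').
have cK : K * c @[_ --> \oo] --> K * c by exact: cvg_cst.
apply: (ler_cvg_to (c1 _) cK); apply: nearW => k.
have -> : (fun w => S k w - S' k w) =
    fun w => \sum_(n <- index_iota 0 k | n \in J) (Zn n w - Zn' n w).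
  by apply/funext => w; rewrite sumrB.
rewrite (nrm_orth_sum mT X_sep (J := mem J))//; last exact: iota_uniq.
apply: (@le_trans _ _ (K * \sum_(0 <= n < k | n \in J) NT (h n) ^+ 2)).
  rewrite mulr_sumr; apply: ler_sum => n Jn.
  apply: (wiener_le X_sep H_range T_ge0 (bF n (set_mem Jn)) tT tT' (hZ n Jn) (hZ' n Jn)).
by rewrite ler_wpM2l ?powR_ge0//; apply: (sum_nrm_le (mI T) (J := mem J)).
Qed.

Lemma fbm_integral_exists (t : R) (phi : R -> Y -> X) : 0 <= t <= T ->
  (forall s : R, 0 <= s <= t -> L20 B (phi s)) -> L20_measurable B `[0, t]%classic phi ->
  (\int[leb]_(s in `[0%R, t]) L20_norm2 B (phi s) < +oo)%E ->
  exists Z, is_fBm_integral B t phi Z.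
Proof.
move=> tT pL mp poo.
have [t0 tT'] := andP tT.
have bF n : J n -> is_fBm P H T (bm_beta B n) by exact: bm_beta_fBm.
have hL n : n \in J -> L2 leb `[0, t]%classic (coef phi n) by move=> Jn; exact: coef_L2.
have Z_ n : {Z | n \in J -> is_wiener_integral P (bm_beta B n) t (coef phi n) Z}.
  apply: cid; case: (boolP (n \in J)) => [Jn|_]; last by exists (fun=> 0).
  have [Z hZ] := wiener_exists X_sep H_range T_ge0 (bF n (set_mem Jn)) tT (hL n Jn).
  by exists Z.
pose Zn n := sval (Z_ n).
have hZ n (Jn : n \in J) : is_wiener_integral P (bm_beta B n) t (coef phi n) (Zn n).
  exact: (svalP (Z_ n)).
have ZL n : n \in J -> L (Zn n) by move=> /hZ[].
have h0L n : n \in J -> L2 leb `[0, t]%classic (fun=> 0 : X) by move=> _; exact: L2_0.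
have Z0 n m : n \in J -> m \in J -> n <> m -> ip P setT (Zn n) (Zn m) = 0.
  move=> Jn Jm nm.
  exact: (wiener_ip0 X_sep bF (@bm_beta_indep _ _ _ _ _ _ _ B) (set_mem Jn) (set_mem Jm)
    nm tT tT (hZ n Jn) (hZ m Jm)).
pose c := fine (\int[leb]_(s in `[0%R, t]) L20_norm2 B (phi s)).
have cE : (\int[leb]_(s in `[0%R, t]) L20_norm2 B (phi s) = c%:E)%E.
  by rewrite fineK// ge0_fin_numE//; apply: integral_ge0 => s _; exact: L20_norm2_ge0.
have hc : forall k, \sum_(0 <= n < k | n \in J) nrm leb `[0, t]%classic (coef phi n) ^+ 2 <= c.
  apply: (sum_nrm_le (mI t) (J := mem J)) => //; rewrite -cE.
  rewrite le_eqVlt; apply/orP; left; apply/eqP; apply: eq_integral => s _.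
  by rewrite L20_coef.
have NZ n : n \in J -> N (Zn n) ^+ 2 <= K * nrm leb `[0, t]%classic (coef phi n) ^+ 2.
  move=> Jn.
  (* The zero integrand has the integral 0, and comparison with it bounds the norm of [Zn n]
     itself. *)
  have W0 : is_wiener_integral P (bm_beta B n) t (fun=> 0 : X) (fun=> 0).
    split; [exact: L2_0|exact: L2_0|exists (fun=> [::]); split => //].
      rewrite (_ : (fun k => _) = fun=> 0%E); first exact: cvg_cst.
      apply/funext => k; rewrite (_ : _ \- _ = fun=> 0).
        by rewrite L2norm_fin ?nrm0//; exact: L2_0.
      by apply/funext => s; rewrite /= /step_fun big_nil subrr.
    rewrite (_ : (fun k => _) = fun=> 0%E); first exact: cvg_cst.
    apply/funext => k; rewrite (_ : _ \- _ = fun=> 0).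
      by rewrite L2norm_fin ?nrm0//; exact: L2_0.
    by apply/funext => s; rewrite /= /step_integral big_nil subrr.
  have := wiener_le X_sep H_range T_ge0 (bF n (set_mem Jn)) tT tT (hZ n Jn) W0.
  rewrite (_ : (fun w => Zn n w - 0) = Zn n); last by apply/funext => w; rewrite subr0.
  move=> /le_trans; apply; rewrite ler_wpM2l ?powR_ge0//.
  rewrite le_eqVlt; apply/orP; left; apply/eqP; congr (_ ^+ 2).
  rewrite /nrm !L2normE -(int_ext0 _ tT'); congr (fine (_ `^ _)); apply: eq_integral => s _.
  by rewrite /ext0; case: ifP; rewrite subr0.
have K0 : 0 <= K by exact: powR_ge0.
have NZC k : \sum_(0 <= n < k | n \in J) N (Zn n) ^+ 2 <= K * c.
  apply: (@le_trans _ _ (K * \sum_(0 <= n < k | n \in J) nrm leb `[0, t]%classic (coef phi n) ^+ 2)).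
    by rewrite mulr_sumr; apply: ler_sum => n Jn; exact: NZ.
  by rewrite ler_wpM2l.
pose S k w := \sum_(0 <= n < k | n \in J) Zn n w.
have SL k : L (S k) by apply: L2_sum.
(* By orthogonality the blocks of the random series have the size of blocks of a convergent
   numerical series. *)
have SE m k : (m <= k)%N ->
    N (fun w => S k w - S m w) ^+ 2 = \sum_(m <= n < k | n \in J) N (Zn n) ^+ 2.
  move=> mk; rewrite -(nrm_orth_sum mT X_sep (J := mem J) (iota_uniq _ _) ZL Z0).
  congr (nrm _ _ _ ^+ 2); apply/funext => w.
  by rewrite /S (big_cat_nat _ mk)//= addrAC subrr add0r.
have [Z ZL' hcZ] : exists2 Z, L Z & N (fun w => S k w - Z w) @[k --> \oo] --> (0 : R).
  apply: L2P_complete => // e e0.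
  have e2 : 0 < e ^+ 2 by exact: exprn_gt0.
  have [K1 hK] := nneg_sum_cauchy (fun n _ => sqr_ge0 (N (Zn n))) NZC e2.
  have hK' m k : (K1 <= m)%N -> (m <= k)%N -> N (fun w => S k w - S m w) <= e.
    move=> Km mk; rewrite -ler_sqr ?nnegrE ?nrm_ge0//; last exact: ltW.
    by rewrite SE//; exact: hK.
  exists K1 => n m Kn Km; case/orP: (leq_total n m) => nm; last exact: hK'.
  by rewrite nrmB; exact: hK'.
exists Z; split => //; exists Zn.
  by move=> n /mem_set; exact: hZ.
apply: (proj2 (cvg_L2normP _)) hcZ; apply: nearW => k; exact: (L2B mT X_sep (SL k) ZL').
Qed.

End FbmIntegral.

(** * Convolutions with an evolution family *)

Section Weight.
Context (R : realType).
Local Notation leb := (@lebesgue_measure R).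

Lemma leb_itv_cc (a b : R) : a <= b -> leb `[a, b]%classic = (b - a)%:E.
Proof.
move=> ab; rewrite lebesgue_measure_itv/= lte_fin; case: ltP => // ba.
by rewrite (_ : a = b) ?subrr//; apply/eqP; rewrite eq_le ab ba.
Qed.

(** Shape of the majorant in [U_ext_le]: small everywhere except on a short window around the time
    considered, where the operators are compared only through their bound [M]. *)
Definition weight (eps c a b s : R) : R := eps + c * \1_(`[a, b]%classic) s.

Lemma measurable_weight (eps c a b : R) (D : set (measurableTypeR R)) :
  measurable_fun D (weight eps c a b).
Proof.
apply: measurable_funD; first exact: measurable_cst.
apply: measurable_funM; first exact: measurable_cst.
apply: (measurable_indic _ : measurable_fun D _).
exact: (measurable_itv `[a, b]).
Qed.

Lemma weight_int (T eps c a b : R) : 0 <= T -> 0 <= eps -> 0 <= c -> a <= b ->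
  (\int[leb]_(s in `[0%R, T]) (weight eps c a b s)%:E <= (eps * T + c * (b - a))%:E)%E.
Proof.
move=> T0 e0 c0 ab.
have mD : measurable (`[0, T]%classic : set (measurableTypeR R)) by exact: measurable_itv.
have mA : measurable (`[a, b]%classic : set (measurableTypeR R)) by exact: measurable_itv.
have mi : measurable_fun (`[0, T]%classic : set (measurableTypeR R)) (fun s : R => (\1_(`[a, b]%classic) s : R)%:E).
  by apply/measurable_EFinP; exact: (measurable_indic mA).
have -> : (\int[leb]_(s in `[0%R, T]) (weight eps c a b s)%:E =
    \int[leb]_(s in `[0%R, T]) (eps%:E + c%:E * (\1_(`[a, b]%classic) s : R)%:E))%E.
  by apply: eq_integral => s _; rewrite /weight EFinD EFinM.
rewrite ge0_integralD//; last 2 first.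
  by move=> s _; rewrite mule_ge0// lee_fin.
  exact: measurable_funeM.
rewrite ge0_integralZl_EFin// integral_indic// EFinD; apply: leeD.
  rewrite [X in (X <= _)%E](_ : _ = eps%:E * leb `[0%R, T]%classic)%E.
    by rewrite leb_itv_cc// subr0 EFinM.
  exact: integral_cst.
rewrite EFinM lee_wpmul2l//.
rewrite -leb_itv_cc//; apply: le_measure; rewrite ?inE//; exact: measurableI.
Qed.

End Weight.

Section EvolutionExt.
Context (R : realType) (X : hilbertType R).
Context (T M : R) (A : R -> operator X) (U : R -> R -> X -> X).
Hypotheses (T_ge0 : 0 <= T) (U_gen : generates T A U) (M_ge0 : 0 <= M).
Hypothesis U_M : forall t s : R, 0 <= s -> s <= t -> t <= T ->
  (normL (U t s) <= M%:E)%E.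
Local Notation leb := (@lebesgue_measure R).

(* For s < t - d, [U t' s - U t s = (U t' (t - d) - U t (t - d)) (U (t - d) s)],
   so that norm continuity off the diagonal gives a bound uniform in s. *)
Lemma U_ext_le (t e : R) : 0 <= t <= T -> 0 < e ->
  exists dl : R, 0 < dl /\ exists G : R -> R,
  [/\ measurable_fun (`[0, T]%classic : set (measurableTypeR R)) G,
      forall s, 0 <= G s <= 1 + 2 * M,
      (\int[leb]_(s in `[0%R, T]) (G s)%:E <= e%:E)%E &
      forall t' s x, 0 <= t' <= T -> `|t' - t| < dl -> 0 <= s <= T ->
        `|ext0 t' (fun s => U t' s (x s)) s - ext0 t (fun s => U t s (x s)) s| <=
        G s * `|x s|].
Proof.
move=> /andP[t0 tT] e0.
have T0 := T_ge0; have M0 := M_ge0.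
have M1 : 0 < M + 1 by lra.
have T1 : 0 < T + 1 by lra.
(* The window of length [2 d] and height [2 M] contributes at most [e / 2]. The level [eps]
   contributes [eps * T <= e / 2] and is at most 1 for the uniform bound on [G]; [eps'] compensates
   the factor [M] of the operator from [s] to [t - d]. *)
pose d := e / (8 * (M + 1)); have d0 : 0 < d by rewrite divr_gt0// mulr_gt0.
pose eps := Num.min 1 (e / (2 * (T + 1))).
have eps0 : 0 < eps by rewrite lt_min ltr01 divr_gt0// mulr_gt0.
pose eps' := eps / (M + 1); have eps'0 : 0 < eps' by rewrite divr_gt0.
have [dl [dl0 dld Hdl]] : exists dl : R, [/\ 0 < dl, dl <= d &
    forall t', 0 <= t' <= T -> `|t' - t| < dl -> 0 <= t - d ->
    forall x, `|U t' (t - d) x - U t (t - d) x| <= eps' * `|x|].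
  (* If [t < d] there is no [s] with [0 <= s < t - d], so the radius [d] does. *)
  have [td|td] := lerP 0 (t - d); last first.
    by exists d; split => // t' _ _; rewrite leNgt td.
  have std : 0 <= t - d < t by rewrite td gtrBl.
  have [dl dl0 Hdl] := U_norm_cvg U_gen std tT eps'0.
  exists (Num.min d dl); split; first by rewrite lt_min d0.
    by rewrite ge_min lexx.
  move=> t' /andP[t'0 t'T] tt' _ x; move: tt'; rewrite lt_min => /andP[t1 t2].
  apply: Hdl => //; rewrite ?subrr ?normr0//; last by rewrite distrC.
  by rewrite td /=; move: t1; rewrite ltr_norml; lra.
exists dl; split => //; exists (weight eps (2 * M) (t - d) (t + d)); split.
- exact: measurable_weight.
- move=> s; rewrite /weight indicE.
  have e1 : eps <= 1 by rewrite /eps ge_min lexx.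
  by case: (_ \in _); rewrite ?mulr1 ?mulr0; lra.
- apply: le_trans (weight_int T_ge0 (ltW eps0) _ _) _; [lra|lra|].
  rewrite lee_fin [leRHS](splitr e); apply: lerD.
    apply: (@le_trans _ _ (e / (2 * (T + 1)) * (T + 1))).
      apply: ler_pM => //; [exact: ltW|by rewrite /eps ge_min lexx orbT|lra].
    by rewrite le_eqVlt; apply/orP; left; apply/eqP; field; rewrite gt_eqF.
  apply: (@le_trans _ _ (2 * (M + 1) * (2 * d))).
    by apply: ler_pM; lra.
  by rewrite le_eqVlt; apply/orP; left; apply/eqP; rewrite /d; field; rewrite gt_eqF.
move=> t' s x /andP[t'0 t'T] tt' /andP[s0 sT].
have x0 : 0 <= `|x s| by [].
have extM v : 0 <= v <= T -> `|ext0 v (fun s => U v s (x s)) s| <= M * `|x s|.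
  move=> /andP[v0 vT]; rewrite /ext0; case: ifP => sv; first exact: (U_le U_gen U_M).
  by rewrite normr0 mulr_ge0.
rewrite /weight indicE; have [sin|sout] := boolP (s \in `[t - d, t + d]%classic).
  rewrite mulr1; apply: (@le_trans _ _ (M * `|x s| + M * `|x s|)).
    apply: le_trans (ler_normB _ _) _; apply: lerD; apply: extM; first by rewrite t'0.
    by rewrite t0.
  have := mulr_ge0 (ltW eps0) x0; lra.
rewrite mulr0 addr0.
(* Outside the window [s] lies on the same side of [t] and [t'], because [dl <= d]: to the right
   both extensions vanish, to the left both operators factor through the time [t - d]. *)
have [ts|st] := ltP t s.
  have tds : t + d < s.
    by move: sout; rewrite mem_setE in_itv /= ; case: (lerP s (t + d)) => //; lra.
  have t's : t' < s by move: tt'; rewrite ltr_norml; lra.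
  rewrite /ext0 (leNgt s t') t's (leNgt s t) ts /= subrr normr0.
  exact: mulr_ge0 (ltW eps0) x0.
have std : s < t - d.
  by move: sout; rewrite mem_setE in_itv /=; case: (lerP (t - d) s) => //; lra.
have dt' : t - d <= t' by move: tt'; rewrite ltr_norml; lra.
have td0 : 0 <= t - d by lra.
rewrite /ext0 st ifT; last by lra.
rewrite -(U_comp U_gen (t := t') (s := t - d))//; [|lra].
rewrite -(U_comp U_gen (t := t) (s := t - d))//; [|lra|lra].
apply: le_trans (Hdl t' _ tt' td0 _) _; first by rewrite t'0.
apply: (@le_trans _ _ (eps' * (M * `|x s|))).
  by rewrite ler_wpM2l ?(ltW eps'0)//; apply: (U_le U_gen U_M) => //; lra.
rewrite mulrA ler_wpM2r// /eps' mulrAC ler_pdivrMr//.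
by rewrite ler_wpM2l ?(ltW eps0)//; lra.
Qed.

End EvolutionExt.

Section BochnerExt.
Context (R : realType) (d : measure_display) (Omega : measurableType d).
Context (P : probability Omega R) (X : hilbertType R) (X_sep : separable X).

Local Notation N := (nrm P setT).
Local Notation L := (L2 P setT).
Local Notation leb := (@lebesgue_measure R).
Let mT : measurable [set: Omega] := measurableT.

(** The sets of the simple functions lie in [[0, t]], so the same simple functions serve on
    [[0, T]]. *)
Lemma bochner_ext (t T : R) (Phi : R -> Omega -> X) (Z : Omega -> X) : 0 <= t <= T ->
  is_bochner_integral P t Phi Z ->
  is_bochner_integral P T (fun s w => ext0 t (Phi^~ w) s) Z.
Proof.
move=> /andP[t0 tT] [PL ZL [m [E [V [EV ae1 int1 lim1]]]]].
have simple0 k s : t < s -> (fun w => \sum_(i < m k) \1_(E k i) s *: V k i w) = fun=> 0.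
  move=> ts; apply/funext => w; rewrite big1// => i _.
  rewrite indicE memNset ?scale0r// => Es; have [_ Et _] := EV k i.
  by have := Et _ Es; rewrite /= in_itv /= => /andP[_]; rewrite leNgt ts.
have zero k s : t < s ->
    L2norm P setT ((fun w => \sum_(i < m k) \1_(E k i) s *: V k i w) \-
      (fun w => ext0 t (Phi^~ w) s)) = 0%E.
  move=> ts; rewrite simple0// (_ : _ \- _ = fun=> 0).
    by rewrite L2norm_fin ?nrm0//; exact: L2_0.
  by apply/funext => w /=; rewrite /ext0 leNgt ts /= subrr.
have same k s : s <= t ->
    L2norm P setT ((fun w => \sum_(i < m k) \1_(E k i) s *: V k i w) \-
      (fun w => ext0 t (Phi^~ w) s)) =
    L2norm P setT ((fun w => \sum_(i < m k) \1_(E k i) s *: V k i w) \- Phi s).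
  by move=> st; congr L2norm; apply/funext => w /=; rewrite /ext0 st.
split => //.
  move=> s /andP[s0 sT]; case: (lerP s t) => st.
    rewrite (_ : (fun w => _) = Phi s); first by apply: PL; rewrite s0.
    by apply/funext => w; rewrite /ext0 st.
  rewrite (_ : (fun w => _) = fun=> 0); first exact: L2_0.
  by apply/funext => w; rewrite /ext0 leNgt st.
exists m, E, V; split => //.
- move=> k i; have [mE Et VL] := EV k i; split => // s /Et /=.
  by rewrite !in_itv /= => /andP[-> st]; exact: le_trans tT.
- have [S [mS S0 HS]] := ae1; exists S; split => // s ns; apply: HS => /= Hs; apply: ns => /=.
  move=> /andP[s0 sT]; case: (lerP s t) => st.
    rewrite (_ : (fun k => _) = (fun k => L2norm P setT
      ((fun w => \sum_(i < m k) \1_(E k i) s *: V k i w) \- Phi s))).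
      by apply: Hs; rewrite s0.
    by apply/funext => k; rewrite same.
  by rewrite (_ : (fun k => _) = fun=> 0%E); [exact: cvg_cst|apply/funext => k; rewrite zero].
- rewrite (_ : (fun k => _) = (fun k => \int[leb]_(s in `[0%R, t])
     L2norm P setT ((fun w => \sum_(i < m k) \1_(E k i) s *: V k i w) \- Phi s)%R)%E) //.
  apply/funext => k; rewrite [LHS]integral_mkcond [RHS]integral_mkcond.
  apply: eq_integral => s _; rewrite /patch !mem_setE !in_itv/=.
  have [st|st] := leP s t; first by rewrite (le_trans st tT); case: ifP => // _; rewrite same.
  by rewrite andbF; case: ifP => // _; rewrite zero.
Qed.

Lemma bochner_ext_le (t t' T : R) (Phi Phi' : R -> Omega -> X) (Z Z' : Omega -> X)
    (G : R -> R) : 0 <= t <= T -> 0 <= t' <= T ->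
  is_bochner_integral P t Phi Z -> is_bochner_integral P t' Phi' Z' ->
  measurable_fun (`[0, T]%classic : set (measurableTypeR R)) G ->
  (forall s, 0 <= s <= T ->
     N (fun w => ext0 t (Phi^~ w) s - ext0 t' (Phi'^~ w) s) <= G s) ->
  ((N (fun w => Z w - Z' w))%:E <= \int[leb]_(s in `[0%R, T]) (G s)%:E)%E.
Proof.
by move=> tT tT' /(bochner_ext tT) bZ /(bochner_ext tT') bZ'; exact: bochner_le.
Qed.

End BochnerExt.

Section BochnerEvolution.
Context (R : realType) (d : measure_display) (Omega : measurableType d).
Context (P : probability Omega R) (X : hilbertType R) (X_sep : separable X).
Context (T M : R) (A : R -> operator X) (U : R -> R -> X -> X).
Hypotheses (T_ge0 : 0 <= T) (U_gen : generates T A U) (M_ge0 : 0 <= M).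
Hypothesis U_M : forall t s : R, 0 <= s -> s <= t -> t <= T ->
  (normL (U t s) <= M%:E)%E.

Local Notation N := (nrm P setT).
Local Notation L := (L2 P setT).
Local Notation leb := (@lebesgue_measure R).
Let mT : measurable [set: Omega] := measurableT.

Lemma cvg_within_itv (a b t : R) (u : R -> R) :
  (forall e, 0 < e -> exists2 dl, 0 < dl & forall t', a <= t' <= b ->
     `|t' - t| < dl -> `|u t'| <= e) ->
  u s @[s --> within `[a, b] (nbhs t)] --> (0 : R).
Proof.
move=> H; apply/cvgrPdist_le => e e0; have [dl dl0 Hdl] := H e e0.
rewrite near_withinE; apply/nbhs_ballP; exists dl => // s; rewrite -ball_normE /= => ts.
by rewrite in_itv /= => sab; rewrite sub0r normrN; apply: Hdl => //; rewrite distrC.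
Qed.

(** Only the operator depends on the upper limit. A bound on [a] is therefore enough, without
    continuity in time: the majorant of [U_ext_le] multiplied by [C] has a small integral. *)
Lemma bochner_U_cvg (t C : R) (a : R -> Omega -> X) (I : R -> Omega -> X) :
  0 <= t <= T -> (forall s, 0 <= s <= T -> L (a s)) -> (forall s, 0 <= s <= T -> N (a s) <= C) ->
  (forall t, 0 <= t <= T -> is_bochner_integral P t (fun s w => U t s (a s w)) (I t)) ->
  N (fun w => I t' w - I t w) @[t' --> within `[0, T] (nbhs t)] --> (0 : R).
Proof.
move=> tT aL aC HI; have C0 : 0 <= C.
  by apply: le_trans (aC t tT); exact: nrm_ge0.
apply: cvg_within_itv => e e0; have C1 : 0 < C + 1 by rewrite ltr_wpDl.
have e1 : 0 < e / (C + 1) by rewrite divr_gt0.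
have [dl [dl0 [G [mG G_bnd intG HG]]]] := U_ext_le T_ge0 U_gen M_ge0 U_M tT e1.
exists dl => // t' tT' tt'; rewrite ger0_norm ?nrm_ge0// -lee_fin.
have mCG : measurable_fun (`[0, T]%classic : set (measurableTypeR R)) (fun s => C * G s).
  by apply: measurable_funM => //; exact: measurable_cst.
apply: le_trans (bochner_ext_le X_sep tT' tT (HI t' tT') (HI t tT) mCG _) _.
  move=> s sT; have [G0 _] := andP (G_bnd s).
  have extL v : 0 <= v <= T -> L (fun w => ext0 v (fun s => U v s (a s w)) s).
    move=> /andP[v0 vT]; have [s0 sT'] := andP sT; rewrite /ext0; case: (leP s v) => sv; last exact: L2_0.
    by have [] := U_L2 U_gen M_ge0 U_M s0 sv vT (aL s sT).
  have [_] := @L2_dom _ _ _ P setT mT _ _ (fun w => ext0 t' (fun s => U t' s (a s w)) s -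
     ext0 t (fun s => U t s (a s w)) s) (a s) (G s) G0
     (proj1 (L2B mT X_sep (extL t' tT') (extL t tT))) (aL s sT)
     (fun w _ => HG t' s (a^~ w) tT' tt' sT).
  move=> /le_trans; apply; rewrite mulrC ler_wpM2r//; exact: aC.
have mI : measurable (`[0, T]%classic : set (measurableTypeR R)) by exact: measurable_itv.
have -> : (\int[leb]_(s in `[0%R, T]) (C * G s)%:E =
    C%:E * \int[leb]_(s in `[0%R, T]) (G s)%:E)%E.
  transitivity (\int[leb]_(s in `[0%R, T]) (C%:E * (G s)%:E))%E.
    by apply: eq_integral => s _; rewrite EFinM.
  apply: ge0_integralZl_EFin => //; last exact/measurable_EFinP.
  by move=> s _; rewrite lee_fin; case/andP: (G_bnd s).
apply: (@le_trans _ _ (C%:E * (e / (C + 1))%:E)%E).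
  by rewrite lee_wpmul2l.
rewrite lee_fin mulrA ler_pdivrMr// mulrC ler_wpM2l ?(ltW e0)//.
by rewrite lerDl.
Qed.

End BochnerEvolution.

Lemma sum_sqr_le (R : realType) (V W : normedModType R) (J : pred nat) (h : nat -> V)
    (k : nat -> W) (c : R) : (forall n, J n -> `|h n| <= c * `|k n|) ->
  (\sum_(n <oo | J n) (`|h n| ^+ 2)%:E <= (c ^+ 2)%:E * \sum_(n <oo | J n) (`|k n| ^+ 2)%:E)%E.
Proof.
move=> hk; rewrite -nneseriesZl; last by move=> n _; rewrite lee_fin sqr_ge0.
apply: lee_nneseries => [n _ _|n Jn]; first by rewrite lee_fin sqr_ge0.
have h0 : 0 <= `|h n| by [].
by rewrite -EFinM lee_fin -exprMn ler_sqr ?nnegrE ?hk// (le_trans h0)// hk.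
Qed.

(** * The stochastic convolution *)

Section FbmEvolution.
Context (R : realType) (d : measure_display) (Omega : measurableType d).
Context (P : probability Omega R) (X Y : hilbertType R) (X_sep : separable X).
Context (H T M : R) (H_range : 2^-1 < H < 1) (T_ge0 : 0 <= T) (B : QfBm P Y H T).
Context (A : R -> operator X) (U : R -> R -> X -> X).
Hypotheses (U_gen : generates T A U) (M_ge0 : 0 <= M).
Hypothesis U_M : forall t s : R, 0 <= s -> s <= t -> t <= T ->
  (normL (U t s) <= M%:E)%E.
Context (sigma : R -> Y -> X) (K : R).
Hypotheses (sigma_L20 : forall t : R, 0 <= t <= T -> L20 B (sigma t))
  (sigma_meas : L20_measurable B `[0, T]%classic sigma)
  (sigma_le : forall t : R, 0 <= t <= T -> (L20_norm2 B (sigma t) <= K%:E)%E).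

Local Notation N := (nrm P setT).
Local Notation L := (L2 P setT).
Local Notation leb := (@lebesgue_measure R).
Local Notation J := (bm_idx B).
Let mT : measurable [set: Omega] := measurableT.
Let mI (t : R) : measurable (`[0, t]%classic : set (measurableTypeR R)).
Proof. exact: measurable_itv. Qed.

Let coefU (t s : R) (n : nat) : 0 <= s -> s <= t -> t <= T ->
  coef B (fun s y => U t s (sigma s y)) n s = U t s (coef B sigma n s).
Proof. by move=> s0 st tT; rewrite /coef (linear_funZ (U_lin U_gen s0 st tT)). Qed.

(** For a fixed vector the map is continuous on [[0, t[] by norm continuity off the diagonal, and
    the endpoint is a single point; the argument [h] enters through [borel_caratheodory]. *)
Lemma U_borel (t : R) (h : R -> X) : 0 <= t <= T ->
  borel_fun (`[0, t]%classic : set (measurableTypeR R)) h ->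
  borel_fun (`[0, t]%classic : set (measurableTypeR R)) (fun s => U t s (h s)).
Proof.
move=> /andP[t0 tT] mh.
apply: (borel_caratheodory (mI t) X_sep X_sep (F := fun s x => U t s x)) => //; last first.
  move=> s; rewrite /= in_itv /= => /andP[s0 st].
  apply: (@lip_continuous _ _ _ _ M) => x y.
  rewrite -(linear_funB (U_lin U_gen s0 st tT)); exact: (U_le U_gen U_M).
move=> x; apply: (borel_ball X_sep (mI t)) => y.
have mo : measurable (`[0, t[%classic : set (measurableTypeR R)) by exact: measurable_itv.
have -> : (`[0, t]%classic : set (measurableTypeR R)) = `[0, t[%classic `|` [set t].
  apply/seteqP; split => s /=; rewrite !in_itv /=.
    by move=> /andP[s0]; rewrite le_eqVlt => /orP[/eqP ->|st]; [right|left; rewrite s0].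
  by case=> [/andP[-> /ltW]//|->]; rewrite t0 lexx.
apply/measurable_funU => //; split; last exact: measurable_fun_set1.
apply: subspace_continuous_measurable_fun => //; apply/subspace_continuousP => s.
rewrite /= in_itv /= => /andP[s0 st]; apply: cvg_norm; apply: cvgB; last exact: cvg_cst.
apply/cvgrPdist_le => e e0; have x1 : 0 < `|x| + 1 by rewrite ltr_wpDl.
have e1 : 0 < e / (`|x| + 1) by rewrite divr_gt0.
have st0 : 0 <= s < t by rewrite s0.
have [dl dl0 Hdl] := U_norm_cvg U_gen st0 tT e1.
rewrite near_withinE; apply/nbhs_ballP; exists dl => // s'; rewrite -ball_normE /= => ss'.
rewrite in_itv /= => st'; rewrite distrC.
apply: (le_trans (Hdl t s' st' tT _ ss' x)); first by rewrite subrr normr0.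
by rewrite mulrAC ler_pdivrMr// ler_wpM2l ?(ltW e0)// lerDl.
Qed.

Let UsigmaL20 (t s : R) : 0 <= s -> s <= t -> t <= T ->
  L20 B (fun y => U t s (sigma s y)) /\
  (L20_norm2 B (fun y => U t s (sigma s y)) <= (M ^+ 2 * K)%:E)%E.
Proof.
move=> s0 st tT; have sT : 0 <= s <= T by rewrite s0 (le_trans st).
have [[slin soo] sK] := sigma_L20 sT.
have Ule (x : X) : `|U t s x| <= M * `|x| by apply: (U_le U_gen U_M).
have le2 : (L20_norm2 B (fun y => U t s (sigma s y)) <= (M ^+ 2 * K)%:E)%E.
  apply: (@le_trans _ _ ((M ^+ 2)%:E * L20_norm2 B (sigma s))%E).
    rewrite (L20_coef B (fun s y => U t s (sigma s y)) s) L20_coef.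
    by apply: sum_sqr_le => n _; rewrite coefU.
  by rewrite [leRHS]EFinM lee_wpmul2l ?lee_fin ?sqr_ge0// sigma_le.
split => //; split; last by apply: le_lt_trans le2 _; rewrite ltry.
split; first by move=> a x y /=; rewrite slin (U_lin U_gen s0 st tT).
have [c sc] : exists c : R, (normL (sigma s) <= c%:E)%E.
  case: (normL (sigma s)) soo => [c _|//|_]; first by exists c.
  by exists 0; rewrite leNye.
apply: (@le_lt_trans _ _ (M * c)%:E); last by rewrite ltry.
apply: ub_ereal_sup => _ [y /= y1 <-]; rewrite lee_fin.
apply: le_trans (Ule _) _; rewrite ler_wpM2l//.
rewrite -lee_fin; apply: le_trans sc; apply: ereal_sup_ubound; by exists y.
Qed.


Let Usigma_meas (t : R) : 0 <= t <= T ->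
  L20_measurable B `[0, t]%classic (fun s y => U t s (sigma s y)).
Proof.
move=> tT n Jn; apply: U_borel => //.
have := sigma_meas Jn; apply: measurable_funS; first exact: mI.
by move=> s; rewrite /= !in_itv /= => /andP[-> /le_trans]; apply; case/andP: tT.
Qed.

Lemma fbm_U_exists (t : R) : 0 <= t <= T ->
  exists Z, is_fBm_integral B t (fun s y => U t s (sigma s y)) Z.
Proof.
move=> tT; have [t0 tT'] := andP tT; apply: fbm_integral_exists => //.
- by move=> s /andP[s0 st]; have [] := UsigmaL20 s0 st tT'.
- exact: Usigma_meas.
have M2K : (0 <= (M ^+ 2 * K)%:E)%E.
  have H0 : 0 <= (0 : R) by [].
  have [_] := UsigmaL20 H0 t0 tT'; apply: le_trans; exact: L20_norm2_ge0.
apply: (@le_lt_trans _ _ (\int[leb]_(s in `[0%R, t]) cst (M ^+ 2 * K)%:E s)%E).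
  apply: ge0_le_integral; [exact: mI|by move=> s _; exact: L20_norm2_ge0| | |].
  - rewrite (_ : (fun s => _) = fun s => (\sum_(n <oo | n \in J)
      (`|coef B (fun s y => U t s (sigma s y)) n s| ^+ 2)%:E)%E); last first.
      by apply/funext => s; rewrite -L20_coef.
    apply: (ge0_emeasurable_sum (P := mem J)) => [m s _ _|m Jm].
      by rewrite lee_fin sqr_ge0.
    apply/measurable_EFinP; apply: borel_sqr; first exact: mI.
    apply: (borelZ (mI t) X_sep); first exact: measurable_cst.
    exact: Usigma_meas (set_mem Jm).
  - exact: measurable_cst.
  - by move=> s; rewrite /= in_itv /= => /andP[s0 st]; have [] := UsigmaL20 s0 st tT'.
rewrite integral_cst; last exact: mI.
have fin : ((M ^+ 2 * K)%:E * leb `[0%R, t]%classic < +oo)%E.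
  by rewrite leb_itv_cc// subr0 -EFinM ltry.
exact: fin.
Qed.

Lemma fbm_U_cvg (t : R) (Z : R -> Omega -> X) : 0 <= t <= T ->
  (forall t, 0 <= t <= T -> is_fBm_integral B t (fun s y => U t s (sigma s y)) (Z t)) ->
  N (fun w => Z t' w - Z t w) @[t' --> within `[0, T] (nbhs t)] --> (0 : R).
Proof.
move=> tT HZ; have K0 : 0 <= K.
  by rewrite -lee_fin; apply: le_trans (sigma_le tT); exact: L20_norm2_ge0.
apply: cvg_within_itv => e e0; have M0 := M_ge0.
(* The added 1 makes [q] positive; the final estimate is then [(q - 1) * (e ^ 2 / q) <= e ^ 2]. *)
pose q := (T + 1) `^ (2 * H) * ((1 + 2 * M) * K) + 1.
have q0 : 0 < q by rewrite ltr_wpDl// !mulr_ge0// ?powR_ge0//; lra.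
have e1 : 0 < e ^+ 2 / q by rewrite divr_gt0// exprn_gt0.
have [dl [dl0 [G [mG G_bnd intG HG]]]] := U_ext_le T_ge0 U_gen M_ge0 U_M tT e1.
exists dl => // t' tT' tt'; rewrite ger0_norm ?nrm_ge0//.
rewrite -ler_sqr ?nnegrE ?nrm_ge0//; last exact: ltW.
pose h n s := ext0 t' (coef B (fun s y => U t' s (sigma s y)) n) s -
  ext0 t (coef B (fun s y => U t s (sigma s y)) n) s.
have mh n : n \in J -> borel_fun (`[0, T]%classic : set (measurableTypeR R)) (h n).
  move=> Jn; apply: (borelB (mI T) X_sep).
    case/andP: (tT') => _; apply: borel_ext0; apply: (borelZ (mI t') X_sep); first exact: measurable_cst.
    exact: Usigma_meas (set_mem Jn).
  case/andP: (tT) => _; apply: borel_ext0; apply: (borelZ (mI t) X_sep); first exact: measurable_cst.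
  exact: Usigma_meas (set_mem Jn).
have hG n s : 0 <= s <= T -> `|h n s| <= G s * `|coef B sigma n s|.
  move=> sT; apply: le_trans (HG t' s (coef B sigma n) tT' tt' sT).
  rewrite le_eqVlt; apply/orP; left; apply/eqP; congr `|_|; rewrite /h /ext0.
  have [s0 _] := andP sT; have [_ tT1] := andP tT; have [_ tT2] := andP tT'.
  by congr (_ - _); [case: (leP s t')|case: (leP s t)] => // sv; rewrite coefU.
have := fbm_integral_le X_sep H_range T_ge0 (c := (1 + 2 * M) * K * (e ^+ 2 / q)) tT' tT
  (HZ t' tT') (HZ t tT); move=> /(_ _)/le_trans; apply; last first.
  have qE : (T + 1) `^ (2 * H) * ((1 + 2 * M) * K) = q - 1 by rewrite /q addrK.
  rewrite mulrA qE mulrA ler_pdivrMr// mulrC ler_wpM2l ?sqr_ge0//.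
  by rewrite gerBl.
have c0 : 0 <= (1 + 2 * M) * K by rewrite mulr_ge0//; lra.
apply: (@le_trans _ _ (\int[leb]_(s in `[0%R, T]) (((1 + 2 * M) * K)%:E * (G s)%:E))%E).
  apply: ge0_le_integral; first exact: mI.
  - by move=> s _; apply: nneseries_ge0 => n _ _; rewrite lee_fin sqr_ge0.
  - apply: (ge0_emeasurable_sum (P := mem J)) => [m s _ _|m Jm].
      by rewrite lee_fin sqr_ge0.
    by apply/measurable_EFinP; apply: borel_sqr; [exact: mI|exact: mh].
  - by apply: measurable_funeM; apply/measurable_EFinP.
  move=> s; rewrite /= in_itv /= => sT; have [G0 GM] := andP (G_bnd s).
  apply: le_trans (sum_sqr_le (J := mem J) (fun n _ => hG n s sT)) _.
  apply: (@le_trans _ _ ((G s ^+ 2)%:E * K%:E)%E).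
    by rewrite lee_wpmul2l ?lee_fin ?sqr_ge0// -L20_coef sigma_le.
  (* [G] enters squared; since [G <= 1 + 2 M], its square is at most [(1 + 2 M) G], whose integral
     is small. *)
  rewrite -!EFinM lee_fin [leRHS]mulrAC ler_wpM2r// expr2 ler_wpM2r//.
have -> : (\int[leb]_(s in `[0%R, T]) (((1 + 2 * M) * K)%:E * (G s)%:E) =
    ((1 + 2 * M) * K)%:E * \int[leb]_(s in `[0%R, T]) (G s)%:E)%E.
  apply: ge0_integralZl_EFin => //; last exact/measurable_EFinP.
  by move=> s _; rewrite lee_fin; case/andP: (G_bnd s).
by rewrite [leRHS]EFinM lee_wpmul2l// lee_fin.
Qed.

End FbmEvolution.

(** * Mild solutions *)

Section SuperpositionCont.
Context (R : realType) (d : measure_display) (Omega : measurableType d).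
Context (P : probability Omega R) (X : hilbertType R) (X_sep : separable X).

Local Notation N := (nrm P setT).
Local Notation L := (L2 P setT).
Let mT : measurable [set: Omega] := measurableT.

Lemma cvg_within_itvP (a b t : R) (u : R -> R) :
  u s @[s --> within `[a, b] (nbhs t)] --> (0 : R) <->
  (forall e, 0 < e -> exists2 dl, 0 < dl & forall t', a <= t' <= b ->
     `|t' - t| < dl -> `|u t'| <= e).
Proof.
split => [+ e e0|]; last exact: cvg_within_itv.
move=> /cvgrPdist_le/(_ _ e0); rewrite near_withinE => /nbhs_ballP[dl /= dl0 H].
exists dl => // t' abt tt'; have := H t'; rewrite -ball_normE /= in_itv /= sub0r normrN.
by apply => //; rewrite distrC.
Qed.

(** Passage to sequences for the sake of dominated convergence: otherwise points within
    [1 / (n + 1)] of [t] that violate a fixed bound would form a forbidden sequence. *)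
Lemma cvg_within_seq (a b t : R) (u : R -> R) :
  (forall s : nat -> R, (forall n, a <= s n <= b) -> s n @[n --> \oo] --> t ->
     u (s n) @[n --> \oo] --> (0 : R)) ->
  u s @[s --> within `[a, b] (nbhs t)] --> (0 : R).
Proof.
move=> H; apply: cvg_within_itv => e e0; apply: contrapT => /forall2NP no.
have s_ n : {s | [/\ a <= s <= b, `|s - t| < n.+1%:R^-1 & e < `|u s|]}.
  apply: cid; have [n0|] := no n.+1%:R^-1; first by exfalso; apply: n0; rewrite invr_gt0.
  move=> /existsNP[s] /not_implyP[sab] /not_implyP[st] /negP; rewrite -ltNge => us.
  by exists s.
have := H (fun n => sval (s_ n)) (fun n => ltac:(by have [] := svalP (s_ n))).
have st : sval (s_ n) @[n --> \oo] --> t.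
  apply/(cvg_norm_sub0 (X := R^o)); apply: (cvg0_le _ (@cvg_harmonic R)).
  by apply: nearW => n; rewrite normr_ge0/= ltW//; have [] := svalP (s_ n).
move=> /(_ st)/cvgrPdist_lt/(_ _ e0)[n _ /(_ n (leqnn n))] /=.
by rewrite sub0r normrN ltNge ltW//; have [] := svalP (s_ n).
Qed.

Lemma L2_growth (F : X -> X) (C : R) (V : Omega -> X) : 0 <= C -> continuous F ->
  (forall x, `|F x| ^+ 2 <= C * (1 + `|x| ^+ 2)) -> L V ->
  L (fun w => F (V w)) /\ N (fun w => F (V w)) <= Num.sqrt (C * (1 + N V ^+ 2)).
Proof.
move=> C0 Fc FC VL; have mV := proj1 VL.
have CN : 0 <= C * (1 + N V ^+ 2) by rewrite mulr_ge0// addr_ge0// sqr_ge0.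
apply: (@L2_le _ _ _ P setT mT _ (fun w => F (V w)) (fun w => C * (1 + `|V w| ^+ 2))) => //.
- exact: (borel_comp mT Fc mV).
- apply: measurable_funM; first exact: measurable_cst.
  apply: measurable_funD; first exact: measurable_cst.
  exact: borel_sqr.
rewrite sqr_sqrtr//.
have m2 : measurable_fun setT (fun w => (`|V w| ^+ 2)%:E) by apply/measurable_EFinP; exact: borel_sqr.
have -> : (\int[P]_(w in setT) (C * (1 + `|V w| ^+ 2))%:E =
    \int[P]_(w in setT) (C%:E * (1%:E + (`|V w| ^+ 2)%:E)))%E.
  by apply: eq_integral => w _; rewrite EFinM EFinD.
rewrite ge0_integralZl_EFin//; last first.
  by apply: emeasurable_funD => //; exact: measurable_cst.
  by move=> w _; rewrite adde_ge0// lee_fin sqr_ge0.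
have -> : (\int[P]_(w in setT) (1%:E + (`|V w| ^+ 2)%:E) = (1 + N V ^+ 2)%:E)%E.
  rewrite ge0_integralD//.
  rewrite (int_sqr_nrm VL) EFinD; congr (_ + _)%E.
  by transitivity (1%:E * P setT)%E; [exact: integral_cst|rewrite probability_setT mule1].
by rewrite [leRHS]EFinM.
Qed.

Lemma nrm_lip (F : X -> X) (c : R) (V W : Omega -> X) : 0 <= c ->
  (forall x y, `|F x - F y| <= c * `|x - y|) -> L V -> L W ->
  N (fun w => F (V w) - F (W w)) <= c * N (fun w => V w - W w).
Proof.
move=> c0 Fc VL WL; have Fcont := lip_continuous Fc.
have [|//|_ //] := @L2_dom _ _ _ P setT mT _ _ (fun w => F (V w) - F (W w))
  (fun w => V w - W w) c c0 _ (L2B mT X_sep VL WL).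
by apply: (borelB mT X_sep); apply: (borel_comp mT Fcont); [case: VL|case: WL].
Qed.

Section Superposition.
Context (T C c : R) (F : R -> X -> X) (T_ge0 : 0 <= T) (c_ge0 : 0 <= c) (C_ge0 : 0 <= C).
Hypothesis F_cont : {within `[0, T] `*` setT, continuous (fun p : R * X => F p.1 p.2)}.
Hypothesis F_lip : forall t x y, 0 <= t <= T -> `|F t x - F t y| <= c * `|x - y|.
Hypothesis F_growth : forall t x, 0 <= t <= T -> `|F t x| ^+ 2 <= C * (1 + `|x| ^+ 2).

Lemma superposition_L2 t V : 0 <= t <= T -> L V -> L (fun w => F t (V w)) /\
  N (fun w => F t (V w)) <= Num.sqrt (C * (1 + N V ^+ 2)).
Proof.
move=> tT VL; apply: L2_growth => //; last by move=> x; exact: F_growth.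
by apply: (@lip_continuous _ _ _ _ c) => x y; exact: F_lip.
Qed.

Lemma superposition_cvg (y : R -> Omega -> X) (t : R) : 0 <= t <= T ->
  (forall s, 0 <= s <= T -> L (y s)) ->
  N (fun w => y s w - y t w) @[s --> within `[0, T] (nbhs t)] --> (0 : R) ->
  N (fun w => F s (y s w) - F t (y t w)) @[s --> within `[0, T] (nbhs t)] --> (0 : R).
Proof.
move=> tT yL yc.
apply: (@cvg0_le _ _ _ _ _ (fun s => c * N (fun w => y s w - y t w) +
   N (fun w => F s (y t w) - F t (y t w)))).
  rewrite near_withinE; apply: nearW => s; rewrite /= in_itv /= => sT.
  rewrite nrm_ge0/=.
  have L1 := proj1 (superposition_L2 sT (yL s sT)).
  have L2' := proj1 (superposition_L2 sT (yL t tT)).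
  have L3 := proj1 (superposition_L2 tT (yL t tT)).
  apply: le_trans (nrm_dist mT X_sep L1 L2' L3) _; rewrite lerD2r.
  by apply: nrm_lip => // *; [exact: F_lip|exact: yL|exact: yL].
rewrite [X in _ --> X](_ : 0 = c * 0 + 0 :> R); last by rewrite mulr0 addr0.
apply: cvgD.
  by apply: cvgM => //; exact: cvg_cst.
apply: cvg_within_seq => s sT st; have VL := yL t tT.
have FL v : 0 <= v <= T -> L (fun w => F v (y t w)) by move=> vT; have [] := superposition_L2 vT VL.
(* The square of a sum is at most twice the sum of the two squares, each bounded by the growth
   condition; hence the factor 4. *)
have iW : P.-integrable setT (EFin \o (fun w => 4 * C + 4 * C * dot (y t w) (y t w))).
  rewrite (_ : _ \o _ = (fun w => (EFin \o (fun=> (4 * C)%R)) w +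
    (EFin \o (fun w => (4 * C * dot (y t w) (y t w))%R)) w)%E); last first.
    by apply/funext => w /=; rewrite EFinD.
  apply: integrableD => //; first exact: finite_measure_integrable_cst.
  rewrite (_ : _ \o _ = (fun w => (4 * C)%:E * (EFin \o (fun w => dot (y t w) (y t w))) w)%E).
    by apply: integrableZl => //; exact: integrable_dot.
  by apply/funext => w /=; rewrite EFinM.
have [] := L2_dct mT X_sep (hn := fun n w => F (s n) (y t w)) (h := fun w => F t (y t w)) _ _ iW _ _ => //.
- by move=> n; have [] := FL _ (sT n).
- by have [] := FL t tT.
- move=> n w _; rewrite dotxx.
  have a0 : 0 <= `|F (s n) (y t w)| by []. have b0 : 0 <= `|F t (y t w)| by [].
  have h1 := F_growth (y t w) (sT n); have h2 := F_growth (y t w) tT.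
  have h3 := ler_normB (F (s n) (y t w)) (F t (y t w)).
  apply: (@le_trans _ _ ((`|F (s n) (y t w)| + `|F t (y t w)|) ^+ 2)).
    by rewrite ler_sqr ?nnegrE ?addr_ge0.
  move: a0 b0 h1 h2 {h3}; move: (`|F (s n) _|) (`|F t _|) (`|y t w| ^+ 2) => a b z.
  have := sqr_ge0 (a - b); nra.
- move=> w _; have tD : (`[0, T]%classic `*` setT) (t, y t w) by split => //; rewrite /= in_itv.
  have Fc := proj1 (@subspace_continuousP _ (`[0, T]%classic `*` [set: X]) _ _) F_cont _ tD.
  have sc : (s n, y t w) @[n --> \oo] --> (t, y t w).
    exact: (cvg_pair (G := nbhs t) (H := nbhs (y t w)) st (cvg_cst (y t w))).
  apply: (cvg_comp (fun n => (s n, y t w)) (fun p => F p.1 p.2) _ Fc).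
  move=> S HS; have HS' : \forall n \near \oo, (`[0, T]%classic `*` setT) (s n, y t w) -> S (s n, y t w).
    exact: (sc (fun q => (`[0, T]%classic `*` setT) q -> S q) HS).
  suff : \forall n \near \oo, S (s n, y t w) by [].
  by apply: filterS HS' => n; apply; split => //; rewrite /= in_itv /=; exact: sT.
Qed.

End Superposition.

(** For [t > 0] norm continuity off the diagonal applies. At [t = 0] only strong continuity is at
    hand, and dominated convergence with the bound [2 M |V|] carries it over to L^2. *)
Lemma U_orbit_cvg (T M t : R) (A : R -> operator X) (U : R -> R -> X -> X) (V : Omega -> X) :
  generates T A U -> 0 <= M ->
  (forall t s : R, 0 <= s -> s <= t -> t <= T -> (normL (U t s) <= M%:E)%E) ->
  0 < T -> 0 <= t <= T -> L V ->
  N (fun w => U s 0 (V w) - U t 0 (V w)) @[s --> within `[0, T] (nbhs t)] --> (0 : R).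
Proof.
move=> U_gen M0 U_M T0 /andP[t0 tT] VL; have mV := proj1 VL.
have zz : 0 <= (0 : R) by [].
have UL v : 0 <= v <= T -> L (fun w => U v 0 (V w)).
  by move=> /andP[v0 vT]; have [] := U_L2 U_gen M0 U_M zz v0 vT VL.
move: t0; rewrite le_eqVlt => /orP[/eqP t0|t0]; last first.
  apply: cvg_within_itv => e e0.
  have N1 : 0 < N V + 1 by rewrite ltr_wpDl ?nrm_ge0.
  have e1 : 0 < e / (N V + 1) by rewrite divr_gt0.
  have t00 : 0 <= (0 : R) < t by rewrite lexx.
  have [dl dl0 Hdl] := U_norm_cvg U_gen t00 tT e1.
  (* The bound by [t] keeps [s] positive, off the diagonal. *)
  exists (Num.min dl t); first by rewrite lt_min dl0.
  move=> s /andP[s0 sT]; rewrite lt_min => /andP[sd st]; rewrite ger0_norm ?nrm_ge0//.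
  have s_gt0 : 0 < s by move: st; rewrite ltr_norml; lra.
  have lin2 : linear (fun x => U s 0 x - U t 0 x).
    by apply: linear_sub; apply: (U_lin U_gen) => //; exact: ltW.
  have [|_] := L2_lin (ltW e1) lin2 _ VL.
    by move=> x; apply: Hdl; rewrite ?subrr ?normr0 ?lexx//; rewrite distrC.
  move=> /le_trans; apply; rewrite mulrAC ler_pdivrMr// ler_wpM2l ?(ltW e0)//.
  by rewrite lerDl.
apply: cvg_within_seq => s sT; rewrite -t0 => sc.
have E0 w : U 0 0 (V w) = V w by apply: (U_id U_gen); rewrite lexx ltW.
have mU v : 0 <= v <= T -> borel_fun setT (fun w => U v 0 (V w)) by move=> /UL[].
have zT : 0 <= (0 : R) <= T by rewrite lexx ltW.
have iW : P.-integrable setT (EFin \o (fun w => (2 * M) ^+ 2 * dot (V w) (V w))).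
  rewrite (_ : _ \o _ = (fun w => ((2 * M) ^+ 2)%:E * (EFin \o (fun w => dot (V w) (V w))) w)%E).
    by apply: integrableZl => //; exact: integrable_dot.
  by apply/funext => w /=; rewrite EFinM.
have [] := L2_dct mT X_sep (hn := fun n w => U (s n) 0 (V w)) (h := fun w => U 0 0 (V w)) _ _ iW _ _ => //.
- by move=> n; exact: mU.
- exact: mU.
- move=> n w _; have [sn0 snT] := andP (sT n).
  rewrite dotxx -exprMn ler_sqr ?nnegrE ?mulr_ge0//.
  apply: le_trans (ler_normB _ _) _; rewrite [leRHS](_ : _ = M * `|V w| + M * `|V w|); last by ring.
  by apply: lerD; apply: (U_le U_gen U_M) => //; exact: ltW.
- move=> w _; rewrite E0; have [_ [_ _ _ H _]] := U_gen.
  have {}H := H 0 (V w) (ltac:(by rewrite lexx)).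
  apply/cvgrPdist_le => e e0.
  have /cvgrPdist_le/(_ _ e0) := H; rewrite near_withinE => /nbhs_ballP[dl /= dl0 Hdl].
  have /cvgrPdist_lt/(_ _ dl0) := sc; apply: filterS => n snd.
  have [sn0 _] := andP (sT n); move: sn0; rewrite le_eqVlt => /orP[/eqP <-|sn0].
    by rewrite E0 subrr normr0 ltW.
  by apply: Hdl => //; rewrite -ball_normE.
Qed.

End SuperpositionCont.

(** * Integrals over an interval of length zero *)

Section ZeroLength.
Context (R : realType) (d : measure_display) (Omega : measurableType d).
Context (P : probability Omega R) (X Y : hilbertType R) (X_sep : separable X).
Local Notation leb := (@lebesgue_measure R).
Let mT : measurable [set: Omega] := measurableT.

Let int00 (h : R -> \bar R) : (\int[leb]_(s in `[0%R, 0%R]) h s = 0)%E.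
Proof. by rewrite set_itv1 integral_set1. Qed.

(** The representative is the function 0 itself, not merely one that vanishes almost surely: the
    image of a process must equal [phi 0] at time 0 without exceptional set. *)
Lemma bochner0 (Phi : R -> Omega -> X) : L2 P setT (Phi 0) ->
  is_bochner_integral P 0 Phi (fun=> 0).
Proof.
move=> PL; split.
- by move=> s /andP[s0 s0']; rewrite (_ : s = 0)//; apply/eqP; rewrite eq_le s0 s0'.
- exact: L2_0.
exists (fun=> 0%N), (fun _ _ => set0), (fun _ _ => fun=> 0); split.
- by move=> k i; split; [exact: measurable0|exact: sub0set|exact: L2_0].
(* The exceptional null set is the whole interval, so nothing has to converge on it. *)
- exists [set 0]; split; [exact: measurable_set1|exact: lebesgue_measure_set1|].
  move=> s /= /not_implyP[/andP[s0 s0'] _]; by apply/eqP; rewrite eq_le s0 s0'.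
- by rewrite (_ : (fun k => _) = fun=> 0%E); [exact: cvg_cst|apply/funext => k; rewrite int00].
- rewrite (_ : (fun k => _) = fun=> 0%E); first exact: cvg_cst.
  apply/funext => k; rewrite (_ : _ \- _ = fun=> 0).
    by rewrite L2norm_fin ?nrm0//; exact: L2_0.
  by apply/funext => w /=; rewrite big_ord0 subrr.
Qed.

Context (H T : R) (T_ge0 : 0 <= T) (B : QfBm P Y H T).

Lemma fbm0 (psi : R -> Y -> X) : L20 B (psi 0) -> L20_measurable B `[0, 0]%classic psi ->
  is_fBm_integral B 0 psi (fun=> 0).
Proof.
move=> pL mp.
have oo : (\int[leb]_(s in `[0%R, 0%R]) L20_norm2 B (psi s) < +oo)%E by rewrite int00.
split => //.
- by move=> s /andP[s0 s0']; rewrite (_ : s = 0)//; apply/eqP; rewrite eq_le s0 s0'.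
- exact: L2_0.
exists (fun _ => fun=> 0); last first.
  rewrite (_ : (fun k => _) = fun=> 0%E); first exact: cvg_cst.
  apply/funext => k; rewrite (_ : (fun w => _) = fun=> 0).
    by rewrite L2norm_fin ?nrm0//; exact: L2_0.
  by apply/funext => w /=; rewrite big1 ?subrr.
move=> n Jn; have z0 : 0 <= (0 : R) <= T by rewrite lexx.
have cL := coef_L2 X_sep z0 (mem_set Jn) mp oo.
split; [exact: cL|exact: L2_0|exists (fun=> [::]); split => //].
  rewrite (_ : (fun k => _) = fun=> 0%E); first exact: cvg_cst.
  apply/funext => k.
  have dL : L2 leb `[0%R, 0%R]%classic (fun s => step_fun [::] s - coef B psi n s).
    have m0 : measurable (`[0, 0]%classic : set (measurableTypeR R)) by exact: measurable_itv.
    exact: (L2B m0 X_sep (L2_step_fun X_sep (lexx 0) [::]) cL).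
  rewrite (L2norm_fin dL); congr (_%:E).
  have := congr1 fine (int_sqr_nrm dL); rewrite int00 /= => /eqP.
  by rewrite eq_sym sqrf_eq0 => /eqP.
rewrite (_ : (fun k => _) = fun=> 0%E); first exact: cvg_cst.
apply/funext => k; rewrite (_ : _ \- _ = fun=> 0).
  by rewrite L2norm_fin ?nrm0//; exact: L2_0.
by apply/funext => w /=; rewrite /step_integral big_nil subrr.
Qed.

End ZeroLength.

Section ContinuousL2.
Context (R : realType) (d : measure_display) (Omega : measurableType d).
Context (P : probability Omega R) (X : hilbertType R) (X_sep : separable X).
Local Notation N := (nrm P setT).
Local Notation L := (L2 P setT).
Let mT : measurable [set: Omega] := measurableT.

Lemma continuous_L2_bounded (a b : R) (x : R -> Omega -> X) : a <= b ->
  continuous_L2 P a b x -> exists D, forall t, a <= t <= b -> N (x t) <= D.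
Proof.
move=> ab /(continuous_L2P P X_sep) xc.
have cN : {within `[a, b], continuous (fun t => N (x t))}.
  apply/subspace_continuousP => t; rewrite /= in_itv /= => tab.
  apply/(cvg_norm_sub0 (X := R^o)); have [xL] := xc t tab; apply: cvg0_le.
  rewrite near_withinE; apply: nearW => s; rewrite /= in_itv /= => sab.
  by rewrite normr_ge0/=; apply: nrm_sub_le => //; have [] := xc s sab.
have [c _ Hc] := EVT_max ab cN; exists (N (x c)) => t tab.
by apply: Hc; rewrite in_itv.
Qed.

Lemma delay_cvg (tau T : R) (r : R -> R) (x : R -> Omega -> X) :
  {within `[0, +oo[, continuous r} -> (forall t, 0 <= t -> 0 <= r t <= tau) ->
  continuous_L2 P (- tau) T x -> forall t, 0 <= t <= T -> L (x (t - r t)) /\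
  N (fun w => x (s - r s) w - x (t - r t) w) @[s --> within `[0, T] (nbhs t)] --> (0 : R).
Proof.
move=> rc rr /(continuous_L2P P X_sep) xc.
have in_ s : 0 <= s <= T -> - tau <= s - r s <= T.
  by move=> /andP[s0 sT]; have := rr s s0; lra.
move=> t tT; have [xL /cvg_within_itvP xt] := xc _ (in_ t tT); split => //.
apply/cvg_within_itvP => e e0; have [dl dl0 Hdl] := xt e e0.
have [t0 _] := andP tT.
have tD : (`[0, +oo[%classic : set R) t by rewrite /= in_itv /= t0.
(* Half of the radius is spent on the change of [s], half on that of [r s]. *)
have dl2 : 0 < dl / 2 by rewrite divr_gt0.
have /cvgrPdist_lt/(_ _ dl2) := proj1 (@subspace_continuousP _ (`[0, +oo[%classic : set R) _ _) rc _ tD.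
rewrite near_withinE => /nbhs_ballP[dl' /= dl'0 Hr].
exists (Num.min dl' (dl / 2)); first by rewrite lt_min dl'0 dl2.
move=> s sT; rewrite lt_min => /andP[s1 s2]; apply: Hdl; first exact: in_.
have /(_ _ _)/= := Hr s; rewrite -ball_normE /= distrC s1 in_itv /= andbT.
case/andP: (sT) => s0 _ /(_ isT s0); rewrite /from_subspace.
by move: s2; rewrite !ltr_norml; lra.
Qed.

Lemma within_sub_cvg (T t s : R) (u : R -> R) : t <= T ->
  u s' @[s' --> within `[0, T] (nbhs s)] --> (0 : R) ->
  u s' @[s' --> within `[0, t[ (nbhs s)] --> (0 : R).
Proof.
move=> tT uc; apply/cvgrPdist_le => e e0; have /cvgrPdist_le/(_ _ e0) := uc.
rewrite !near_withinE; apply: filterS => s' H; rewrite /= in_itv /= => /andP[s0 st].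
by apply: H; rewrite /= in_itv /= s0 (le_trans (ltW st)).
Qed.

End ContinuousL2.

Section ExpInt.
Context (R : realType).
Local Notation leb := (@lebesgue_measure R).

(** The antiderivative is [c * expR (lam * s) / lam]; its nonnegative value at 0 is dropped. *)
Lemma int_expR_le (c lam t : R) : 0 <= c -> 0 < lam -> 0 <= t ->
  (\int[leb]_(s in `[0%R, t]) (c * expR (lam * s))%:E <= (c * expR (lam * t) / lam)%:E)%E.
Proof.
move=> c0 l0; rewrite le_eqVlt => /orP[/eqP <-|t0].
  by rewrite set_itv1 integral_set1 lee_fin divr_ge0 ?mulr_ge0 ?expR_ge0// ltW.
pose F s := c * expR (lam * s) / lam.
have dl (s : R) : is_derive s 1 (fun s : R => lam * s) lam.
  have -> : (fun s : R => lam * s) = lam \*: (@id R) by [].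
  by apply: is_derive_eq; rewrite /GRing.scale /= mulr1.
have dF (s : R) : is_derive s 1 F (c * expR (lam * s)).
  have -> : F = (c / lam) \*: (expR \o (fun s : R => lam * s)).
    by apply/funext => u; rewrite /F /GRing.scale /= mulrAC.
  have -> : c * expR (lam * s) = (c / lam) *: (expR (lam * s) * lam).
    by rewrite /GRing.scale /=; field; rewrite gt_eqF.
  by apply: is_deriveZ; apply: is_derive1_comp; exact: is_derive_expR.
have cf : continuous (fun s : R => c * expR (lam * s)).
  move=> s; apply: cvgM; first exact: cvg_cst.
  apply: continuous_comp; last exact: continuous_expR.
  by apply: cvgM; [exact: cvg_cst|exact: cvg_id].
have cF (s : R) : {for s, continuous F}.
  by apply: differentiable_continuous; apply/derivable1_diffP; apply: ex_derive.
have -> : (\int[leb]_(s in `[0%R, t]) (c * expR (lam * s))%:E = (F t)%:E - (F 0)%:E)%E.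
  apply: (continuous_FTC2 t0).
  - by apply: continuous_subspaceT => s; exact: cf.
  - split.
    + by move=> s _; apply: ex_derive.
    + by apply: cvg_at_right_filter; exact: cF.
    + by apply: cvg_at_left_filter; exact: cF.
  - by move=> s _; rewrite derive1E derive_val.
rewrite -EFinD lee_fin gerBl /F divr_ge0 ?mulr_ge0 ?expR_ge0//; exact: ltW.
Qed.

End ExpInt.

Section ContinuousL2Glue.
Context (R : realType) (d : measure_display) (Omega : measurableType d).
Context (P : probability Omega R) (X : hilbertType R) (X_sep : separable X).
Local Notation N := (nrm P setT).
Local Notation L := (L2 P setT).
Let mT : measurable [set: Omega] := measurableT.

Lemma continuous_L2_ext (a b : R) (x y : R -> Omega -> X) :
  (forall t, a <= t <= b -> x t = y t) -> continuous_L2 P a b x -> continuous_L2 P a b y.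
Proof.
move=> xy /(continuous_L2P P X_sep) xc; apply/(continuous_L2P P X_sep) => t tab.
have [xL /cvg_within_itvP xt] := xc t tab; rewrite -(xy t tab); split => //.
apply/cvg_within_itvP => e /xt[dl dl0 H]; exists dl => // s sab; rewrite -(xy s sab).
exact: H.
Qed.

Lemma continuous_L2_glue (a b c : R) (x : R -> Omega -> X) :
  continuous_L2 P a b x -> continuous_L2 P b c x -> continuous_L2 P a c x.
Proof.
move=> /(continuous_L2P P X_sep) xc /(continuous_L2P P X_sep) xc'.
apply/(continuous_L2P P X_sep) => t /andP[at_ tc].
have [tb|bt|tb] := ltgtP t b.
- have [|xL /cvg_within_itvP xt] := xc t; first by rewrite at_ ltW.
  split => //; apply/cvg_within_itvP => e /xt[dl dl0 H].
  exists (Num.min dl (b - t)); first by rewrite lt_min dl0 subr_gt0.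
  move=> s /andP[as_ _]; rewrite lt_min => /andP[s1 s2]; apply: H => //.
  by rewrite as_ /=; move: s2; rewrite ltr_norml; lra.
- have [|xL /cvg_within_itvP xt] := xc' t; first by rewrite tc ltW.
  split => //; apply/cvg_within_itvP => e /xt[dl dl0 H].
  exists (Num.min dl (t - b)); first by rewrite lt_min dl0 subr_gt0.
  move=> s /andP[_ sc]; rewrite lt_min => /andP[s1 s2]; apply: H => //.
  by rewrite sc andbT; move: s2; rewrite ltr_norml; lra.
have [|xL /cvg_within_itvP xt] := xc t; first by rewrite at_ tb lexx.
have [|_ /cvg_within_itvP xt'] := xc' t; first by rewrite tc tb lexx.
split => //; apply/cvg_within_itvP => e e0; have [dl dl0 H] := xt e e0.
have [dl' dl'0 H'] := xt' e e0; exists (Num.min dl dl'); first by rewrite lt_min dl0.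
move=> s /andP[as_ sc]; rewrite lt_min => /andP[s1 s2].
by have [sb|/ltW bs] := lerP s b; [apply: H => //; rewrite as_|apply: H' => //; rewrite bs].
Qed.

Lemma nrm_ae (u v : Omega -> X) : L u -> L v -> {ae P, forall w, u w = v w} ->
  N (fun w => u w - v w) = 0.
Proof.
move=> uL vL uv; apply/(nrm_eq0 mT (L2B mT X_sep uL vL)).
by apply: filterS uv => w uw _; rewrite uw subrr.
Qed.

Lemma nrm_ae_le (u v : Omega -> X) : L u -> L v -> {ae P, forall w, u w = v w} ->
  N u <= N v.
Proof.
move=> uL vL uv; rewrite -[leRHS]add0r -(nrm_ae uL vL uv).
apply: le_trans (nrmD mT X_sep (L2B mT X_sep uL vL) vL).
rewrite le_eqVlt; apply/orP; left; apply/eqP; congr nrm; apply/funext => w.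
by rewrite subrK.
Qed.

End ContinuousL2Glue.

Lemma geo_le0 (R : realType) (a q c : R) : 0 <= q < 1 -> (forall n, a <= q ^+ n * c) -> a <= 0.
Proof.
move=> /andP[q0 q1] H.
have cq : q ^+ n * c @[n --> \oo] --> (0 : R).
  rewrite -(mul0r c); apply: cvgM; last exact: cvg_cst.
  by apply: cvg_expr; rewrite ger0_norm.
have ca : a @[_ --> \oo] --> a by exact: cvg_cst.
by apply: (ler_cvg_to ca cq); exact: nearW.
Qed.

(** * The fixed-point map and its iteration *)

Section MildSolution.
Context (R : realType) (d : measure_display) (Omega : measurableType d).
Context (P : probability Omega R) (X Y : hilbertType R) (X_sep : separable X).
Context (H tau T : R) (H_range : 2^-1 < H < 1) (tau_gt0 : 0 < tau) (T_gt0 : 0 < T).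
Context (B : QfBm P Y H T) (A : R -> operator X) (U : R -> R -> X -> X).
Context (f g : R -> X -> X) (sigma : R -> Y -> X) (r rho : R -> R) (phi : R -> Omega -> X).
Context (M Mstar C1 C2 Lstar K : R).
Hypotheses (A_closed : forall t : R, 0 <= t <= T -> closed_densely_defined (A t))
  (U_gen : generates T A U)
  (sigma_L20 : forall t : R, 0 <= t <= T -> L20 B (sigma t))
  (sigma_meas : L20_measurable B `[0, T]%classic sigma)
  (sigma_le : forall t : R, 0 <= t <= T -> (L20_norm2 B (sigma t) <= K%:E)%E)
  (r_range : forall t : R, 0 <= t -> 0 <= r t <= tau)
  (rho_range : forall t : R, 0 <= t -> 0 <= rho t <= tau)
  (M_ge0 : 0 <= M)
  (U_M : forall t s : R, 0 <= s -> s <= t -> t <= T -> (normL (U t s) <= M%:E)%E)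
  (A_inv : forall t : R, 0 <= t <= T -> boundedly_invertible (A t))
  (Mstar_gt0 : 0 < Mstar)
  (A_inv_le : forall t : R, 0 <= t <= T -> (normL (op_inv (A t)) <= Mstar%:E)%E)
  (f_cont : {within `[0, T] `*` setT, continuous (fun p : R * X => f p.1 p.2)})
  (g_cont : {within `[0, T] `*` setT, continuous (fun p : R * X => g p.1 p.2)})
  (g_dom : forall (t : R) (x : X), 0 <= t <= T -> dom (A t) (g t x))
  (C1_ge0 : 0 <= C1) (C2_ge0 : 0 <= C2)
  (f_lip : forall (t : R) (x y : X), 0 <= t <= T -> `|f t x - f t y| <= C1 * `|x - y|)
  (g_lip : forall (t : R) (x y : X), 0 <= t <= T -> `|g t x - g t y| <= C1 * `|x - y|)
  (f_growth : forall (t : R) (x : X), 0 <= t <= T -> `|f t x| ^+ 2 <= C2 * (1 + `|x| ^+ 2))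
  (g_growth : forall (t : R) (x : X), 0 <= t <= T -> `|g t x| ^+ 2 <= C2 * (1 + `|x| ^+ 2))
  (Ag_growth : forall (t : R) (x : X), 0 <= t <= T ->
     `|A t (g t x)| ^+ 2 <= C2 * (1 + `|x| ^+ 2))
  (Lstar_range : 0 < Lstar < Mstar^-1)
  (Ag_lip : forall (t : R) (x y : X), 0 <= t <= T ->
     `|A t (g t x) - A t (g t y)| <= Lstar * `|x - y|)
  (r_cont : {within `[0, +oo[, continuous r})
  (rho_cont : {within `[0, +oo[, continuous rho})
  (phi_cont : continuous_L2 P (- tau) 0 phi).

Local Notation N := (nrm P setT).
Local Notation L := (L2 P setT).
Local Notation leb := (@lebesgue_measure R).
Let mT : measurable [set: Omega] := measurableT.
Let T_ge0 : 0 <= T := ltW T_gt0.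

(* [mild_step x z]: z is the image of x under the fixed-point map, known only up
   to null sets; mild solutions are its fixed points. *)
Definition mild_step (x z : R -> Omega -> X) : Prop :=
  [/\ continuous_L2 P (- tau) T z,
      forall t : R, - tau <= t <= 0 -> {ae P, forall w, z t w = phi t w} &
      forall t : R, 0 <= t <= T ->
      exists I1 I2 I3 : Omega -> X,
      [/\ is_bochner_integral P t
            (fun s w => U t s (A s (g s (x (s - r s) w)))) I1,
          is_bochner_integral P t (fun s w => U t s (f s (x (s - rho s) w))) I2,
          is_fBm_integral B t (fun s y => U t s (sigma s y)) I3 &
          {ae P, forall w,
             z t w = U t 0 (phi 0 w + g 0 (phi (- r 0) w))
                     - g t (x (t - r t) w) - I1 w + I2 w + I3 w}]].

(** Equality with [phi] is exact, not almost sure, so that iterates agree literally in the past and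
    the right-hand side at time 0 can be computed pointwise. *)
Definition admissible (x : R -> Omega -> X) : Prop :=
  continuous_L2 P (- tau) T x /\ forall t, t <= 0 -> x t = phi t.

(** The integrals are chosen separately for each [t]. Continuity in [t] survives the choice, because
    the estimates hold for all representatives. *)
Lemma mild_step_exists x : admissible x -> exists z, admissible z /\ mild_step x z.
Proof.
have T0 := T_ge0; have M0 := M_ge0; have z0 : 0 <= (0 : R) <= T by rewrite lexx.
have z00 : 0 <= (0 : R) by [].
move=> [xc xphi].
have tauT : - tau <= T by have := tau_gt0; lra.
have [D xD] := continuous_L2_bounded X_sep tauT xc.
pose y1 s := x (s - r s); pose y2 s := x (s - rho s).
have y1c := delay_cvg X_sep r_cont r_range xc.
have y2c := delay_cvg X_sep rho_cont rho_range xc.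
have y1L s : 0 <= s <= T -> L (y1 s) by move=> /y1c[].
have y2L s : 0 <= s <= T -> L (y2 s) by move=> /y2c[].
have D0 : 0 <= D by apply: le_trans (nrm_ge0 P setT _) (xD T _); rewrite tauT lexx.
pose C := Num.sqrt (C2 * (1 + D ^+ 2)).
have CN (V : Omega -> X) : N V <= D -> Num.sqrt (C2 * (1 + N V ^+ 2)) <= C.
  move=> VD; apply: ler_wsqrtr; rewrite ler_wpM2l// lerD2l ler_sqr// nnegrE//.
  exact: nrm_ge0.
have y1N s : 0 <= s <= T -> N (y1 s) <= D.
  by move=> /andP[s0 sT]; apply: xD; have := r_range s0; lra.
have y2N s : 0 <= s <= T -> N (y2 s) <= D.
  by move=> /andP[s0 sT]; apply: xD; have := rho_range s0; lra.
have gL s : 0 <= s <= T -> L (fun w => g s (y1 s w)).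
  by move=> sT; have [] := superposition_L2 C2_ge0 g_lip g_growth sT (y1L s sT).
have fL s : 0 <= s <= T -> L (fun w => f s (y2 s w)) /\ N (fun w => f s (y2 s w)) <= C.
  move=> sT; have [fL' fN] := superposition_L2 C2_ge0 f_lip f_growth sT (y2L s sT).
  by split => //; apply: le_trans fN (CN _ (y2N s sT)).
have AgL s : 0 <= s <= T -> L (fun w => A s (g s (y1 s w))) /\
    N (fun w => A s (g s (y1 s w))) <= C.
  move=> sT; have Agc : continuous (fun v => A s (g s v)).
    by apply: (@lip_continuous _ _ _ _ Lstar) => v v'; exact: Ag_lip.
  have [AgL' AgN] := L2_growth C2_ge0 Agc (fun v => Ag_growth v sT) (y1L s sT).
  by split => //; apply: le_trans AgN (CN _ (y1N s sT)).
have gc s : 0 <= s <= T ->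
    N (fun w => g s' (y1 s' w) - g s (y1 s w)) @[s' --> within `[0, T] (nbhs s)] --> (0 : R).
  move=> sT; have [_ yc] := y1c s sT.
  exact: (superposition_cvg X_sep C1_ge0 C2_ge0 g_cont g_lip g_growth).
have fc s : 0 <= s <= T ->
    N (fun w => f s' (y2 s' w) - f s (y2 s w)) @[s' --> within `[0, T] (nbhs s)] --> (0 : R).
  move=> sT; have [_ yc] := y2c s sT.
  exact: (superposition_cvg X_sep C1_ge0 C2_ge0 f_cont f_lip f_growth).
have in0t t s : 0 <= t <= T -> 0 <= s <= t -> 0 <= s <= T.
  by move=> /andP[_ tT] /andP[-> st]; exact: le_trans tT.
have in0t' t s : 0 <= t <= T -> 0 <= s < t -> 0 <= s <= T.
  by move=> tT /andP[s0 /ltW st]; apply: in0t tT _; rewrite s0.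
have I1_ t : {I | 0 <= t <= T -> is_bochner_integral P t
    (fun s w => U t s (A s (g s (y1 s w)))) I /\ (t = 0 -> I = fun=> 0)}.
  apply: cid; case: (boolP (0 <= t <= T)) => [tT|_]; last by exists (fun=> 0).
  have [->|/eqP t0] := eqVneq t 0.
    exists (fun=> 0) => _; split => //; apply: bochner0 => //.
    by have [] := U_L2 U_gen M_ge0 U_M z00 z00 T0 (AgL 0 z0).1.
  have [|||||||||I HI] := @UA_bochner _ _ _ P X X_sep T M A U U_gen M_ge0 U_M _ _ _ _ t C
      (fun s w => g s (y1 s w)) tT; last by exists I.
  - by move=> s /A_closed[].
  - by move=> s /A_closed[].
  - by move=> s sT; exists Mstar; exact: A_inv_le.
  - by move=> s /A_inv[].
  - by move=> s st; apply: gL; exact: in0t st.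
  - by move=> s w st; apply: g_dom; exact: in0t st.
  - by move=> s st; have [] := AgL s (in0t _ _ tT st).
  - by move=> s st; have [] := AgL s (in0t _ _ tT st).
  - move=> s st; apply: (within_sub_cvg (T := T)); first by case/andP: tT.
    by apply: gc; exact: in0t' st.
have I2_ t : {I | 0 <= t <= T -> is_bochner_integral P t
    (fun s w => U t s (f s (y2 s w))) I /\ (t = 0 -> I = fun=> 0)}.
  apply: cid; case: (boolP (0 <= t <= T)) => [tT|_]; last by exists (fun=> 0).
  have [->|/eqP t0] := eqVneq t 0.
    exists (fun=> 0) => _; split => //; apply: bochner0 => //.
    by have [] := U_L2 U_gen M_ge0 U_M z00 z00 T0 (fL 0 z0).1.
  have [|||I HI] := @U_bochner _ _ _ P X X_sep T M A U U_gen M_ge0 U_M t C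
      (fun s w => f s (y2 s w)) tT; last by exists I.
  - by move=> s st; have [] := fL s (in0t _ _ tT st).
  - by move=> s st; have [] := fL s (in0t _ _ tT st).
  - move=> s st; apply: (within_sub_cvg (T := T)); first by case/andP: tT.
    by apply: fc; exact: in0t' st.
have I3_ t : {I | 0 <= t <= T -> is_fBm_integral B t
    (fun s y => U t s (sigma s y)) I /\ (t = 0 -> I = fun=> 0)}.
  apply: cid; case: (boolP (0 <= t <= T)) => [tT|_]; last by exists (fun=> 0).
  have [I HI] := fbm_U_exists X_sep H_range T0 U_gen M_ge0 U_M sigma_L20 sigma_meas sigma_le tT.
  have [t0|/eqP t0] := eqVneq t 0; last by exists I.
  exists (fun=> 0) => _; split => //; move: HI; rewrite t0 => -[pL mp _ _ _].
  have p0 : 0 <= (0 : R) <= 0 by rewrite lexx.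
  exact: (fbm0 X_sep T0 (psi := fun s y => U 0 s (sigma s y)) (pL 0 p0) mp).
pose I1 t := sval (I1_ t); pose I2 t := sval (I2_ t); pose I3 t := sval (I3_ t).
have hI1 t tT := svalP (I1_ t) tT.
have hI2 t tT := svalP (I2_ t) tT.
have hI3 t tT := svalP (I3_ t) tT.
have phiP := proj1 (continuous_L2P P X_sep _ _ _) phi_cont.
have phi0L : L (phi 0).
  by have [|//] := phiP 0; rewrite lexx oppr_le0 (ltW tau_gt0).
have phirL : L (phi (- r 0)).
  by have [|//] := phiP (- r 0); rewrite oppr_le0 lerN2 andbC; exact: r_range.
have xiL : L (fun w => phi 0 w + g 0 (phi (- r 0) w)).
  apply: L2D => //.
  by have [] := superposition_L2 C2_ge0 g_lip g_growth z0 phirL.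
pose F t w := U t 0 (phi 0 w + g 0 (phi (- r 0) w))
                     - g t (x (t - r t) w) - I1 t w + I2 t w + I3 t w.
(* Regrouped as nested differences, the form in which [nrm_sub_cvg] passes continuity from the terms
   to the whole. *)
have F_E : F = fun t w => (U t 0 (phi 0 w + g 0 (phi (- r 0) w)) - g t (y1 t w)) -
    ((I1 t w - I2 t w) - I3 t w).
  apply/funext => t; apply/funext => w; rewrite /F opprB opprB.
  by rewrite (addrC (I3 t w)) (addrC (I2 t w) (- _)) !addrA.
have ULx t : 0 <= t <= T -> L (fun w => U t 0 (phi 0 w + g 0 (phi (- r 0) w))).
  by move=> /andP[t0 tT]; have [] := U_L2 U_gen M_ge0 U_M z00 t0 tT xiL.
have I1L t : 0 <= t <= T -> L (I1 t) by move=> /hI1[[]].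
have I2L t : 0 <= t <= T -> L (I2 t) by move=> /hI2[[]].
have I3L t : 0 <= t <= T -> L (I3 t) by move=> /hI3[[]].
have abL t : 0 <= t <= T ->
    L (fun w => U t 0 (phi 0 w + g 0 (phi (- r 0) w)) - g t (y1 t w)).
  by move=> tT; exact: (L2B mT X_sep (ULx t tT) (gL t tT)).
have I12L t : 0 <= t <= T -> L (fun w => I1 t w - I2 t w).
  by move=> tT; exact: (L2B mT X_sep (I1L t tT) (I2L t tT)).
have I123L t : 0 <= t <= T -> L (fun w => (I1 t w - I2 t w) - I3 t w).
  by move=> tT; exact: (L2B mT X_sep (I12L t tT) (I3L t tT)).
have F_c : continuous_L2 P 0 T F.
  apply/(continuous_L2P P X_sep) => t tT; rewrite F_E; split.
    exact: (L2B mT X_sep (abL t tT) (I123L t tT)).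
  have near_in (Q : R -> Prop) : (forall s, 0 <= s <= T -> Q s) ->
      \forall s \near within `[0, T] (nbhs t), Q s.
    by move=> HQ; rewrite near_withinE; apply: nearW => s; rewrite /= in_itv /=; exact: HQ.
  apply: (nrm_sub_cvg X_sep _ (near_in _ abL) (abL t tT) (near_in _ I123L) (I123L t tT)).
    apply: (nrm_sub_cvg X_sep _ (near_in _ ULx) (ULx t tT) (near_in _ gL) (gL t tT)).
    + exact: (U_orbit_cvg X_sep U_gen M_ge0 U_M T_gt0 tT xiL).
    + exact: gc.
  apply: (nrm_sub_cvg X_sep _ (near_in _ I12L) (I12L t tT) (near_in _ I3L) (I3L t tT)).
  + apply: (nrm_sub_cvg X_sep _ (near_in _ I1L) (I1L t tT) (near_in _ I2L) (I2L t tT)).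
    * apply: (bochner_U_cvg X_sep T0 U_gen M_ge0 U_M tT (fun s sT => (AgL s sT).1)
        (fun s sT => (AgL s sT).2)) => s sT.
      by have [] := hI1 s sT.
    * apply: (bochner_U_cvg X_sep T0 U_gen M_ge0 U_M tT (fun s sT => (fL s sT).1)
        (fun s sT => (fL s sT).2)) => s sT.
      by have [] := hI2 s sT.
    refine (fbm_U_cvg X_sep H_range T0 U_gen M_ge0 U_M sigma_meas sigma_le (Z := I3) tT _) => s sT.
    by have [] := hI3 s sT.
(* At time 0 the operator is the identity, the integrals vanish and the two terms in [g] cancel,
   because [x (- r 0)] is [phi (- r 0)]. *)
have F0 : F 0 = phi 0.
  have I10 : I1 0 = fun=> 0 by exact: (hI1 0 z0).2.
  have I20 : I2 0 = fun=> 0 by exact: (hI2 0 z0).2.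
  have I30 : I3 0 = fun=> 0 by exact: (hI3 0 z0).2.
  apply/funext => w; rewrite /F I10 I20 I30.
  rewrite (U_id U_gen)// xphi; last first.
    by rewrite sub0r oppr_le0; case/andP: (r_range z00).
  by rewrite sub0r addrK subr0 !addr0.
pose z t := if t <= 0 then phi t else F t.
have zF t : 0 <= t -> z t = F t.
  move=> t0; rewrite /z; case: ifP => // t0'.
  by have -> : t = 0; [apply/eqP; rewrite eq_le t0 t0'|rewrite F0].
have zphi t : t <= 0 -> z t = phi t by move=> t0; rewrite /z t0.
have z_c : continuous_L2 P (- tau) T z.
  apply: (continuous_L2_glue X_sep (b := 0)).
    by apply: (continuous_L2_ext X_sep _ phi_cont) => t /andP[_ t0]; rewrite zphi.
  by apply: (continuous_L2_ext X_sep _ F_c) => t /andP[t0 _]; rewrite zF.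
exists z; split => //; split => //.
  by move=> t /andP[_ t0]; rewrite zphi//; exact: aeW.
move=> t tT; exists (I1 t), (I2 t), (I3 t); split; try by case: (hI1 t tT); case: (hI2 t tT); case: (hI3 t tT).
by case/andP: (tT) => t0 _; rewrite zF//; exact: aeW.
Qed.

Let sub_addACA (p q p' q' : X) : (p + q) - (p' + q') = (p - p') + (q - q').
Proof. by rewrite opprD addrACA. Qed.

(** The weighted sup norm appears only through bounds of the form [D * expR (lam * t)], which the
    map reproduces up to a constant factor. The noise terms cancel, being integrals of the same
    integrand. *)
Lemma mild_step_contract lam D x z x' z' : 0 < lam -> 0 <= D ->
  continuous_L2 P (- tau) T x -> continuous_L2 P (- tau) T x' ->
  mild_step x z -> mild_step x' z' ->
  (forall t, - tau <= t <= 0 -> N (fun w => x t w - x' t w) <= 0) ->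
  (forall t, 0 <= t <= T -> N (fun w => x t w - x' t w) <= D * expR (lam * t)) ->
  forall t, 0 <= t <= T -> N (fun w => z t w - z' t w) <=
    (Mstar * Lstar + M * (Lstar + C1) / lam) * (D * expR (lam * t)).
Proof.
move=> lam0 D0 xc xc' [zc zphi hz] [zc' zphi' hz'] xx0 xxD t tT.
have [Lstar0 _] := andP Lstar_range; have M0 := M_ge0; have Ms0 := ltW Mstar_gt0.
have C10 := C1_ge0; have [t0 t_le_T] := andP tT.
have xL s : - tau <= s <= T -> L (x s) by move=> sT; have [] := proj1 (continuous_L2P P X_sep _ _ _) xc s sT.
have xL' s : - tau <= s <= T -> L (x' s) by move=> sT; have [] := proj1 (continuous_L2P P X_sep _ _ _) xc' s sT.
have zL : L (z t).
  by have [|//] := proj1 (continuous_L2P P X_sep _ _ _) zc t; have := tau_gt0; lra.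
have zL' : L (z' t).
  by have [|//] := proj1 (continuous_L2P P X_sep _ _ _) zc' t; have := tau_gt0; lra.
have xd (rr : R -> R) : (forall t : R, 0 <= t -> 0 <= rr t <= tau) -> forall s, 0 <= s <= T ->
    [/\ L (x (s - rr s)), L (x' (s - rr s)) &
     N (fun w => x (s - rr s) w - x' (s - rr s) w) <= D * expR (lam * s)].
  move=> rrr s /andP[s0 sT]; have /andP[r0 r1] := rrr s s0.
  split; [by apply: xL; lra|by apply: xL'; lra|].
  (* A delayed time is either in the past, where the processes agree, or positive, where
     monotonicity of the exponential makes the delay harmless. *)
  have [le0|gt0] := lerP (s - rr s) 0.
    apply: le_trans (xx0 _ _) _; first by rewrite le0 andbT; lra.
    by rewrite mulr_ge0// expR_ge0.
  apply: le_trans (xxD _ _) _; first by rewrite ltW//=; lra.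
  by rewrite ler_wpM2l// ler_expR ler_wpM2l ?(ltW lam0)// gerBl.
have [I1 [I2 [I3 [h1 h2 h3 hF]]]] := hz t tT.
have [I1' [I2' [I3' [h1' h2' h3' hF']]]] := hz' t tT.
have I1L : L I1 by case: h1. have I1L' : L I1' by case: h1'.
have I2L : L I2 by case: h2. have I2L' : L I2' by case: h2'.
have I3L : L I3 by case: h3. have I3L' : L I3' by case: h3'.
have mexp c : measurable_fun (`[0, t]%classic : set (measurableTypeR R)) (fun s => c * expR (lam * s)).
  apply: measurable_funTS; apply: continuous_measurable_fun => s.
  apply: cvgM; first exact: cvg_cst.
  apply: continuous_comp; last exact: continuous_expR.
  by apply: cvgM; [exact: cvg_cst|exact: cvg_id].
have in0t s : 0 <= s <= t -> 0 <= s <= T by move=> /andP[-> st]; exact: le_trans t_le_T.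
have gstar s a b : 0 <= s <= T -> `|g s a - g s b| <= Mstar * Lstar * `|a - b|.
  move=> sT; have [Alin _ _] := A_closed sT; have [Abij _] := A_inv sT.
  apply: le_trans (op_inv_sub_le Alin Abij (A_inv_le sT) (g_dom a sT) (g_dom b sT)) _.
  by rewrite -mulrA ler_wpM2l// Ag_lip.
(* Used twice: for [A s (g s _)] with [Lstar] and the delay [r], and for [f] with [C1] and the delay
   [rho]. *)
have int_le (G G' : R -> X -> X) (rr : R -> R) (c : R) (I I' : Omega -> X) : 0 <= c ->
    (forall t : R, 0 <= t -> 0 <= rr t <= tau) ->
    (forall s a b, 0 <= s <= T -> `|G s a - G s b| <= c * `|a - b|) ->
    is_bochner_integral P t (fun s w => U t s (G s (x (s - rr s) w))) I ->
    is_bochner_integral P t (fun s w => U t s (G s (x' (s - rr s) w))) I' ->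
    N (fun w => I w - I' w) <= M * c * D * expR (lam * t) / lam.
  move=> c0 rrr Gc hI hI'; rewrite -lee_fin.
  apply: le_trans (int_expR_le _ lam0 t0); last by rewrite !mulr_ge0.
  apply: (bochner_le X_sep hI hI' (mexp _)) => s st; have sT := in0t s st.
  have [L1 L2' N1] := xd rr rrr s sT; have [s0 s_le_t] := andP st.
  apply: (@le_trans _ _ (M * c * N (fun w => x (s - rr s) w - x' (s - rr s) w))).
    apply: (@nrm_lip _ _ _ P X X_sep (fun v => U t s (G s v))) => //; first by rewrite mulr_ge0.
    move=> a b; rewrite -(linear_funB (U_lin U_gen s0 s_le_t t_le_T)).
    apply: le_trans (U_le U_gen U_M _ s0 s_le_t t_le_T) _.
    by rewrite -mulrA ler_wpM2l// Gc.
  by rewrite -[leRHS]mulrA ler_wpM2l// mulr_ge0.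
have n1 := int_le _ (fun=> id) r Lstar _ _ (ltW Lstar0) r_range Ag_lip h1 h1'.
have n2 := int_le _ (fun=> id) rho C1 _ _ C1_ge0 rho_range f_lip h2 h2'.
(* The two noise integrals may be different representatives; the case [c = 0] of [fbm_integral_le]
   identifies them. *)
have n3 : N (fun w => I3 w - I3' w) <= 0.
  have c0 : (\int[leb]_(s in `[0%R, T]) (\sum_(n <oo | n \in bm_idx B)
      (`|ext0 t (coef B (fun s y => U t s (sigma s y)) n) s -
         ext0 t (coef B (fun s y => U t s (sigma s y)) n) s| ^+ 2)%:E) <= 0%:E)%E.
    rewrite le_eqVlt; apply/orP; left; apply/eqP; apply: integral0_eq => s _.
    by apply: eseries0 => n _ _; rewrite subrr normr0 expr0n.
  have := fbm_integral_le X_sep H_range T_ge0 tT tT h3 h3' c0.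
  by rewrite mulr0 => h; rewrite -ler_sqr ?nnegrE ?nrm_ge0// expr0n.
have [gL gL' gN] := xd r r_range t tT.
have n0 : N (fun w => g t (x' (t - r t) w) - g t (x (t - r t) w)) <=
    Mstar * Lstar * (D * expR (lam * t)).
  rewrite nrmB.
  apply: (@le_trans _ _ (Mstar * Lstar * N (fun w => x (t - r t) w - x' (t - r t) w))).
    apply: (@nrm_lip _ _ _ P X X_sep (g t)) => //; first by rewrite mulr_ge0// ltW.
    by move=> a b; exact: gstar.
  by rewrite ler_wpM2l// mulr_ge0// ltW.
have g1L := (superposition_L2 C2_ge0 g_lip g_growth tT gL).1.
have g1L' := (superposition_L2 C2_ge0 g_lip g_growth tT gL').1.
have dg := L2B mT X_sep g1L' g1L.
have d1 := L2B mT X_sep I1L' I1L.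
have d2 := L2B mT X_sep I2L I2L'.
have d3 := L2B mT X_sep I3L I3L'.
have d01 := L2D mT X_sep dg d1.
have d012 := L2D mT X_sep d01 d2.
apply: (@le_trans _ _ (N (fun w => ((g t (x' (t - r t) w) - g t (x (t - r t) w)) +
    (I1' w - I1 w)) + (I2 w - I2' w) + (I3 w - I3' w)))).
  apply: (nrm_ae_le X_sep (L2B mT X_sep zL zL') (L2D mT X_sep d012 d3)).
  apply: filterS2 hF hF' => w -> ->.
  rewrite !sub_addACA subrr add0r !opprK.
  by rewrite (addrC (- g t _)) (addrC (- I1 w)).
apply: le_trans (nrmD mT X_sep d012 d3) _.
have e1 := nrmD mT X_sep d01 d2; have e2 := nrmD mT X_sep dg d1.
have e3 : N (fun w => I1' w - I1 w) = N (fun w => I1 w - I1' w) by exact: nrmB.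
have -> : (Mstar * Lstar + M * (Lstar + C1) / lam) * (D * expR (lam * t)) =
    Mstar * Lstar * (D * expR (lam * t)) + M * Lstar * D * expR (lam * t) / lam +
    M * C1 * D * expR (lam * t) / lam by ring.
by lra.
Qed.

(** Picard iteration with a choice of image at each step. For uniqueness, the bound on the
    difference of two solutions can be multiplied by [q] any number of times. *)
Lemma mild_step_fixpoint : exists2 x, mild_step x x &
  forall y, mild_step y y -> forall t, - tau <= t <= T -> {ae P, forall w, y t w = x t w}.
Proof.
have T0 := T_ge0; have M0 := M_ge0; have tau0 := ltW tau_gt0.
have [Lstar0 LstarM] := andP Lstar_range.
pose k := Mstar * Lstar; pose m := M * (Lstar + C1).
have k0 : 0 <= k by rewrite mulr_ge0// ltW.
have k1 : k < 1 by rewrite /k mulrC -ltr_pdivlMr// div1r.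
have m0 : 0 <= m by rewrite mulr_ge0// addr_ge0// ltW.
(* This gives [m / lam < (1 - k) / 2], hence [q < (1 + k) / 2 < 1]; the summand 1 keeps [lam]
   positive when [m] vanishes. *)
pose lam := 2 * (m + 1) / (1 - k).
have lam0 : 0 < lam by rewrite divr_gt0//; lra.
pose q := k + m / lam.
have q01 : 0 <= q < 1.
  rewrite addr_ge0//=; last by rewrite divr_ge0// ltW.
  rewrite -ltrBrDl ltr_pdivrMr// mulrC /lam divfK; first lra.
  by rewrite gt_eqF// subr_gt0.
have [q0 q1] := andP q01.
have expT t : t <= T -> expR (lam * t) <= expR (lam * T).
  by move=> tT; rewrite ler_expR ler_wpM2l// ltW.
have exp1 t : 0 <= t -> 1 <= expR (lam * t).
  by move=> t0; rewrite -expR0 ler_expR mulr_ge0// ltW.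
have cL (x : R -> Omega -> X) t : continuous_L2 P (- tau) T x -> - tau <= t <= T -> L (x t).
  by move=> xc tT; have [] := proj1 (continuous_L2P P X_sep _ _ _) xc t tT.
have inT t : 0 <= t <= T -> - tau <= t <= T by move=> /andP[t0 tT]; lra.
have inP t : - tau <= t <= 0 -> - tau <= t <= T by move=> /andP[t0 tT]; lra.
have bnd (x y : R -> Omega -> X) : continuous_L2 P (- tau) T x -> continuous_L2 P (- tau) T y ->
    exists2 D, 0 <= D & forall t, 0 <= t <= T -> N (fun w => x t w - y t w) <= D.
  move=> xc yc; have tauT : - tau <= T by lra.
  have [Dx HDx] := continuous_L2_bounded X_sep tauT xc.
  have [Dy HDy] := continuous_L2_bounded X_sep tauT yc.
  have HD t : 0 <= t <= T -> N (fun w => x t w - y t w) <= Dx + Dy.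
    move=> /inT tT; apply: (@le_trans _ _ (N (x t) + N (y t))).
      rewrite -(nrmN mT X_sep (cL y t yc tT)).
      exact: (nrmD mT X_sep (cL x t xc tT) (L2N mT X_sep (cL y t yc tT))).
    by apply: lerD; [exact: HDx|exact: HDy].
  exists (Dx + Dy) => //; apply: le_trans (HD 0 _); [exact: nrm_ge0|by rewrite lexx].
have eq0 (u v : Omega -> X) : u = v -> N (fun w => u w - v w) <= 0.
  by move=> ->; rewrite (_ : (fun w => _) = fun=> 0) ?nrm0//; apply/funext => w; rewrite subrr.
have ae_of (u v : Omega -> X) : L u -> L v -> N (fun w => u w - v w) <= 0 ->
    {ae P, forall w, u w = v w}.
  move=> uL vL uv; have : N (fun w => u w - v w) = 0.
    by apply/eqP; rewrite eq_le uv nrm_ge0.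
  move/(nrm_eq0 mT (L2B mT X_sep uL vL)); apply: filterS => w /(_ I)/eqP.
  by rewrite subr_eq0 => /eqP.
(* Any continuous extension of [phi] can start the iteration; the constant one is the simplest. *)
pose x0 t := if t <= 0 then phi t else phi 0.
have phiP := proj1 (continuous_L2P P X_sep _ _ _) phi_cont.
have adm0 : admissible x0.
  split; last by move=> t t0; rewrite /x0 t0.
  apply: (continuous_L2_glue X_sep (b := 0)).
    by apply: (continuous_L2_ext X_sep _ phi_cont) => t /andP[_ t0]; rewrite /x0 t0.
  apply: (continuous_L2_ext X_sep (x := fun=> phi 0)).
    move=> t /andP[t0 _]; rewrite /x0; case: ifP => // t0'.
    by congr phi; apply/eqP; rewrite eq_le t0 t0'.
  apply/(continuous_L2P P X_sep) => t _; split; first by have [|//] := phiP 0; lra.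
  apply: cvg_within_itv => e e0; exists 1 => // s _ _.
  by rewrite ger0_norm ?nrm_ge0//; apply: le_trans (eq0 _ _ erefl) _; exact: ltW.
have next_ (s : {x | admissible x}) : {s' : {x | admissible x} | mild_step (sval s) (sval s')}.
  apply: cid; have [z [zadm zs]] := mild_step_exists (svalP s).
  by exists (exist _ z zadm).
pose xs n := iter n (fun s => sval (next_ s)) (exist _ x0 adm0).
pose x_ n := sval (xs n).
have xadm n : admissible (x_ n) by exact: (svalP (xs n)).
have xstep n : mild_step (x_ n) (x_ n.+1) by exact: (svalP (next_ (xs n))).
have xL n t : 0 <= t <= T -> L (x_ n t) by move=> /inT; apply: cL; have [] := xadm n.
have xphi n t : t <= 0 -> x_ n t = phi t by have [_] := xadm n; exact.
have [D D0 HD] := bnd _ _ (xadm 1%N).1 (xadm 0%N).1.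
have incr n : forall t, 0 <= t <= T ->
    N (fun w => x_ n.+1 t w - x_ n t w) <= q ^+ n * D * expR (lam * t).
  elim: n => [|n IH] t tT.
    rewrite expr0 mul1r; apply: le_trans (HD t tT) _.
    by rewrite ler_peMr// exp1//; case/andP: tT.
  have := mild_step_contract (D := q ^+ n * D) lam0 _ (xadm n.+1).1 (xadm n).1 (xstep n.+1) (xstep n).
  move=> /(_ _ _ IH t tT)/le_trans; apply.
  - by rewrite mulr_ge0// exprn_ge0.
  - by move=> s /andP[_ s0]; apply: eq0; rewrite !xphi.
  by rewrite exprS !mulrA.
(* Sum of the geometric series of the increments, with the weight at its largest value; [cE] is the
   recursion that drives [tail]. *)
pose c := D * expR (lam * T) / (1 - q).
have q1' : 0 < 1 - q by rewrite subr_gt0.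
have c0 : 0 <= c by rewrite divr_ge0 ?mulr_ge0 ?expR_ge0// ltW.
have qc0 n : 0 <= q ^+ n * c by apply: mulr_ge0 => //; exact: exprn_ge0.
have cE : q * c + D * expR (lam * T) = c by rewrite /c; field; rewrite gt_eqF.
have tail j : forall n t, 0 <= t <= T -> N (fun w => x_ (n + j)%N t w - x_ n t w) <= q ^+ n * c.
  elim: j => [|j IH] n t tT.
    by rewrite addn0; apply: le_trans (eq0 _ _ erefl) _.
  rewrite addnS -addSn.
  apply: le_trans (nrm_dist mT X_sep (xL _ t tT) (xL n.+1 t tT) (xL _ t tT)) _.
  rewrite -cE mulrDr mulrA -exprSr; apply: lerD; first exact: IH.
  apply: le_trans (incr n t tT) _; rewrite -mulrA ler_wpM2l ?exprn_ge0//.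
  by rewrite ler_wpM2l// expT//; case/andP: tT.
have qc : q ^+ n * c @[n --> \oo] --> (0 : R).
  rewrite -(mul0r c); apply: cvgM; last exact: cvg_cst.
  by apply: cvg_expr; rewrite ger0_norm.
(* The limit is taken at each time separately but with a rate independent of [t], from which its
   continuity follows. *)
have v_ t : {v | 0 <= t <= T -> L v /\ forall n, N (fun w => x_ n t w - v w) <= q ^+ n * c}.
  apply: cid; case: (boolP (0 <= t <= T)) => [tT|_]; last by exists (fun=> 0).
  have [|v vL vc] := L2P_complete X_sep (u := fun n => x_ n t) (fun n => xL n t tT).
    move=> e e0; have e2 : 0 < e / 2 by rewrite divr_gt0.
    have /cvgrPdist_le/(_ _ e2)[n0 _ /(_ n0 (leqnn n0))] := qc.
    rewrite /= sub0r normrN ger0_norm ?qc0// => Hn0.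
    have near0 n : (n0 <= n)%N -> N (fun w => x_ n t w - x_ n0 t w) <= e / 2.
      by move=> nn; rewrite -(subnKC nn); exact: le_trans (tail _ _ _ tT) Hn0.
    exists n0 => i j ni nj.
    apply: le_trans (nrm_dist mT X_sep (xL i t tT) (xL n0 t tT) (xL j t tT)) _.
    by rewrite (splitr e) lerD ?near0// nrmB near0.
  exists v => _; split => // n; apply/ler_addgt0Pr => e e0.
  have /cvgrPdist_le/(_ _ e0)[j0 _ /(_ (n + j0)%N (leq_addl _ _))] := vc.
  rewrite /= sub0r normrN ger0_norm ?nrm_ge0// => Hj.
  apply: le_trans (nrm_dist mT X_sep (xL n t tT) (xL (n + j0)%N t tT) vL) _.
  by apply: lerD => //; rewrite nrmB; exact: tail.
pose x t := if t <= 0 then phi t else sval (v_ t).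
have xlim t : 0 <= t <= T -> L (x t) /\ forall n, N (fun w => x_ n t w - x t w) <= q ^+ n * c.
  move=> tT; rewrite /x; case: ifP => t0; last by have := svalP (v_ t) tT.
  split; first by have [|//] := phiP t; rewrite t0 andbT; case/andP: tT; lra.
  move=> n; rewrite xphi//; exact: le_trans (eq0 _ _ erefl) _.
have xadm' : admissible x.
  split; last by move=> t t0; rewrite /x t0.
  apply: (continuous_L2_glue X_sep (b := 0)).
    by apply: (continuous_L2_ext X_sep _ phi_cont) => t /andP[_ t0]; rewrite /x t0.
  apply/(continuous_L2P P X_sep) => t tT; have [xtL xtN] := xlim t tT; split => //.
  apply: cvg_within_itv => e e0; have e4 : 0 < e / 4 by rewrite divr_gt0.
  have e2 : 0 < e / 2 by rewrite divr_gt0.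
  have /cvgrPdist_le/(_ _ e4)[n _ /(_ n (leqnn n))] := qc.
  rewrite /= sub0r normrN ger0_norm ?qc0// => Hn.
  have [_ /cvg_within_itvP/(_ _ e2)[dl dl0 Hdl]] :=
    proj1 (continuous_L2P P X_sep _ _ _) (xadm n).1 t (inT t tT).
  exists dl => // s sT st; rewrite ger0_norm ?nrm_ge0//; have [xsL xsN] := xlim s sT.
  apply: le_trans (nrm_dist mT X_sep xsL (xL n t tT) xtL) _.
  have h1 := nrm_dist mT X_sep xsL (xL n s sT) (xL n t tT).
  have h2 := le_trans (xtN n) Hn.
  have h3 := Hdl s (inT s sT) st; rewrite ger0_norm ?nrm_ge0// in h3.
  have h4 := le_trans (xsN n) Hn; rewrite nrmB in h4.
  by apply: (le_trans (lerD h1 h2)); move: h3 h4; lra.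
(* The image [z] of the limit is within a geometric error of [x_ n.+1], hence almost surely equal to
   [x] at each time; [x] then satisfies the equation with the integrals found for [z]. *)
have [z [zadm zstep]] := mild_step_exists xadm'.
have xz t : 0 <= t <= T -> N (fun w => x t w - z t w) <= 0.
  move=> tT; have zL : L (z t) by apply: cL (inT t tT); case: zadm.
  have [xtL xtN] := xlim t tT.
  apply: (geo_le0 q01 (c := q * c * (1 + expR (lam * T)))) => n.
  have h1 := xtN n.+1; rewrite nrmB in h1.
  have := mild_step_contract (D := q ^+ n * c) lam0 (qc0 n) (xadm n).1 xadm'.1 (xstep n) zstep.
  move=> /(_ _ _ t tT)H2; have {}H2 : N (fun w => x_ n.+1 t w - z t w) <=
      q * (q ^+ n * c * expR (lam * t)).
    apply: H2.
      by move=> s /andP[_ s0]; apply: eq0; rewrite xphi// xadm'.2.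
    move=> s sT; apply: le_trans ((xlim s sT).2 n) _.
    by rewrite ler_peMr// exp1//; case/andP: sT.
  apply: le_trans (nrm_dist mT X_sep xtL (xL n.+1 t tT) zL) _.
  apply: (@le_trans _ _ (q ^+ n.+1 * c + q * (q ^+ n * c * expR (lam * T)))).
    apply: lerD => //; apply: le_trans H2 _; rewrite ler_wpM2l// ler_wpM2l//.
    by apply: expT; case/andP: tT.
  by rewrite le_eqVlt; apply/orP; left; apply/eqP; rewrite exprS; ring.
have [xc xphi'] := xadm'.
have zz : mild_step x x.
  split => //; first by move=> s /andP[_ s0]; rewrite xphi'//; exact: aeW.
  move=> s sT; have [_ _ /(_ s sT)[I1 [I2 [I3 [h1 h2 h3 hF]]]]] := zstep.
  exists I1, I2, I3; split => //.
  have := ae_of _ _ (xlim s sT).1 (cL z s zadm.1 (inT s sT)) (xz s sT).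
  by apply: filterS2 hF => w -> ->.
exists x => // y ystep t tT; have [yc yphi _] := ystep.
apply: ae_of; [exact: cL|exact: cL|].
have past s : - tau <= s <= 0 -> N (fun w => y s w - x s w) <= 0.
  move=> sT; have [s1 s0] := andP sT.
  rewrite (nrm_ae X_sep (cL y s yc (inP s sT)) (cL x s xc (inP s sT)))//.
  by rewrite xphi'//; exact: yphi.
have [t0|t0] := lerP t 0; first by apply: past; rewrite t0 andbT; case/andP: tT.
have [D2 D20 HD2] := bnd _ _ yc xc.
have iter n : forall s, 0 <= s <= T ->
    N (fun w => y s w - x s w) <= q ^+ n * D2 * expR (lam * s).
  elim: n => [|n IH] s sT.
    rewrite expr0 mul1r; apply: le_trans (HD2 s sT) _.
    by rewrite ler_peMr// exp1//; case/andP: sT.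
  have Dn : 0 <= q ^+ n * D2 by rewrite mulr_ge0// exprn_ge0.
  apply: le_trans (mild_step_contract lam0 Dn yc xc ystep zz past IH sT) _.
  by rewrite exprS !mulrA.
apply: (geo_le0 q01 (c := D2 * expR (lam * t))) => n.
by rewrite mulrA; apply: iter; rewrite ltW//=; case/andP: tT.
Qed.

End MildSolution.

Theorem theorem8 (R : realType) (d : measure_display)
  (Omega : measurableType d) (P : probability Omega R)
  (P_complete : measure_is_complete P)
  (X Y : hilbertType R) (X_separable : separable X) (Y_separable : separable Y)
  (H tau T : R) (H_range : 2^-1 < H < 1) (tau_gt0 : 0 < tau) (T_gt0 : 0 < T)
  (B : QfBm P Y H T)
  (A : R -> operator X) (U : R -> R -> X -> X)
  (A_closed : forall t : R, 0 <= t <= T -> closed_densely_defined (A t))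
  (A_dom : forall t s : R, 0 <= t <= T -> 0 <= s <= T -> dom (A t) = dom (A s))
  (A_AT : acquistapace_terreni T A)
  (A_generates : generates T A U)
  (f g : R -> X -> X) (sigma : R -> Y -> X) (r rho : R -> R)
  (phi : R -> Omega -> X)
  (sigma_L20 : forall t : R, 0 <= t <= T -> L20 B (sigma t))
  (sigma_meas : L20_measurable B `[0, T] sigma)
  (r_range : forall t : R, 0 <= t -> 0 <= r t <= tau)
  (rho_range : forall t : R, 0 <= t -> 0 <= rho t <= tau)
  (* (1) *)
  (beta M Mstar : R) (beta_gt0 : 0 < beta) (M_ge1 : 1 <= M)
  (U_exp : forall t s : R, 0 <= s -> s <= t -> t <= T ->
     (normL (U t s) <= (M * expR (- beta * (t - s)))%:E)%E)
  (A_inv : forall t : R, 0 <= t <= T -> boundedly_invertible (A t))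
  (Mstar_gt0 : 0 < Mstar)
  (A_inv_le : forall t : R, 0 <= t <= T -> (normL (op_inv (A t)) <= Mstar%:E)%E)
  (* (2) *)
  (f_cont : {within `[0, T] `*` setT, continuous (fun p : R * X => f p.1 p.2)})
  (g_cont : {within `[0, T] `*` setT, continuous (fun p : R * X => g p.1 p.2)})
  (g_dom : forall (t : R) (x : X), 0 <= t <= T -> dom (A t) (g t x))
  (C1 C2 : R) (C1_gt0 : 0 < C1) (C2_gt0 : 0 < C2)
  (f_lip : forall (t : R) (x y : X), 0 <= t <= T ->
     `|f t x - f t y| <= C1 * `|x - y|)
  (g_lip : forall (t : R) (x y : X), 0 <= t <= T ->
     `|g t x - g t y| <= C1 * `|x - y|)
  (f_growth : forall (t : R) (x : X), 0 <= t <= T ->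
     `|f t x| ^+ 2 <= C2 * (1 + `|x| ^+ 2))
  (g_growth : forall (t : R) (x : X), 0 <= t <= T ->
     `|g t x| ^+ 2 <= C2 * (1 + `|x| ^+ 2) /\
     `|A t (g t x)| ^+ 2 <= C2 * (1 + `|x| ^+ 2))
  (* (3) *)
  (Lstar : R) (Lstar_range : 0 < Lstar < Mstar^-1)
  (Ag_lip : forall (t : R) (x y : X), 0 <= t <= T ->
     `|A t (g t x) - A t (g t y)| <= Lstar * `|x - y|)
  (g_cont_L2 : forall x : R -> Omega -> X, continuous_L2 P 0 T x ->
     forall s : R, 0 <= s <= T ->
     'E_P[(fun w => `|g t (x t w) - g s (x s w)| ^+ 2)%R]%E
       @[t --> within `[0, T] (nbhs s)] --> 0%E)
  (* (4) *)
  (L : R) (L_gt0 : 0 < L)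
  (sigma_le : forall t : R, 0 <= t <= T ->
     (L20_norm2 B (sigma t) <= (L ^+ 2)%:E)%E)
  (r_cont : {within `[0, +oo[, continuous r})
  (rho_cont : {within `[0, +oo[, continuous rho})
  (phi_cont : continuous_L2 P (- tau) 0 phi) :
  exists2 x : R -> Omega -> X,
    mild_solution B tau A U f g sigma r rho phi x &
    forall y : R -> Omega -> X,
      mild_solution B tau A U f g sigma r rho phi y ->
      forall t : R, - tau <= t <= T -> {ae P, forall w, y t w = x t w}.
Proof.
have M_ge0 : 0 <= M by lra.
(* As [s <= t] and [beta > 0], the exponential factor is at most 1, so [M] bounds all the
   operators. *)
have U_M t s : 0 <= s -> s <= t -> t <= T -> (normL (U t s) <= M%:E)%E.
  move=> s0 st tT; apply: le_trans (U_exp t s s0 st tT) _.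
  rewrite lee_fin ler_piMr// -expR0 ler_expR mulNr oppr_le0 mulr_ge0 ?subr_ge0//.
  exact: ltW.
have [x xs xu] := mild_step_fixpoint X_separable H_range tau_gt0 T_gt0 A_closed A_generates
  sigma_L20 sigma_meas sigma_le r_range rho_range M_ge0 U_M A_inv Mstar_gt0 A_inv_le
  f_cont g_cont g_dom (ltW C1_gt0) (ltW C2_gt0) f_lip g_lip f_growth
  (fun t x tT => (g_growth t x tT).1) (fun t x tT => (g_growth t x tT).2)
  Lstar_range Ag_lip r_cont rho_cont phi_cont.
by exists x.
Qed.
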